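(* Fix $L>0$ and initial data $$\theta(0)=\theta_0,\qquad\theta'(0)=a_0,\qquad\theta''(0)=b_0,\qquad\rho(0)=\rho_0>0.$$ Define $$k_{1,0}=a_0+\frac{\sinh\theta_0}{L},\qquad H_0=-\frac{a_0}{2}-\frac{\sinh\theta_0}{L},\qquad H_0'=-\frac{b_0}{2}-\frac{a_0\cosh\theta_0}{L}.$$ Assume $$k_{1,0}\neq0,\qquad H_0\neq0,\qquad H_0'\neq0,\qquad H_0\neq k_{1,0},$$ and choose $u_0$ so that $u_0/H_0>0$. Consider the scalar third-order equation $$\Bigl(\frac{H'}{k_1}\Bigr)'+\Bigl(\frac{H'}{k_1}\Bigr)^2+\frac{\cosh\theta}{L}\frac{H'}{k_1}+k_1^2+\frac{\sinh^2\theta}{L^2}-\frac2{L^2}=0,\qquad k_1=\theta'+\frac{\sinh\theta}{L},\quad H=-\frac{\theta'}2-\frac{\sinh\theta}{L}.$$ Then the initial-value problem for this equation with the data $(\theta_0,a_0,b_0)$ has a unique local real-analytic solution $\theta$, and the associated functions $$\rho(s)=\rho_0\exp\Bigl[\frac1L\int_0^s\cosh\theta(\tau)\,d\tau\Bigr],\quad u(s)=u_0\exp\Bigl[\int_0^s\frac{H'(\tau)}{k_1(\tau)}\,d\tau\Bigr],\quad\lambda(s)^2=\frac{u(s)}{H(s)}$$ are uniquely determined by the stated initial data. Moreover, there exists, for some $\delta>0$ and an interval $J\subset\mathbb R$, a local real-analytic spacelike parabolic rotational immersion $X:(-\delta,\delta)\times J\to\mathrm{AdS}_3(L)$, with induced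 metric $g=ds^2+\rho^2dt^2$, which is a proper biharmonic conformal immersion (with respect to the source metric $\lambda^{-2}g$). The immersion is unique up to an ambient isometry of $\mathrm{AdS}_3(L)$. Both $H$ and $\lambda$ are nonconstant. The conditions $k_{1,0}\neq0$, $H_0\neq0$, $H_0'\neq0$, $H_0\neq k_{1,0}$ define an open subset of the initial-data space.
   Context: $\mathrm{AdS}_3(L)=\{X\in\mathbb R^{2,2}:\langle X,X\rangle=-L^2\}$ with $\langle X,X\rangle=-X_0^2-X_1^2+X_2^2+X_3^2$, carrying the induced Lorentzian metric of constant curvature $-1/L^2$. The immersion $X$ associated with $\theta$ is the one with induced metric $g=ds^2+\rho(s)^2dt^2$, timelike unit normal $\xi$, and shape operator $A$ ($\nabla^N_Y\xi=-AY$) given by $A\partial_s=k_1\partial_s$, $A\partial_t=k_2\partial_t$, where $k_1=\theta'+\frac{\sinh\theta}{L}$, $k_2=\frac{\sinh\theta}{L}$ and $q=\rho'/\rho=\frac{\cosh\theta}{L}$. Its scalar mean curvature, defined by mean-curvature vector $=H\xi$ (mean-curvature vector $=$ half the trace of the second fundamental form), is $H=-\frac12\operatorname{tr}_gA=-\frac{k_1+k_2}2$. Spacelike means $g$ is Riemannian. Parabolic rotational means that $X_t=\mathcal BX$ for a constant $\mathcal B\in\mathfrak{so}(2,2)$ (skew-adjoint endomorphism of $\mathbb R^{2,2}$) of rank two with $\mathcal B^3=0$, $\mathcal B^2\neq0$. For a smooth map $\phi:(M,g')\to(N,h)$ between pseudo-Riemannian manifolds, $\tau_{g'}(\phi)=\operatorname{tr}_{g'}\nabla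 d\phi$ and $\tau_{2,g'}(\phi)=\Delta^\phi_{g'}\tau_{g'}(\phi)-\sum_i\epsilon_iR^N(d\phi(e_i),\tau_{g'}(\phi))d\phi(e_i)$, where $\{e_i\}$ is a local $g'$-pseudo-orthonormal frame with $g'(e_i,e_j)=\epsilon_i\delta_{ij}$, $\Delta^\phi_{g'}V=\sum_i\epsilon_i(\nabla^\phi_{e_i}\nabla^\phi_{e_i}V-\nabla^\phi_{\nabla_{e_i}e_i}V)$, and $R^N(X,Y)=[\nabla^N_X,\nabla^N_Y]-\nabla^N_{[X,Y]}$. The map is biharmonic if $\tau_{2,g'}(\phi)=0$; proper biharmonic means biharmonic but not harmonic ($\tau_{g'}(\phi)\not\equiv0$). Primes denote $d/ds$. *)

(* Defs.v *)
From Stdlib Require Export Reals.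
From Coquelicot Require Export Coquelicot.

Open Scope R_scope.

Definition analytic_at (f : R -> R) (x : R) : Prop :=
  exists a : nat -> R,
    Rbar_lt 0 (CV_radius a) /\ locally x (fun y => f y = PSeries a (y - x)).

(* Absolutely convergent double power series around [p]. *)
Definition analytic2_at (f : R * R -> R) (p : R * R) : Prop :=
  exists (a : nat -> nat -> R) (r : R), 0 < r /\
    forall h k : R, Rabs h < r -> Rabs k < r ->
      (forall m, ex_series (fun n => Rabs (a m n * h ^ m * k ^ n))) /\
      ex_series (fun m => Series (fun n => Rabs (a m n * h ^ m * k ^ n))) /\
      f (fst p + h, snd p + k) = Series (fun m => Series (fun n => a m n * h ^ m * k ^ n)).

Fixpoint class_C (n : nat) {V W : NormedModule R_AbsRing} (D : V -> Prop) (f : V -> W)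
    {struct n} : Prop :=
  match n with
  | O => forall p, D p -> continuous f p
  | S m => exists df : V -> V -> W,
      (forall p, D p -> filterdiff f (locally p) (df p)) /\
      (forall v, class_C m D (fun p => df p v))
  end.

Definition smooth_on {V W : NormedModule R_AbsRing} (D : V -> Prop) (f : V -> W) : Prop :=
  forall n, class_C n D f.

Notation R22 := (R * R * R * R)%type.

Definition c0 (x : R22) : R := fst (fst (fst x)).
Definition c1 (x : R22) : R := snd (fst (fst x)).
Definition c2 (x : R22) : R := snd (fst x).
Definition c3 (x : R22) : R := snd x.

Definition ip (x y : R22) : R :=
  - c0 x * c0 y - c1 x * c1 y + c2 x * c2 y + c3 x * c3 y.

Definition AdS (L : R) (p : R22) : Prop := ip p p = - L ^ 2.

(* Orthogonal projection onto the tangent space at [p] of the quadric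
   [ip q q = ip p p]; the tangent space is the [ip]-orthogonal of [p]. *)
Definition tanproj (p v : R22) : R22 := minus v (scal (ip v p / ip p p) p).

Definition vDerive (f : R -> R22) (x : R) : R22 :=
  (Derive (fun y => c0 (f y)) x, Derive (fun y => c1 (f y)) x,
   Derive (fun y => c2 (f y)) x, Derive (fun y => c3 (f y)) x).

(* Flat derivative of the field [Z] along the field [Y] in R^{2,2}. *)
Definition flatD (Y Z : R22 -> R22) (p : R22) : R22 :=
  vDerive (fun h => Z (plus p (scal h (Y p)))) 0.

(* The Levi-Civita connection of a nondegenerate submanifold of R^{2,2} is the
   tangential part of the flat derivative.  Fields below are defined near the
   quadric and tangent to all the quadrics [ip q q = const]. *)
Definition nablaN (Y Z : R22 -> R22) (p : R22) : R22 := tanproj p (flatD Y Z p).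

Definition bracketN (Y Z : R22 -> R22) (p : R22) : R22 :=
  minus (flatD Y Z p) (flatD Z Y p).

Definition curv_field (X Y Z : R22 -> R22) (p : R22) : R22 :=
  minus (minus (nablaN X (nablaN Y Z) p) (nablaN Y (nablaN X Z) p))
        (nablaN (bracketN X Y) Z p).

(* R^N(x,y)z for vectors tangent at [p]: by tensoriality it is evaluated on the
   tangent fields [q |-> tanproj q x] extending them. *)
Definition curvN (p x y z : R22) : R22 :=
  curv_field (fun q => tanproj q x) (fun q => tanproj q y) (fun q => tanproj q z) p.

(* A smooth map of the quadric is one that extends smoothly to a neighbourhood. *)
Definition AdS_isometry (L : R) (F : R22 -> R22) : Prop :=
  exists (G : R22 -> R22) (U : R22 -> Prop),
    open U /\ (forall p, AdS L p -> U p) /\ smooth_on U F /\ smooth_on U G /\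
    (forall p, AdS L p -> AdS L (F p) /\ AdS L (G p) /\ G (F p) = p /\ F (G p) = p) /\
    (forall p, AdS L p -> exists dF : R22 -> R22,
        filterdiff F (locally p) dF /\
        forall v w, ip v p = 0 -> ip w p = 0 -> ip (dF v) (dF w) = ip v w).

Inductive ix : Set := i1 | i2.

Definition sum2 {G : AbelianMonoid} (f : ix -> G) : G := plus (f i1) (f i2).

Definition coord (i : ix) (p : R * R) : R := match i with i1 => fst p | i2 => snd p end.

Definition line (i : ix) (p : R * R) (x : R) : R * R :=
  match i with i1 => (x, snd p) | i2 => (fst p, x) end.

Definition pd (i : ix) (f : R * R -> R) (p : R * R) : R :=
  Derive (fun x => f (line i p x)) (coord i p).

Definition vpd (i : ix) (V : R * R -> R22) (p : R * R) : R22 :=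
  vDerive (fun x => V (line i p x)) (coord i p).

Definition metric := ix -> ix -> R * R -> R.
Definition vfield := R * R -> ix -> R.

Definition metric_det (g : metric) (p : R * R) : R :=
  g i1 i1 p * g i2 i2 p - g i1 i2 p * g i2 i1 p.

Definition metric_inv (g : metric) (i j : ix) (p : R * R) : R :=
  match i, j with
  | i1, i1 => g i2 i2 p / metric_det g p
  | i2, i2 => g i1 i1 p / metric_det g p
  | _, _ => - g i j p / metric_det g p
  end.

Definition christoffel (g : metric) (k i j : ix) (p : R * R) : R :=
  / 2 * sum2 (fun l => metric_inv g k l p *
                (pd i (g j l) p + pd j (g i l) p - pd l (g i j) p)).

Definition nabla_src (g : metric) (Y Z : vfield) : vfield := fun p k =>
  sum2 (fun i => Y p i * pd i (fun q => Z q k) p) +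
  sum2 (fun i => sum2 (fun j => christoffel g k i j p * Y p i * Z p j)).

Definition dmap (phi : R * R -> R22) (Y : vfield) (p : R * R) : R22 :=
  sum2 (fun k => scal (Y p k) (vpd k phi p)).

Definition nabla_phi (phi : R * R -> R22) (Y : vfield) (V : R * R -> R22) (p : R * R) : R22 :=
  tanproj (phi p) (sum2 (fun k => scal (Y p k) (vpd k V p))).

Definition ortho_frame (D : R * R -> Prop) (g : metric) (eps : ix -> R) (e : ix -> vfield)
    : Prop :=
  (forall i, eps i = 1 \/ eps i = -1) /\
  (forall i k, smooth_on D (fun p => e i p k)) /\
  (forall p, D p -> forall i j,
     sum2 (fun k => sum2 (fun l => g k l p * e i p k * e j p l)) =
     match i, j with i1, i1 | i2, i2 => eps i | _, _ => 0 end).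

Definition tension (g : metric) (eps : ix -> R) (e : ix -> vfield)
    (phi : R * R -> R22) (p : R * R) : R22 :=
  sum2 (fun i => scal (eps i)
    (minus (nabla_phi phi (e i) (dmap phi (e i)) p)
           (dmap phi (nabla_src g (e i) (e i)) p))).

Definition laplacian (g : metric) (eps : ix -> R) (e : ix -> vfield)
    (phi V : R * R -> R22) (p : R * R) : R22 :=
  sum2 (fun i => scal (eps i)
    (minus (nabla_phi phi (e i) (nabla_phi phi (e i) V) p)
           (nabla_phi phi (nabla_src g (e i) (e i)) V p))).

Definition bitension (g : metric) (eps : ix -> R) (e : ix -> vfield)
    (phi : R * R -> R22) (p : R * R) : R22 :=
  minus (laplacian g eps e phi (tension g eps e phi) p)
        (sum2 (fun i => scal (eps i)
           (curvN (phi p) (dmap phi (e i) p) (tension g eps e phi p) (dmap phi (e i) p)))).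

(* Tension and bitension do not depend on the frame, so the quantification over
   all local frames amounts to the use of any one of them near each point. *)
Definition harmonic (D : R * R -> Prop) (g : metric) (phi : R * R -> R22) : Prop :=
  forall (D' : R * R -> Prop) (eps : ix -> R) (e : ix -> vfield),
    open D' -> (forall p, D' p -> D p) -> ortho_frame D' g eps e ->
    forall p, D' p -> tension g eps e phi p = zero.

Definition biharmonic (D : R * R -> Prop) (g : metric) (phi : R * R -> R22) : Prop :=
  forall (D' : R * R -> Prop) (eps : ix -> R) (e : ix -> vfield),
    open D' -> (forall p, D' p -> D p) -> ortho_frame D' g eps e ->
    forall p, D' p -> bitension g eps e phi p = zero.

Definition proper_biharmonic (D : R * R -> Prop) (g : metric) (phi : R * R -> R22) : Prop :=
  biharmonic D g phi /\ ~ harmonic D g phi.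

Definition induced (X : R * R -> R22) : metric := fun i j p => ip (vpd i X p) (vpd j X p).

(* Positive definiteness of the induced metric also makes [X] an immersion. *)
Definition spacelike (D : R * R -> Prop) (X : R * R -> R22) : Prop :=
  forall p, D p -> forall v : ix -> R, v i1 <> 0 \/ v i2 <> 0 ->
    0 < sum2 (fun i => sum2 (fun j => induced X i j p * v i * v j)).

Definition conformal (D : R * R -> Prop) (g : metric) (lam : R * R -> R) (X : R * R -> R22)
    : Prop :=
  forall p, D p -> 0 < lam p /\ forall i j, induced X i j p = lam p ^ 2 * g i j p.

Definition skew_adjoint (B : R22 -> R22) : Prop :=
  is_linear B /\ forall x y, ip (B x) y = - ip x (B y).

Definition rank_two (B : R22 -> R22) : Prop :=
  exists x y : R22,
    (forall a b : R, plus (scal a (B x)) (scal b (B y)) = zero -> a = 0 /\ b = 0) /\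
    (forall z, exists a b : R, B z = plus (scal a (B x)) (scal b (B y))).

Definition parabolic_rotational (D : R * R -> Prop) (X : R * R -> R22) : Prop :=
  exists B : R22 -> R22,
    skew_adjoint B /\ rank_two B /\
    (forall x, B (B (B x)) = zero) /\ (exists x, B (B x) <> zero) /\
    (forall p, D p -> vpd i2 X p = B (X p)).

Definition analytic_map (D : R * R -> Prop) (X : R * R -> R22) : Prop :=
  forall p, D p ->
    analytic2_at (fun q => c0 (X q)) p /\ analytic2_at (fun q => c1 (X q)) p /\
    analytic2_at (fun q => c2 (X q)) p /\ analytic2_at (fun q => c3 (X q)) p.

Definition is_open_interval (J : R -> Prop) : Prop :=
  open J /\ (exists t, J t) /\ (forall x y z, J x -> J z -> x <= y <= z -> J y).

Definition strip (delta : R) (J : R -> Prop) (p : R * R) : Prop :=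
  Rabs (fst p) < delta /\ J (snd p).

Definition k1 (L : R) (theta : R -> R) (s : R) : R := Derive theta s + sinh (theta s) / L.
Definition k2 (L : R) (theta : R -> R) (s : R) : R := sinh (theta s) / L.
Definition H (L : R) (theta : R -> R) (s : R) : R :=
  - Derive theta s / 2 - sinh (theta s) / L.

Definition H'_over_k1 (L : R) (theta : R -> R) (s : R) : R :=
  Derive (H L theta) s / k1 L theta s.

Definition rho (L rho0 : R) (theta : R -> R) (s : R) : R :=
  rho0 * exp (1 / L * RInt (fun x => cosh (theta x)) 0 s).

Definition u (L u0 : R) (theta : R -> R) (s : R) : R :=
  u0 * exp (RInt (H'_over_k1 L theta) 0 s).

Definition lambda2 (L u0 : R) (theta : R -> R) (s : R) : R := u L u0 theta s / H L theta s.
Definition lambda (L u0 : R) (theta : R -> R) (s : R) : R := sqrt (lambda2 L u0 theta s).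

Definition rot_metric (r : R -> R) : metric := fun i j p =>
  match i, j with i1, i1 => 1 | i2, i2 => r (fst p) ^ 2 | _, _ => 0 end.

Definition source_metric (r lam : R -> R) : metric := fun i j p =>
  / lam (fst p) ^ 2 * rot_metric r i j p.

Definition k1_init (L theta0 a0 : R) : R := a0 + sinh theta0 / L.
Definition H_init (L theta0 a0 : R) : R := - a0 / 2 - sinh theta0 / L.
Definition H'_init (L theta0 a0 b0 : R) : R := - b0 / 2 - a0 * cosh theta0 / L.

Definition admissible (L theta0 a0 b0 : R) : Prop :=
  k1_init L theta0 a0 <> 0 /\ H_init L theta0 a0 <> 0 /\
  H'_init L theta0 a0 b0 <> 0 /\ H_init L theta0 a0 <> k1_init L theta0 a0.

(* The condition [k1 <> 0] is what makes the quotients of the equation meaningful. *)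
Definition ivp_solution (L theta0 a0 b0 delta : R) (theta : R -> R) : Prop :=
  (forall s, Rabs s < delta -> analytic_at theta s) /\
  (forall s, Rabs s < delta ->
     k1 L theta s <> 0 /\
     Derive (H'_over_k1 L theta) s + H'_over_k1 L theta s ^ 2
       + cosh (theta s) / L * H'_over_k1 L theta s
       + k1 L theta s ^ 2 + sinh (theta s) ^ 2 / L ^ 2 - 2 / L ^ 2 = 0) /\
  theta 0 = theta0 /\ Derive theta 0 = a0 /\ Derive_n theta 2 0 = b0.

(* [rho], [lambda]: the coefficient of the induced metric ds^2 + rho^2 dt^2 and
   the conformal factor. *)
Definition rotational_biharmonic_immersion (L delta : R) (J : R -> Prop) (rho lambda : R -> R)
    (X : R * R -> R22) : Prop :=
  let D := strip delta J in
  let g' := source_metric rho lambda in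
  (forall p, D p -> AdS L (X p)) /\
  analytic_map D X /\
  spacelike D X /\
  parabolic_rotational D X /\
  (forall p, D p -> forall i j, induced X i j p = rot_metric rho i j p) /\
  conformal D g' (fun p => lambda (fst p)) X /\
  proper_biharmonic D g' X.

(* [xi] is a timelike unit normal of [X] in the quadric for which the shape operator
   has eigenvalues [k1], [k2] on the coordinate fields and the mean curvature vector
   is [H xi]; the second fundamental form of an isometric immersion is its Hessian,
   so its trace is the tension for the induced metric. *)
Definition unit_normal_with_shape (D : R * R -> Prop) (k1 k2 H : R -> R)
    (X xi : R * R -> R22) : Prop :=
  analytic_map D xi /\
  forall p, D p ->
    ip (xi p) (xi p) = -1 /\ ip (xi p) (X p) = 0 /\
    (forall i, ip (xi p) (vpd i X p) = 0) /\
    tanproj (X p) (vpd i1 xi p) = opp (scal (k1 (fst p)) (vpd i1 X p)) /\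
    tanproj (X p) (vpd i2 xi p) = opp (scal (k2 (fst p)) (vpd i2 X p)) /\
    (forall (D' : R * R -> Prop) (eps : ix -> R) (e : ix -> vfield),
       open D' -> (forall q, D' q -> D q) -> D' p -> ortho_frame D' (induced X) eps e ->
       scal (/ 2) (tension (induced X) eps e X p) = scal (H (fst p)) (xi p)).

(* Main.v *)
From Stdlib Require Import List Lra Lia FunctionalExtensionality ClassicalEpsilon.
Require Import Defs.

Open Scope R_scope.

(** The theorem rests on one remark and one explicit formula.

    The remark: with [p = theta'], [w = H'/k1], [S = sinh theta], [C = cosh theta], the
    third-order equation becomes a first-order system with _quadratic_ right-hand sides, and
    this persists when [rho], [1/rho], [z = int S/rho] and [u] are added to the unknowns.  For a
    quadratic system the coefficients of the formal power series solution satisfy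
    [|a_n| <= M K^n] by a one-line induction ([coef_bound]), which gives local analytic
    solutions ([qsystem_exists]).  Uniqueness on an interval is Gronwall's inequality
    ([qsolution_unique]); and solving the system afresh at each point shows that every
    solution is analytic wherever it is defined ([qsolution_analytic]).  So existence,
    uniqueness and the analyticity of all the associated functions come together.

    The formula: a parabolic one-parameter group has, in a null frame [n, e, m, f], the form
    [m -> m + t e + t^2/2 n], [e -> e + t n], and it fixes [n] and [f].  Taking the orbit of a
    curve with coordinates [rho] along [m], [rho z] along [f], none along [e] and the last one
    fixed by [<X, X> = - L^2], and given [rho'/rho = C/L], the induced metric is
    [ds^2 + rho^2 dt^2] exactly when [(rho z')^2 = S^2] ([imm]).  Its Gauss-Weingarten equations
    ([imm_surface]) have principal curvatures [k1], [k2].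

    In dimension two the tension field for [lambda^{-2} g] is [lambda^2] times that for [g],
    hence [2 lambda^2 H xi = 2 u xi], and the Laplacian of sections scales in the same way
    ([frame_trace]).  The bitension is therefore the Jacobi operator at [2 u xi]
    ([surface_biharmonic]).  Its tangential part vanishes iff [k1 u' = u H'], which is
    [u'/u = w]; its normal part vanishes iff
    [u'' + q u' + u (k1^2 + k2^2 - 2/L^2) = 0], which is then the equation for [theta].

    For the uniqueness of the immersion, a null frame is built from [X(0,t0)], [B X(0,t0)] and
    [B^2 X(0,t0)] ([parabolic_frame]), and the induced metric determines all the coordinates in
    it but for the sign of [rho z' = +- S] ([canonical_form]).  Two immersions are thus
    exchanged by the linear map that exchanges their frames.  *)

(** * Vectors of the pseudo-Euclidean space *)

Lemma R22_ext (x y : R22) :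
  c0 x = c0 y -> c1 x = c1 y -> c2 x = c2 y -> c3 x = c3 y -> x = y.
Proof.
  destruct x as [[[x0 x1] x2] x3], y as [[[y0 y1] y2] y3].
  unfold c0, c1, c2, c3; simpl; intros; subst; reflexivity.
Qed.

Lemma c0_plus x y : c0 (plus x y) = c0 x + c0 y. Proof. reflexivity. Qed.
Lemma c1_plus x y : c1 (plus x y) = c1 x + c1 y. Proof. reflexivity. Qed.
Lemma c2_plus x y : c2 (plus x y) = c2 x + c2 y. Proof. reflexivity. Qed.
Lemma c3_plus x y : c3 (plus x y) = c3 x + c3 y. Proof. reflexivity. Qed.
Lemma c0_scal (a : R) x : c0 (scal a x) = a * c0 x. Proof. reflexivity. Qed.
Lemma c1_scal (a : R) x : c1 (scal a x) = a * c1 x. Proof. reflexivity. Qed.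
Lemma c2_scal (a : R) x : c2 (scal a x) = a * c2 x. Proof. reflexivity. Qed.
Lemma c3_scal (a : R) x : c3 (scal a x) = a * c3 x. Proof. reflexivity. Qed.
Lemma c0_opp x : c0 (opp x) = - c0 x. Proof. reflexivity. Qed.
Lemma c1_opp x : c1 (opp x) = - c1 x. Proof. reflexivity. Qed.
Lemma c2_opp x : c2 (opp x) = - c2 x. Proof. reflexivity. Qed.
Lemma c3_opp x : c3 (opp x) = - c3 x. Proof. reflexivity. Qed.
Lemma c0_minus x y : c0 (minus x y) = c0 x - c0 y. Proof. reflexivity. Qed.
Lemma c1_minus x y : c1 (minus x y) = c1 x - c1 y. Proof. reflexivity. Qed.
Lemma c2_minus x y : c2 (minus x y) = c2 x - c2 y. Proof. reflexivity. Qed.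
Lemma c3_minus x y : c3 (minus x y) = c3 x - c3 y. Proof. reflexivity. Qed.
Lemma c0_zero : c0 (zero : R22) = 0. Proof. reflexivity. Qed.
Lemma c1_zero : c1 (zero : R22) = 0. Proof. reflexivity. Qed.
Lemma c2_zero : c2 (zero : R22) = 0. Proof. reflexivity. Qed.
Lemma c3_zero : c3 (zero : R22) = 0. Proof. reflexivity. Qed.
Lemma c0_mk a b c d : c0 (a, b, c, d) = a. Proof. reflexivity. Qed.
Lemma c1_mk a b c d : c1 (a, b, c, d) = b. Proof. reflexivity. Qed.
Lemma c2_mk a b c d : c2 (a, b, c, d) = c. Proof. reflexivity. Qed.
Lemma c3_mk a b c d : c3 (a, b, c, d) = d. Proof. reflexivity. Qed.

Create HintDb r22.
Hint Rewrite c0_plus c1_plus c2_plus c3_plus c0_scal c1_scal c2_scal c3_scal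
  c0_opp c1_opp c2_opp c3_opp c0_minus c1_minus c2_minus c3_minus
  c0_zero c1_zero c2_zero c3_zero c0_mk c1_mk c2_mk c3_mk : r22.

Ltac Rring := match goal with |- @eq _ ?a ?b => change (@eq R a b) end; ring.

Ltac vec_ring := apply R22_ext; autorewrite with r22; ring.

Lemma scal_m1 (v : R22) : scal (-1) v = opp v.
Proof. vec_ring. Qed.

Lemma scal_m1_mult (a : R) (v : R22) : scal (-1 * a) v = scal (- a) v.
Proof. vec_ring. Qed.

Lemma ip_comm x y : ip x y = ip y x.
Proof. unfold ip; ring. Qed.
Lemma ip_plus_l x y z : ip (plus x y) z = ip x z + ip y z.
Proof. unfold ip; autorewrite with r22; ring. Qed.
Lemma ip_scal_l (a : R) x z : ip (scal a x) z = a * ip x z.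
Proof. unfold ip; autorewrite with r22; ring. Qed.
Lemma ip_opp_l x z : ip (opp x) z = - ip x z.
Proof. unfold ip; autorewrite with r22; ring. Qed.
Lemma ip_minus_l x y z : ip (minus x y) z = ip x z - ip y z.
Proof. unfold ip; autorewrite with r22; ring. Qed.
Lemma ip_zero_l z : ip zero z = 0.
Proof. unfold ip; autorewrite with r22; ring. Qed.
Lemma ip_plus_r x y z : ip z (plus x y) = ip z x + ip z y.
Proof. unfold ip; autorewrite with r22; ring. Qed.
Lemma ip_scal_r (a : R) x z : ip z (scal a x) = a * ip z x.
Proof. unfold ip; autorewrite with r22; ring. Qed.
Lemma ip_opp_r x z : ip z (opp x) = - ip z x.
Proof. unfold ip; autorewrite with r22; ring. Qed.
Lemma ip_minus_r x y z : ip z (minus x y) = ip z x - ip z y.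
Proof. unfold ip; autorewrite with r22; ring. Qed.
Lemma ip_zero_r z : ip z zero = 0.
Proof. unfold ip; autorewrite with r22; ring. Qed.

Create HintDb ipdb.
Hint Rewrite ip_plus_l ip_scal_l ip_opp_l ip_minus_l ip_zero_l
  ip_plus_r ip_scal_r ip_opp_r ip_minus_r ip_zero_r : ipdb.

Lemma tanproj_plus p v w : tanproj p (plus v w) = plus (tanproj p v) (tanproj p w).
Proof. unfold tanproj; rewrite ip_plus_l; unfold Rdiv; vec_ring. Qed.

Lemma tanproj_scal p (a : R) v : tanproj p (scal a v) = scal a (tanproj p v).
Proof. unfold tanproj; rewrite ip_scal_l; unfold Rdiv; vec_ring. Qed.

Lemma tanproj_tangent p v : ip v p = 0 -> tanproj p v = v.
Proof. intros h; unfold tanproj; rewrite h; unfold Rdiv; vec_ring. Qed.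

Lemma tanproj_self p : ip p p <> 0 -> tanproj p p = zero.
Proof.
  intros h; unfold tanproj.
  replace (ip p p / ip p p) with 1 by (field; exact h); vec_ring.
Qed.

Lemma ip_tanproj p v : ip p p <> 0 -> ip (tanproj p v) p = 0.
Proof. intros h; unfold tanproj; rewrite ip_minus_l, ip_scal_l; field; exact h. Qed.

(** * Partial derivatives *)

Definition is_pd (i : ix) (f : R * R -> R) (p : R * R) (l : R) : Prop :=
  is_derive (fun x => f (line i p x)) (coord i p) l.

Definition is_vderive (f : R -> R22) (x : R) (l : R22) : Prop :=
  is_derive (fun y => c0 (f y)) x (c0 l) /\ is_derive (fun y => c1 (f y)) x (c1 l) /\
  is_derive (fun y => c2 (f y)) x (c2 l) /\ is_derive (fun y => c3 (f y)) x (c3 l).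

Definition is_vpd (i : ix) (V : R * R -> R22) (p : R * R) (W : R22) : Prop :=
  is_vderive (fun x => V (line i p x)) (coord i p) W.

Lemma line_coord i p : line i p (coord i p) = p.
Proof. destruct i, p; reflexivity. Qed.

Lemma is_vderive_unique f x l : is_vderive f x l -> vDerive f x = l.
Proof.
  intros (h0 & h1 & h2 & h3); unfold vDerive.
  apply R22_ext; autorewrite with r22; apply is_derive_unique; assumption.
Qed.

Ltac split4 := split; [| split; [| split]].

Lemma is_vderive_ext_loc f g x l :
  locally x (fun y => f y = g y) -> is_vderive f x l -> is_vderive g x l.
Proof.
  intros hl (h0 & h1 & h2 & h3); split4;
    [ apply (is_derive_ext_loc (fun y => c0 (f y))) | apply (is_derive_ext_loc (fun y => c1 (f y)))
    | apply (is_derive_ext_loc (fun y => c2 (f y))) | apply (is_derive_ext_loc (fun y => c3 (f y)))];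
    try assumption; revert hl; apply filter_imp; intros y e; rewrite e; reflexivity.
Qed.

Lemma is_vderive_eq f x l l' : is_vderive f x l -> l = l' -> is_vderive f x l'.
Proof. intros h <-; exact h. Qed.

Lemma is_derive_eq (f : R -> R) (x l l' : R) : is_derive f x l -> l = l' -> is_derive f x l'.
Proof. intros h <-; exact h. Qed.

Lemma is_derive_Rmult (f g : R -> R) x df dg :
  is_derive f x df -> is_derive g x dg ->
  is_derive (fun y => f y * g y) x (df * g x + f x * dg).
Proof. intros hf hg. apply (is_derive_mult f g x df dg hf hg). intros; apply Rmult_comm. Qed.

Lemma is_derive_Rplus (f g : R -> R) x df dg :
  is_derive f x df -> is_derive g x dg -> is_derive (fun y => f y + g y) x (df + dg).
Proof. intros hf hg; exact (is_derive_plus f g x df dg hf hg). Qed.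

Lemma is_derive_Rminus (f g : R -> R) x df dg :
  is_derive f x df -> is_derive g x dg -> is_derive (fun y => f y - g y) x (df - dg).
Proof. intros hf hg; exact (is_derive_minus f g x df dg hf hg). Qed.

Lemma is_derive_cst (c x : R) : is_derive (fun _ : R => c) x 0.
Proof. exact (is_derive_const c x). Qed.

Lemma is_derive_idR (x : R) : is_derive (fun y : R => y) x 1.
Proof. exact (is_derive_id x). Qed.

Lemma is_vderive_plus f g x l m :
  is_vderive f x l -> is_vderive g x m -> is_vderive (fun y => plus (f y) (g y)) x (plus l m).
Proof.
  intros (h0 & h1 & h2 & h3) (k0 & k1 & k2 & k3); split4;
    apply is_derive_Rplus; assumption.
Qed.

Lemma is_vderive_scal (a : R -> R) f x da l :
  is_derive a x da -> is_vderive f x l ->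
  is_vderive (fun y => scal (a y) (f y)) x (plus (scal da (f x)) (scal (a x) l)).
Proof.
  intros ha (h0 & h1 & h2 & h3); split4;
    apply is_derive_Rmult; assumption.
Qed.

Lemma is_vderive_const (v : R22) x : is_vderive (fun _ => v) x zero.
Proof. split4; apply is_derive_cst. Qed.

Lemma is_derive_ip f g x l m :
  is_vderive f x l -> is_vderive g x m ->
  is_derive (fun y => ip (f y) (g y)) x (ip l (g x) + ip (f x) m).
Proof.
  intros (h0 & h1 & h2 & h3) (k0 & k1 & k2 & k3); unfold ip.
  eapply is_derive_eq.
  - apply is_derive_Rplus; [apply is_derive_Rplus; [apply is_derive_Rminus|]|].
    + apply is_derive_Rmult; [apply (is_derive_opp _ _ _ h0) | exact k0].
    + apply is_derive_Rmult; eassumption.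
    + apply is_derive_Rmult; eassumption.
    + apply is_derive_Rmult; eassumption.
  - unfold opp; simpl; ring.
Qed.

Lemma is_vpd_unique i V p W : is_vpd i V p W -> vpd i V p = W.
Proof. apply is_vderive_unique. Qed.

Lemma continuous_line i p : continuous (line i p) (coord i p).
Proof.
  destruct i, p as [s t]; unfold line, coord; simpl; intros P [e he];
    exists e; intros y hy; apply he; split; simpl; try exact hy; apply ball_center.
Qed.

Lemma line_locally (D : R * R -> Prop) i p :
  open D -> D p -> locally (coord i p) (fun x => D (line i p x)).
Proof.
  intros hD hp; apply (continuous_line i p).
  rewrite line_coord; apply hD, hp.
Qed.

Lemma is_vpd_ext (D : R * R -> Prop) i V V' p W :
  open D -> D p -> (forall q, D q -> V q = V' q) -> is_vpd i V p W -> is_vpd i V' p W.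
Proof.
  intros hD hp he; apply is_vderive_ext_loc.
  generalize (line_locally D i p hD hp); apply filter_imp; intros x; apply he.
Qed.

Lemma is_pd_ext (D : R * R -> Prop) i f f' p l :
  open D -> D p -> (forall q, D q -> f q = f' q) -> is_pd i f p l -> is_pd i f' p l.
Proof.
  intros hD hp he; apply is_derive_ext_loc.
  generalize (line_locally D i p hD hp); apply filter_imp; intros x; apply he.
Qed.

Lemma is_vpd_plus i V W p v w :
  is_vpd i V p v -> is_vpd i W p w -> is_vpd i (fun q => plus (V q) (W q)) p (plus v w).
Proof. exact (is_vderive_plus _ _ _ _ _). Qed.

Lemma is_vpd_scal i a V p da v :
  is_pd i a p da -> is_vpd i V p v ->
  is_vpd i (fun q => scal (a q) (V q)) p (plus (scal da (V p)) (scal (a p) v)).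
Proof.
  intros ha hV; unfold is_vpd; eapply is_vderive_eq.
  - exact (is_vderive_scal _ _ _ _ _ ha hV).
  - simpl; rewrite line_coord; reflexivity.
Qed.

Lemma is_pd_fst1 f p l : is_derive f (fst p) l -> is_pd i1 (fun q => f (fst q)) p l.
Proof. intros h; exact h. Qed.

Lemma is_pd_fst2 f p : is_pd i2 (fun q => f (fst q)) p 0.
Proof. exact (is_derive_cst (f (fst p)) (snd p)). Qed.

(** A differentiable function of two variables has partial derivatives: it is composed
    with the affine map that parametrizes a coordinate line. *)
Lemma filterdiff_is_pd (f : R * R -> R) (p : R * R) (df : R * R -> R) i :
  filterdiff f (locally p) df -> exists l, is_pd i f p l.
Proof.
  intros hf; destruct p as [s t].
  set (l := fun y : R => match i with i1 => df (y, 0) | i2 => df (0, y) end).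
  assert (hf' : filterdiff (fun q : R * R => f (fst q, snd q)) (locally (s, t))
                  (fun q : R * R => df (fst q, snd q))).
  { apply (filterdiff_ext f); [now intros [? ?] |].
    apply (filterdiff_ext_lin f df); [exact hf | now intros [? ?]]. }
  assert (hd : filterdiff (fun x => f (line i (s, t) x)) (locally (coord i (s, t))) l).
  { destruct i; unfold line, coord, l; cbv [fst snd].
    - apply (filterdiff_comp'_2 (U := R_NormedModule) (V := R_NormedModule)
               (fun x : R => x) (fun _ => t) (fun a b => f (a, b)) s
               (fun y => y) (fun _ => 0) (fun a b => df (a, b))).
      + apply filterdiff_id.
      + exact (filterdiff_const (U := R_NormedModule) (V := R_NormedModule) t).
      + exact hf'.
    - apply (filterdiff_comp'_2 (U := R_NormedModule) (V := R_NormedModule)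
               (fun _ : R => s) (fun y => y) (fun a b => f (a, b)) t
               (fun _ => 0) (fun y => y) (fun a b => df (a, b))).
      + exact (filterdiff_const (U := R_NormedModule) (V := R_NormedModule) s).
      + apply filterdiff_id.
      + exact hf'. }
  exists (l 1); unfold is_pd, is_derive.
  eapply filterdiff_ext_lin; [exact hd |].
  intros y; destruct hd as [hl _].
  rewrite <- (linear_scal _ hl); f_equal; exact (eq_sym (Rmult_1_r y)).
Qed.

(** * Curvature of the quadric *)

Lemma is_vderive_flatD Y Z p W :
  is_vderive (fun h => Z (plus p (scal h (Y p)))) 0 W -> flatD Y Z p = W.
Proof. apply is_vderive_unique. Qed.

Lemma is_vderive_line (p y : R22) : is_vderive (fun h : R => plus p (scal h y)) 0 y.
Proof.
  eapply is_vderive_eq.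
  - apply is_vderive_plus; [apply is_vderive_const |].
    apply (is_vderive_scal (fun h => h)); [apply is_derive_idR | apply is_vderive_const].
  - vec_ring.
Qed.

Lemma ip_tangent_line (p y : R22) (h : R) :
  ip y p = 0 -> ip (plus p (scal h y)) (plus p (scal h y)) = ip p p + h ^ 2 * ip y y.
Proof.
  intros e; autorewrite with ipdb; rewrite (ip_comm p y), e; ring.
Qed.

Lemma plus_scal_0 (p y : R22) : plus p (scal 0 y) = p.
Proof. vec_ring. Qed.

Lemma is_derive_ip_div (p y z : R22) :
  ip p p <> 0 -> ip y p = 0 ->
  is_derive (fun h : R => ip z (plus p (scal h y)) /
     ip (plus p (scal h y)) (plus p (scal h y))) 0 (ip z y / ip p p).
Proof.
  intros hp hy.
  eapply is_derive_eq.
  - apply is_derive_div.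
    + apply is_derive_ip; [apply is_vderive_const | apply is_vderive_line].
    + apply is_derive_ip; apply is_vderive_line.
    + cbv beta; rewrite plus_scal_0; exact hp.
  - cbv beta; rewrite plus_scal_0, ip_zero_l, (ip_comm p y), hy; field; exact hp.
Qed.

Lemma flatD_tanproj (Y : R22 -> R22) (z p : R22) :
  ip p p <> 0 -> ip (Y p) p = 0 ->
  flatD Y (fun q => tanproj q z) p =
  opp (plus (scal (ip z (Y p) / ip p p) p) (scal (ip z p / ip p p) (Y p))).
Proof.
  intros hp hy; apply is_vderive_flatD; unfold tanproj, minus.
  eapply is_vderive_eq.
  - apply is_vderive_plus; [apply (is_vderive_const z)|].
    apply (is_vderive_ext_loc (fun h => scal (-1) (scal (ip z (plus p (scal h (Y p))) /
      ip (plus p (scal h (Y p))) (plus p (scal h (Y p)))) (plus p (scal h (Y p)))))).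
    + apply filter_forall; intros h; apply scal_m1.
    + apply (is_vderive_scal (fun _ => -1)); [apply is_derive_cst |].
      apply is_vderive_scal; [apply (is_derive_ip_div p (Y p) z hp hy) |].
      apply is_vderive_line.
  - cbv beta; rewrite plus_scal_0; vec_ring.
Qed.

(** Of the two terms of the flat derivative, one is radial and is removed by the projection. *)
Lemma nablaN_tanproj (Y : R22 -> R22) (z p : R22) :
  ip p p <> 0 -> ip (Y p) p = 0 ->
  nablaN Y (fun q => tanproj q z) p = scal (- (ip z p / ip p p)) (Y p).
Proof.
  intros hp hy; unfold nablaN; rewrite flatD_tanproj by assumption.
  unfold tanproj.
  rewrite ip_opp_l, ip_plus_l, !ip_scal_l, hy.
  apply R22_ext; autorewrite with r22; field; exact hp.
Qed.

Lemma tangent_line_nonnull (p y : R22) :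
  ip p p <> 0 -> ip y p = 0 ->
  locally 0 (fun h : R => ip (plus p (scal h y)) (plus p (scal h y)) <> 0).
Proof.
  intros hp hy.
  assert (hc : continuous (fun h : R => ip p p + h ^ 2 * ip y y) 0).
  { apply (ex_derive_continuous (fun h : R => ip p p + h ^ 2 * ip y y)).
    auto_derive; exact I. }
  assert (ho : locally (ip p p + 0 ^ 2 * ip y y) (fun v : R => v <> 0)).
  { apply open_neq; rewrite pow_i by lia; lra. }
  specialize (hc _ ho); unfold filtermap in hc; revert hc.
  apply filter_imp; intros h; rewrite ip_tangent_line; auto.
Qed.

Lemma nablaN_nablaN_tanproj (x y z p : R22) :
  ip p p <> 0 -> ip x p = 0 -> ip y p = 0 -> ip z p = 0 ->
  nablaN (fun q => tanproj q x) (nablaN (fun q => tanproj q y) (fun q => tanproj q z)) p =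
  scal (- (ip z x / ip p p)) y.
Proof.
  intros hp hx hy hz; unfold nablaN at 1.
  rewrite (is_vderive_flatD _ _ _ (scal (- (ip z x / ip p p)) y)).
  - apply tanproj_tangent; rewrite ip_scal_l, hy; ring.
  - rewrite (tanproj_tangent p x hx).
    apply (is_vderive_ext_loc (fun h => scal ((-1) * (ip z (plus p (scal h x)) /
      ip (plus p (scal h x)) (plus p (scal h x)))) (tanproj (plus p (scal h x)) y))).
    + generalize (tangent_line_nonnull p x hp hx); apply filter_imp; intros h hh.
      rewrite nablaN_tanproj; [ apply scal_m1_mult | exact hh | apply ip_tanproj, hh].
    + eapply is_vderive_eq.
      * apply is_vderive_scal.
        -- apply is_derive_Rmult; [apply is_derive_cst | apply (is_derive_ip_div p x z hp hx)].
        -- unfold tanproj, minus.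
           apply is_vderive_plus; [apply (is_vderive_const y)|].
           apply (is_vderive_ext_loc (fun h => scal (-1) (scal (ip y (plus p (scal h x)) /
             ip (plus p (scal h x)) (plus p (scal h x))) (plus p (scal h x))))).
           ++ apply filter_forall; intros h; apply scal_m1.
           ++ apply (is_vderive_scal (fun _ => -1)); [apply is_derive_cst |].
              apply is_vderive_scal; [apply (is_derive_ip_div p x y hp hx) |].
              apply is_vderive_line.
      * cbv beta; rewrite plus_scal_0, hz, (tanproj_tangent p y hy).
        apply R22_ext; autorewrite with r22; field; exact hp.
Qed.

(** The quadric is totally umbilic in the flat space, which leaves constant curvature:
    covariant derivatives of the fields [q |-> tanproj q z] are multiples of the direction,
    with coefficient [- <z, q> / <q, q>], and only the derivative of <z, q> survives at [p]. *)
Lemma curvN_formula (p x y z : R22) :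
  ip p p <> 0 -> ip x p = 0 -> ip y p = 0 -> ip z p = 0 ->
  curvN p x y z = minus (scal (ip z y / ip p p) x) (scal (ip z x / ip p p) y).
Proof.
  intros hp hx hy hz; unfold curvN, curv_field.
  rewrite !nablaN_nablaN_tanproj by assumption.
  assert (hb : bracketN (fun q => tanproj q x) (fun q => tanproj q y) p = zero).
  { unfold bracketN; rewrite !flatD_tanproj;
      try assumption; rewrite ?tanproj_tangent; try assumption.
    rewrite hx, hy, (ip_comm y x); apply R22_ext; autorewrite with r22; field; exact hp. }
  rewrite nablaN_tanproj; [ rewrite hb; vec_ring | exact hp | rewrite hb; apply ip_zero_l].
Qed.

(** * Traces over orthonormal frames *)

Lemma sum2_R (f : ix -> R) : sum2 f = f i1 + f i2.
Proof. reflexivity. Qed.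

Lemma sum2_V (f : ix -> R22) : sum2 f = plus (f i1) (f i2).
Proof. reflexivity. Qed.

(** A left inverse of a square matrix is a right inverse: orthonormality of the rows of the
    frame matrix gives the inverse metric as the sum of squares of its columns. *)
Lemma frame_columns (G K eps1 eps2 a b c d : R) :
  0 < G -> 0 < K -> (eps1 = 1 \/ eps1 = -1) -> (eps2 = 1 \/ eps2 = -1) ->
  G * a * a + K * b * b = eps1 -> G * c * c + K * d * d = eps2 ->
  G * a * c + K * b * d = 0 ->
  eps1 = 1 /\ eps2 = 1 /\ a * a + c * c = / G /\ b * b + d * d = / K /\ a * b + c * d = 0.
Proof.
  intros hG hK h1 h2 ha hc hac.
  assert (e1 : eps1 = 1).
  { destruct h1 as [| h1]; [assumption|].
    assert (0 <= G * (a * a)) by (apply Rmult_le_pos; [lra | apply Rle_0_sqr]).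
    assert (0 <= K * (b * b)) by (apply Rmult_le_pos; [lra | apply Rle_0_sqr]).
    lra. }
  assert (e2 : eps2 = 1).
  { destruct h2 as [| h2]; [assumption|].
    assert (0 <= G * (c * c)) by (apply Rmult_le_pos; [lra | apply Rle_0_sqr]).
    assert (0 <= K * (d * d)) by (apply Rmult_le_pos; [lra | apply Rle_0_sqr]).
    lra. }
  rewrite e1 in ha; rewrite e2 in hc.
  assert (hD : G * K * (a * d - b * c) * (a * d - b * c) = 1).
  { replace 1 with ((G * a * a + K * b * b) * (G * c * c + K * d * d)
      - (G * a * c + K * b * d) * (G * a * c + K * b * d)) by (rewrite ha, hc, hac; ring).
    ring. }
  assert (hD0 : a * d - b * c <> 0) by (intros e; rewrite e in hD; lra).
  assert (hx1 : a * (G * (a * a + c * c) - 1) + K * b * (a * b + c * d) = 0).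
  { replace (a * (G * (a * a + c * c) - 1) + K * b * (a * b + c * d))
      with (a * (G * a * a + K * b * b - 1) + c * (G * a * c + K * b * d)) by ring.
    rewrite ha, hac; ring. }
  assert (hx2 : c * (G * (a * a + c * c) - 1) + K * d * (a * b + c * d) = 0).
  { replace (c * (G * (a * a + c * c) - 1) + K * d * (a * b + c * d))
      with (c * (G * c * c + K * d * d - 1) + a * (G * a * c + K * b * d)) by ring.
    rewrite hc, hac; ring. }
  assert (hx : G * (a * a + c * c) = 1).
  { apply Rminus_diag_uniq, (Rmult_eq_reg_l (a * d - b * c)); [|assumption].
    transitivity (d * (a * (G * (a * a + c * c) - 1) + K * b * (a * b + c * d)) -
      b * (c * (G * (a * a + c * c) - 1) + K * d * (a * b + c * d))); [ring|].
    rewrite hx1, hx2; ring. }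
  assert (hy : a * b + c * d = 0).
  { apply (Rmult_eq_reg_l (K * (a * d - b * c))); [|apply Rmult_integral_contrapositive; split; lra].
    transitivity (a * (c * (G * (a * a + c * c) - 1) + K * d * (a * b + c * d)) -
      c * (a * (G * (a * a + c * c) - 1) + K * b * (a * b + c * d))); [ring|].
    rewrite hx1, hx2; ring. }
  assert (hz : K * (b * b + d * d) = 1).
  { transitivity ((G * a * a + K * b * b) + (G * c * c + K * d * d) - G * (a * a + c * c));
      [ring | rewrite ha, hc, hx; ring]. }
  repeat split; try assumption.
  - apply (Rmult_eq_reg_l G); [rewrite hx, Rinv_r; lra | lra].
  - apply (Rmult_eq_reg_l K); [rewrite hz, Rinv_r; lra | lra].
Qed.

Definition is_conf_metric (D : R * R -> Prop) (g : metric) (E r : R -> R) : Prop :=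
  forall q, D q ->
    g i1 i1 q = E (fst q) /\ g i2 i2 q = E (fst q) * r (fst q) ^ 2 /\
    g i1 i2 q = 0 /\ g i2 i1 q = 0.

Lemma christoffel_conf (D : R * R -> Prop) (g : metric) (E r : R -> R) (p : R * R) (dE dr : R) :
  open D -> D p -> is_conf_metric D g E r -> E (fst p) <> 0 -> r (fst p) <> 0 ->
  is_derive E (fst p) dE -> is_derive r (fst p) dr ->
  christoffel g i1 i1 i1 p = dE / (2 * E (fst p)) /\
  christoffel g i1 i2 i2 p =
    - (dE * r (fst p) ^ 2 + E (fst p) * (2 * r (fst p) * dr)) / (2 * E (fst p)) /\
  christoffel g i2 i1 i1 p = 0 /\ christoffel g i2 i2 i2 p = 0.
Proof.
  intros hD hp hg hE hr dhE dhr.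
  assert (hG : is_derive (fun s => E s * r s ^ 2) (fst p)
                 (dE * r (fst p) ^ 2 + E (fst p) * (2 * r (fst p) * dr))).
  { eapply is_derive_eq; [apply is_derive_Rmult; [exact dhE |] |].
    - apply (is_derive_ext (fun s => r s * r s)); [intros t; exact (f_equal (Rmult (r t)) (eq_sym (Rmult_1_r (r t)))) |].
      apply is_derive_Rmult; exact dhr.
    - simpl; ring. }
  assert (hpd : forall i j f l, (forall q, D q -> g i j q = f (fst q)) ->
    is_derive f (fst p) l -> pd i1 (g i j) p = l /\ pd i2 (g i j) p = 0).
  { intros i j f l hf hl.
    split; apply is_derive_unique, (is_pd_ext D _ (fun q => f (fst q))); auto using is_pd_fst2;
      intros q hq; symmetry; apply hf, hq. }
  destruct (hpd i1 i1 E dE) as [p1 p2]; [intros q hq; apply hg, hq | exact dhE |].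
  destruct (hpd i2 i2 (fun s => E s * r s ^ 2) _ ltac:(intros q hq; apply hg, hq) hG) as [p3 p4].
  destruct (hpd i1 i2 (fun _ => 0) 0) as [p5 p6];
    [intros q hq; apply hg, hq | apply is_derive_cst |].
  destruct (hpd i2 i1 (fun _ => 0) 0) as [p7 p8];
    [intros q hq; apply hg, hq | apply is_derive_cst |].
  destruct (hg p hp) as (g11 & g22 & g12 & g21).
  unfold christoffel; rewrite !sum2_R; unfold metric_inv, metric_det.
  rewrite ?p1, ?p2, ?p3, ?p4, ?p5, ?p6, ?p7, ?p8, ?g11, ?g22, ?g12, ?g21.
  repeat split; field; auto.
Qed.

Lemma ortho_frame_columns (D D' : R * R -> Prop) (g : metric) (E r : R -> R)
    (eps : ix -> R) (e : ix -> vfield) (p : R * R) :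
  (forall q, D' q -> D q) -> D' p -> is_conf_metric D g E r ->
  0 < E (fst p) -> 0 < r (fst p) -> ortho_frame D' g eps e ->
  eps i1 = 1 /\ eps i2 = 1 /\
  e i1 p i1 * e i1 p i1 + e i2 p i1 * e i2 p i1 = / E (fst p) /\
  e i1 p i2 * e i1 p i2 + e i2 p i2 * e i2 p i2 = / (E (fst p) * r (fst p) ^ 2) /\
  e i1 p i1 * e i1 p i2 + e i2 p i1 * e i2 p i2 = 0.
Proof.
  intros hDD hp hg hE hr (heps & _ & hortho).
  destruct (hg p (hDD p hp)) as (g11 & g22 & g12 & g21).
  assert (h := hortho p hp).
  assert (h11 := h i1 i1); assert (h22 := h i2 i2); assert (h12 := h i1 i2).
  rewrite !sum2_R, g11, g22, g12, g21 in h11, h22, h12.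
  apply frame_columns; auto.
  - apply Rmult_lt_0_compat; [assumption | apply pow_lt; assumption].
  - lra.
  - lra.
  - lra.
Qed.

Lemma ortho_frame_pd (D' : R * R -> Prop) g eps (e : ix -> vfield) (p : R * R) :
  ortho_frame D' g eps e -> D' p ->
  exists de : ix -> ix -> ix -> R, forall i k l, is_pd k (fun q => e i q l) p (de i k l).
Proof.
  intros (_ & hs & _) hp.
  assert (h : forall i k l, exists d, is_pd k (fun q => e i q l) p d).
  { intros i k l; destruct (hs i l 1%nat) as (df & hdf & _).
    exact (filterdiff_is_pd _ p (df p) k (hdf p hp)). }
  exists (fun i k l => proj1_sig (constructive_indefinite_description _ (h i k l))).
  intros i k l; exact (proj2_sig (constructive_indefinite_description _ (h i k l))).
Qed.

(** For any frame, the trace of the covariant derivative of [sum_l dx^l W_l] only involves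
    the inverse metric: the derivatives of the frame cancel against those in the connection
    of the source.  In dimension two the Christoffel symbols of [E (ds^2 + r^2 dt^2)]
    contract to [- (r'/r) / E] along [d/ds], so that [E] only enters as a factor: this is the
    conformal covariance of the Laplacian. *)
Lemma frame_trace (D D' : R * R -> Prop) (g : metric) (E r : R -> R)
    (eps : ix -> R) (e : ix -> vfield) (phi : R * R -> R22)
    (W : ix -> R * R -> R22) (dW : ix -> ix -> R22) (p : R * R) (dE dr : R) :
  open D -> (forall q, D' q -> D q) -> D' p -> is_conf_metric D g E r ->
  0 < E (fst p) -> 0 < r (fst p) ->
  is_derive E (fst p) dE -> is_derive r (fst p) dr ->
  ortho_frame D' g eps e ->
  (forall k l, is_vpd k (W l) p (dW k l)) ->
  (forall l, ip (W l p) (phi p) = 0) ->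
  sum2 (fun i => scal (eps i)
    (minus (tanproj (phi p) (sum2 (fun k => scal (e i p k)
              (vpd k (fun q => sum2 (fun l => scal (e i q l) (W l q))) p))))
           (sum2 (fun k => scal (nabla_src g (e i) (e i) p k) (W k p))))) =
  scal (/ E (fst p))
    (plus (plus (tanproj (phi p) (dW i1 i1))
                (scal (/ r (fst p) ^ 2) (tanproj (phi p) (dW i2 i2))))
          (scal (dr / r (fst p)) (W i1 p))).
Proof.
  intros hD hDD hp hg hE hr dhE dhr hf hW htan.
  destruct (ortho_frame_columns D D' g E r eps e p hDD hp hg hE hr hf)
    as (e1 & e2 & h11 & h22 & h12).
  destruct (ortho_frame_pd D' g eps e p hf hp) as (de & hde).
  destruct (christoffel_conf D g E r p dE dr hD (hDD p hp) hg) as (c111 & c122 & c211 & c222);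
    try assumption; try lra.
  assert (hv : forall i k, vpd k (fun q => sum2 (fun l => scal (e i q l) (W l q))) p =
    plus (plus (scal (de i k i1) (W i1 p)) (scal (e i p i1) (dW k i1)))
         (plus (scal (de i k i2) (W i2 p)) (scal (e i p i2) (dW k i2)))).
  { intros i k; apply is_vpd_unique.
    apply is_vpd_plus; apply is_vpd_scal; auto. }
  assert (hs : forall i k, nabla_src g (e i) (e i) p k =
    e i p i1 * de i i1 k + e i p i2 * de i i2 k +
    (christoffel g k i1 i1 p * e i p i1 * e i p i1 + christoffel g k i1 i2 p * e i p i1 * e i p i2 +
    (christoffel g k i2 i1 p * e i p i2 * e i p i1 + christoffel g k i2 i2 p * e i p i2 * e i p i2))).
  { intros i k; unfold nabla_src; rewrite !sum2_R.
    replace (pd i1 (fun q => e i q k) p) with (de i i1 k)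
      by (symmetry; apply is_derive_unique, hde).
    replace (pd i2 (fun q => e i q k) p) with (de i i2 k)
      by (symmetry; apply is_derive_unique, hde).
    reflexivity. }
  rewrite !sum2_V, !hv, !hs, e1, e2.
  rewrite !tanproj_plus, !tanproj_scal, !tanproj_plus, !tanproj_scal.
  rewrite !(tanproj_tangent _ (W _ p)) by apply htan.
  set (T := fun k l => tanproj (phi p) (dW k l)).
  change (tanproj (phi p) (dW i1 i1)) with (T i1 i1).
  change (tanproj (phi p) (dW i1 i2)) with (T i1 i2).
  change (tanproj (phi p) (dW i2 i1)) with (T i2 i1).
  change (tanproj (phi p) (dW i2 i2)) with (T i2 i2).
  clearbody T.
  set (Gam := fun k i j => christoffel g k i j p).
  transitivity (plus (plus
    (scal (e i1 p i1 * e i1 p i1 + e i2 p i1 * e i2 p i1)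
      (minus (T i1 i1) (plus (scal (Gam i1 i1 i1) (W i1 p)) (scal (Gam i2 i1 i1) (W i2 p)))))
    (scal (e i1 p i2 * e i1 p i2 + e i2 p i2 * e i2 p i2)
      (minus (T i2 i2) (plus (scal (Gam i1 i2 i2) (W i1 p)) (scal (Gam i2 i2 i2) (W i2 p))))))
    (scal (e i1 p i1 * e i1 p i2 + e i2 p i1 * e i2 p i2)
      (minus (plus (T i1 i2) (T i2 i1))
        (plus (scal (Gam i1 i1 i2 + Gam i1 i2 i1) (W i1 p))
              (scal (Gam i2 i1 i2 + Gam i2 i2 i1) (W i2 p)))))).
  { unfold Gam; vec_ring. }
  rewrite h11, h22, h12; unfold Gam; rewrite c111, c122, c211, c222.
  apply R22_ext; autorewrite with r22; field; lra.
Qed.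

Lemma tension_conf (D D' : R * R -> Prop) (g : metric) (E r : R -> R)
    (eps : ix -> R) (e : ix -> vfield) (phi : R * R -> R22)
    (dX : ix -> ix -> R22) (p : R * R) (dE dr : R) :
  open D -> (forall q, D' q -> D q) -> D' p -> is_conf_metric D g E r ->
  0 < E (fst p) -> 0 < r (fst p) ->
  is_derive E (fst p) dE -> is_derive r (fst p) dr ->
  ortho_frame D' g eps e ->
  (forall k l, is_vpd k (vpd l phi) p (dX k l)) ->
  (forall l, ip (vpd l phi p) (phi p) = 0) ->
  tension g eps e phi p =
  scal (/ E (fst p))
    (plus (plus (tanproj (phi p) (dX i1 i1))
                (scal (/ r (fst p) ^ 2) (tanproj (phi p) (dX i2 i2))))
          (scal (dr / r (fst p)) (vpd i1 phi p))).
Proof.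
  intros; apply (frame_trace D D' g E r eps e phi (fun l => vpd l phi) dX p dE dr); assumption.
Qed.

Lemma laplacian_conf (D D' : R * R -> Prop) (g : metric) (E r : R -> R)
    (eps : ix -> R) (e : ix -> vfield) (phi V : R * R -> R22)
    (dW : ix -> ix -> R22) (p : R * R) (dE dr : R) :
  open D -> (forall q, D' q -> D q) -> D' p -> is_conf_metric D g E r ->
  0 < E (fst p) -> 0 < r (fst p) ->
  is_derive E (fst p) dE -> is_derive r (fst p) dr ->
  ortho_frame D' g eps e ->
  (forall k l, is_vpd k (fun q => tanproj (phi q) (vpd l V q)) p (dW k l)) ->
  ip (phi p) (phi p) <> 0 ->
  laplacian g eps e phi V p =
  scal (/ E (fst p))
    (plus (plus (tanproj (phi p) (dW i1 i1))
                (scal (/ r (fst p) ^ 2) (tanproj (phi p) (dW i2 i2))))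
          (scal (dr / r (fst p)) (tanproj (phi p) (vpd i1 V p)))).
Proof.
  intros hD hDD hp hg hE hr dhE dhr hf hW hn.
  assert (hlin : forall Y q, nabla_phi phi Y V q =
    sum2 (fun l => scal (Y q l) (tanproj (phi q) (vpd l V q)))).
  { intros Y q; unfold nabla_phi; rewrite !sum2_V, tanproj_plus, !tanproj_scal; reflexivity. }
  rewrite <- (frame_trace D D' g E r eps e phi (fun l q => tanproj (phi q) (vpd l V q))
    dW p dE dr) by (try assumption; intros l; apply ip_tanproj, hn).
  unfold laplacian; f_equal; apply functional_extensionality; intros i.
  rewrite hlin; do 2 f_equal; unfold nabla_phi at 1.
  do 2 f_equal; apply functional_extensionality; intros k.
  do 2 f_equal; apply functional_extensionality; intros q; apply hlin.
Qed.

(** * Surfaces of revolution in the quadric: tension and bitension *)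

(** Gauss-Weingarten equations of a surface with first fundamental form [ds^2 + r^2 dt^2],
    [q = r'/r], and principal curvatures [ka], [kb] along the coordinate lines. *)
Record surface {L : R} {D : R * R -> Prop} {X Xs Xt xi : R * R -> R22} {r q ka kb : R -> R}
    : Prop := {
  sf_XX : forall p, D p -> ip (X p) (X p) = - L ^ 2;
  sf_sX : forall p, D p -> ip (Xs p) (X p) = 0;
  sf_tX : forall p, D p -> ip (Xt p) (X p) = 0;
  sf_xX : forall p, D p -> ip (xi p) (X p) = 0;
  sf_ss : forall p, D p -> ip (Xs p) (Xs p) = 1;
  sf_tt : forall p, D p -> ip (Xt p) (Xt p) = r (fst p) ^ 2;
  sf_st : forall p, D p -> ip (Xs p) (Xt p) = 0;
  sf_xx : forall p, D p -> ip (xi p) (xi p) = -1;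
  sf_xs : forall p, D p -> ip (xi p) (Xs p) = 0;
  sf_xt : forall p, D p -> ip (xi p) (Xt p) = 0;
  sf_dX1 : forall p, D p -> is_vpd i1 X p (Xs p);
  sf_dX2 : forall p, D p -> is_vpd i2 X p (Xt p);
  sf_dXs1 : forall p, D p ->
    is_vpd i1 Xs p (plus (scal (- ka (fst p)) (xi p)) (scal (/ L ^ 2) (X p)));
  sf_dXs2 : forall p, D p -> is_vpd i2 Xs p (scal (q (fst p)) (Xt p));
  sf_dXt1 : forall p, D p -> is_vpd i1 Xt p (scal (q (fst p)) (Xt p));
  sf_dXt2 : forall p, D p ->
    is_vpd i2 Xt p (scal (r (fst p) ^ 2) (plus (plus (scal (- q (fst p)) (Xs p))
      (scal (- kb (fst p)) (xi p))) (scal (/ L ^ 2) (X p))));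
  sf_dxi1 : forall p, D p -> is_vpd i1 xi p (scal (- ka (fst p)) (Xs p));
  sf_dxi2 : forall p, D p -> is_vpd i2 xi p (scal (- kb (fst p)) (Xt p));
  sf_r : forall p, D p -> 0 < r (fst p) /\ is_derive r (fst p) (q (fst p) * r (fst p))
}.

Arguments surface : clear implicits.

Lemma is_vpd_eq i V p W W' : is_vpd i V p W -> W = W' -> is_vpd i V p W'.
Proof. intros h <-; exact h. Qed.

Lemma tanproj_tangent_plus_radial (x v : R22) (b : R) :
  ip x x <> 0 -> ip v x = 0 -> tanproj x (plus v (scal b x)) = v.
Proof.
  intros hx hv; rewrite tanproj_plus, tanproj_scal, tanproj_self, tanproj_tangent by assumption.
  vec_ring.
Qed.

Section Surface.
Context (L : R) (D : R * R -> Prop) (X Xs Xt xi : R * R -> R22) (r q ka kb : R -> R).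
Context (hL : 0 < L) (hD : open D) (hS : surface L D X Xs Xt xi r q ka kb).

Lemma surface_nonnull p : D p -> ip (X p) (X p) <> 0.
Proof. intros hp; rewrite (sf_XX hS p hp). generalize (pow_lt L 2 hL); lra. Qed.

Lemma surface_vpd1 p : D p -> vpd i1 X p = Xs p.
Proof. intros hp; apply is_vpd_unique, (sf_dX1 hS p hp). Qed.

Lemma surface_vpd2 p : D p -> vpd i2 X p = Xt p.
Proof. intros hp; apply is_vpd_unique, (sf_dX2 hS p hp). Qed.

Lemma surface_tension (D' : R * R -> Prop) (g : metric) (E : R -> R)
    (eps : ix -> R) (e : ix -> vfield) (p : R * R) (dE : R) :
  (forall q, D' q -> D q) -> D' p -> is_conf_metric D g E r ->
  0 < E (fst p) -> is_derive E (fst p) dE -> ortho_frame D' g eps e ->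
  tension g eps e X p = scal (- (ka (fst p) + kb (fst p)) / E (fst p)) (xi p).
Proof.
  intros hDD hp hg hE hdE hf.
  assert (hDp := hDD p hp); destruct hS, (sf_r0 p hDp) as [hr hdr].
  rewrite (tension_conf D D' g E r eps e X (fun k l => match k, l with
    | i1, i1 => plus (scal (- ka (fst p)) (xi p)) (scal (/ L ^ 2) (X p))
    | i2, i2 => scal (r (fst p) ^ 2) (plus (plus (scal (- q (fst p)) (Xs p))
                  (scal (- kb (fst p)) (xi p))) (scal (/ L ^ 2) (X p)))
    | _, _ => scal (q (fst p)) (Xt p) end) p dE (q (fst p) * r (fst p))); try assumption.
  - rewrite surface_vpd1, tanproj_scal, !tanproj_tangent_plus_radial; try apply surface_nonnull;
      try assumption.
    + apply R22_ext; autorewrite with r22; field; lra.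
    + autorewrite with ipdb; rewrite sf_sX0, sf_xX0 by assumption; ring.
    + autorewrite with ipdb; rewrite sf_xX0 by assumption; ring.
  - intros k l; apply (is_vpd_ext D k (match l with i1 => Xs | i2 => Xt end)); try assumption.
    + intros q' hq'; destruct l; symmetry; [apply surface_vpd1 | apply surface_vpd2]; exact hq'.
    + destruct k, l; auto.
  - intros l; destruct l; [rewrite surface_vpd1 | rewrite surface_vpd2]; auto.
Qed.

Lemma surface_normal_vpd (f : R -> R) (p : R * R) (df : R) :
  D p -> is_derive f (fst p) df ->
  is_vpd i1 (fun q => scal (f (fst q)) (xi q)) p
    (plus (scal df (xi p)) (scal (- (f (fst p) * ka (fst p))) (Xs p))) /\
  is_vpd i2 (fun q => scal (f (fst q)) (xi q)) p (scal (- (f (fst p) * kb (fst p))) (Xt p)).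
Proof.
  intros hp hdf; destruct hS; split.
  - eapply is_vpd_eq.
    + apply (is_vpd_scal i1 (fun q => f (fst q))); [apply is_pd_fst1; exact hdf | auto].
    + vec_ring.
  - eapply is_vpd_eq.
    + apply (is_vpd_scal i2 (fun q => f (fst q))); [apply is_pd_fst2 | auto].
    + vec_ring.
Qed.

(** The covariant derivative of [f xi] is [f' xi - f A] on [d/ds] and [- f A] on [d/dt]; the
    Laplacian differentiates these once more, and [A] itself contributes through
    [ka' + q (ka - kb)], the [d/ds] component of its divergence. *)
Lemma surface_normal_laplacian (D' : R * R -> Prop) (g : metric) (E f f' : R -> R)
    (eps : ix -> R) (e : ix -> vfield) (V : R * R -> R22) (p : R * R) (dE d2f dka dkb : R) :
  open D' -> (forall q, D' q -> D q) -> D' p -> is_conf_metric D g E r ->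
  0 < E (fst p) -> is_derive E (fst p) dE -> ortho_frame D' g eps e ->
  (forall q, D' q -> V q = scal (f (fst q)) (xi q)) ->
  (forall q, D' q -> is_derive f (fst q) (f' (fst q))) ->
  is_derive f' (fst p) d2f -> is_derive ka (fst p) dka -> is_derive kb (fst p) dkb ->
  laplacian g eps e X V p = scal (/ E (fst p)) (plus
    (scal (d2f + q (fst p) * f' (fst p) + f (fst p) * (ka (fst p) ^ 2 + kb (fst p) ^ 2)) (xi p))
    (scal (- 2 * f' (fst p) * ka (fst p) - f (fst p) * (dka + q (fst p) * (ka (fst p) - kb (fst p))))
       (Xs p))).
Proof.
  intros hD' hDD hp hg hE hdE hf hV hdf hd2f hdka hdkb.
  assert (hDp := hDD p hp).
  assert (hW1 : forall x, D' x -> tanproj (X x) (vpd i1 V x) =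
     plus (scal (f' (fst x)) (xi x)) (scal (- (f (fst x) * ka (fst x))) (Xs x)) /\
     tanproj (X x) (vpd i2 V x) = scal (- (f (fst x) * kb (fst x))) (Xt x)).
  { intros x hx; assert (hDx := hDD x hx).
    destruct (surface_normal_vpd f x (f' (fst x)) hDx (hdf x hx)) as [v1 v2].
    assert (hl : forall i W, is_vpd i (fun y => scal (f (fst y)) (xi y)) x W -> vpd i V x = W).
    { intros i W hW; apply is_vpd_unique.
      apply (is_vpd_ext D' i (fun y => scal (f (fst y)) (xi y))); auto.
      intros y hy; symmetry; auto. }
    rewrite (hl _ _ v1), (hl _ _ v2); destruct hS; split; apply tanproj_tangent;
      autorewrite with ipdb; rewrite ?sf_xX0, ?sf_sX0, ?sf_tX0 by assumption; ring. }
  assert (hnn := surface_nonnull p hDp).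
  destruct hS, (sf_r0 p hDp) as [hr hdr].
  rewrite (laplacian_conf D D' g E r eps e X V (fun k l => match l with
    | i1 => match k with
       | i1 => plus (plus (scal d2f (xi p)) (scal (f' (fst p)) (scal (- ka (fst p)) (Xs p))))
         (plus (scal (- (f' (fst p) * ka (fst p) + f (fst p) * dka)) (Xs p))
           (scal (- (f (fst p) * ka (fst p)))
              (plus (scal (- ka (fst p)) (xi p)) (scal (/ L ^ 2) (X p)))))
       | i2 => plus (plus (scal 0 (xi p)) (scal (f' (fst p)) (scal (- kb (fst p)) (Xt p))))
         (plus (scal 0 (Xs p))
            (scal (- (f (fst p) * ka (fst p))) (scal (q (fst p)) (Xt p))))
       end
    | i2 => match k with
       | i1 => plus (scal (- (f' (fst p) * kb (fst p) + f (fst p) * dkb)) (Xt p))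
           (scal (- (f (fst p) * kb (fst p))) (scal (q (fst p)) (Xt p)))
       | i2 => plus (scal 0 (Xt p))
           (scal (- (f (fst p) * kb (fst p)))
             (scal (r (fst p) ^ 2) (plus (plus (scal (- q (fst p)) (Xs p))
                  (scal (- kb (fst p)) (xi p))) (scal (/ L ^ 2) (X p)))))
       end
    end) p dE (q (fst p) * r (fst p))); try assumption.
  - rewrite (proj1 (hW1 p hp)).
    repeat (rewrite tanproj_plus || rewrite tanproj_scal).
    rewrite !tanproj_self, (tanproj_tangent _ (xi p)), (tanproj_tangent _ (Xs p)) by auto.
    apply R22_ext; autorewrite with r22; field; lra.
  - assert (hka : is_derive (fun s => - (f s * ka s)) (fst p)
                    (- (f' (fst p) * ka (fst p) + f (fst p) * dka)))
      by (apply (is_derive_opp (fun s => f s * ka s)), is_derive_Rmult; auto).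
    assert (hkb : is_derive (fun s => - (f s * kb s)) (fst p)
                    (- (f' (fst p) * kb (fst p) + f (fst p) * dkb)))
      by (apply (is_derive_opp (fun s => f s * kb s)), is_derive_Rmult; auto).
    intros k l; destruct l.
    + apply (is_vpd_ext D' k (fun x => plus (scal (f' (fst x)) (xi x))
        (scal (- (f (fst x) * ka (fst x))) (Xs x)))); auto.
      * intros y hy; symmetry; exact (proj1 (hW1 y hy)).
      * destruct k; apply is_vpd_plus.
        -- apply (is_vpd_scal i1 (fun y => f' (fst y))); auto.
        -- apply (is_vpd_scal i1 (fun y => - (f (fst y) * ka (fst y)))); auto.
        -- apply (is_vpd_scal i2 (fun y => f' (fst y))); [apply is_pd_fst2 | auto].
        -- apply (is_vpd_scal i2 (fun y => - (f (fst y) * ka (fst y))));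
             [apply (is_pd_fst2 (fun s => - (f s * ka s))) | auto].
    + apply (is_vpd_ext D' k (fun x => scal (- (f (fst x) * kb (fst x))) (Xt x))); auto.
      * intros y hy; symmetry; exact (proj2 (hW1 y hy)).
      * destruct k.
        -- apply (is_vpd_scal i1 (fun y => - (f (fst y) * kb (fst y)))); auto.
        -- apply (is_vpd_scal i2 (fun y => - (f (fst y) * kb (fst y))));
             [apply (is_pd_fst2 (fun s => - (f s * kb s))) | auto].
Qed.

Lemma surface_curvature_trace (D' : R * R -> Prop) (g : metric) (E : R -> R)
    (eps : ix -> R) (e : ix -> vfield) (p : R * R) (a : R) :
  (forall q, D' q -> D q) -> D' p -> is_conf_metric D g E r -> 0 < E (fst p) ->
  ortho_frame D' g eps e ->
  sum2 (fun i => scal (eps i)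
    (curvN (X p) (dmap X (e i) p) (scal a (xi p)) (dmap X (e i) p))) =
  scal (2 * a / (E (fst p) * L ^ 2)) (xi p).
Proof.
  intros hDD hp hg hE hf.
  assert (hDp := hDD p hp); assert (hnn := surface_nonnull p hDp).
  assert (v1 := surface_vpd1 p hDp); assert (v2 := surface_vpd2 p hDp).
  destruct hS, (sf_r0 p hDp) as [hr _].
  destruct (ortho_frame_columns D D' g E r eps e p hDD hp hg hE hr hf)
    as (e1 & e2 & h11 & h22 & _).
  assert (hx : forall i, dmap X (e i) p = plus (scal (e i p i1) (Xs p)) (scal (e i p i2) (Xt p))).
  { intros i; unfold dmap; rewrite sum2_V, v1, v2; reflexivity. }
  assert (hc : forall i, curvN (X p) (dmap X (e i) p) (scal a (xi p)) (dmap X (e i) p) =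
    scal (a * (e i p i1 * e i p i1 + r (fst p) ^ 2 * (e i p i2 * e i p i2)) / L ^ 2) (xi p)).
  { intros i; rewrite hx, curvN_formula; try assumption.
    - autorewrite with ipdb.
      rewrite (ip_comm (Xt p) (Xs p)), (ip_comm (Xs p) (xi p)), (ip_comm (Xt p) (xi p)).
      rewrite sf_ss0, sf_tt0, sf_st0, sf_xs0, sf_xt0, sf_XX0 by assumption.
      apply R22_ext; autorewrite with r22; field; lra.
    - autorewrite with ipdb; rewrite sf_sX0, sf_tX0 by assumption; ring.
    - autorewrite with ipdb; rewrite sf_xX0 by assumption; ring.
    - autorewrite with ipdb; rewrite sf_sX0, sf_tX0 by assumption; ring. }
  rewrite sum2_V, !hc, e1, e2.
  transitivity (scal (a * ((e i1 p i1 * e i1 p i1 + e i2 p i1 * e i2 p i1) +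
     r (fst p) ^ 2 * (e i1 p i2 * e i1 p i2 + e i2 p i2 * e i2 p i2)) / L ^ 2) (xi p)).
  { apply R22_ext; autorewrite with r22; field; lra. }
  rewrite h11, h22; apply R22_ext; autorewrite with r22; field; lra.
Qed.

(** With [H = - (ka + kb) / 2] and [H / E = U], the tension is [2 U xi].  The [xi] part of the
    bitension is the Jacobi operator applied to [U], and the tangential part compares
    [A (grad U)] with [U grad H]; the Codazzi equation [kb' = q (ka - kb)] is what turns
    the divergence of [A] into the gradient of [H]. *)
Lemma surface_biharmonic (g : metric) (E U w : R -> R) :
  is_conf_metric D g E r ->
  (forall p, D p -> 0 < E (fst p) /\ ex_derive E (fst p) /\
    - (ka (fst p) + kb (fst p)) / E (fst p) = 2 * U (fst p)) ->
  (forall p, D p -> is_derive U (fst p) (w (fst p) * U (fst p))) ->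
  (forall p, D p -> exists dw dka,
    is_derive w (fst p) dw /\ is_derive ka (fst p) dka /\
    is_derive kb (fst p) (q (fst p) * (ka (fst p) - kb (fst p))) /\
    dka + q (fst p) * (ka (fst p) - kb (fst p)) = - 2 * w (fst p) * ka (fst p) /\
    dw + w (fst p) ^ 2 + q (fst p) * w (fst p) + ka (fst p) ^ 2 + kb (fst p) ^ 2
      - 2 / L ^ 2 = 0) ->
  biharmonic D g X.
Proof.
  intros hg hE hU hode D' eps e hD' hDD hf p hp.
  assert (hDp := hDD p hp).
  destruct (hode p hDp) as (dw & dka & hdw & hdka & hdkb & hcod & hjac).
  destruct (hE p hDp) as (hEp & (dE & hdE) & hEU).
  assert (hten : forall y, D' y -> tension g eps e X y = scal (2 * U (fst y)) (xi y)).
  { intros y hy; destruct (hE y (hDD y hy)) as (hEy & (dEy & hdEy) & hEUy).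
    rewrite (surface_tension D' g E eps e y dEy) by assumption; rewrite hEUy; reflexivity. }
  unfold bitension.
  rewrite (hten p hp), (surface_curvature_trace D' g E) by assumption.
  rewrite (surface_normal_laplacian D' g E (fun s => 2 * U s) (fun s => 2 * (w s * U s)) eps e
    (tension g eps e X) p dE (2 * (dw * U (fst p) + w (fst p) * (w (fst p) * U (fst p))))
    dka (q (fst p) * (ka (fst p) - kb (fst p)))); try assumption.
  - rewrite hcod.
    replace dw with (2 / L ^ 2 - w (fst p) ^ 2 - q (fst p) * w (fst p) - ka (fst p) ^ 2
      - kb (fst p) ^ 2) by lra.
    apply R22_ext; autorewrite with r22; field; lra.
  - intros y hy; apply (is_derive_scal U (fst y) 2), hU, hDD, hy.
  - apply (is_derive_scal (fun s => w s * U s) (fst p) 2), is_derive_Rmult; auto.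
Qed.

End Surface.

(** * Quadratic systems of differential equations *)

(** [(c, j, k)] stands for the monomial [c y_j y_k]. *)
Definition monomial := (R * nat * nat)%type.

Definition mono (c : R) (j k : nat) : monomial := (c, j, k).

Definition qsum (l : list monomial) (f : nat -> nat -> R) : R :=
  List.fold_right (fun m acc => fst (fst m) * f (snd (fst m)) (snd m) + acc) 0 l.

Definition qnorm (l : list monomial) : R :=
  List.fold_right (fun m acc => Rabs (fst (fst m)) + acc) 0 l.

Definition qrhs (l : list monomial) (y : nat -> R) : R := qsum l (fun j k => y j * y k).

(** The unknowns are [y_0, ..., y_N]. *)
Definition qsystem (Q : nat -> list monomial) (N : nat) (B : R) : Prop :=
  (forall i m, List.In m (Q i) -> (snd (fst m) <= N)%nat /\ (snd m <= N)%nat) /\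
  (forall i, qnorm (Q i) <= B).

Definition qsolution (Q : nat -> list monomial) (N : nat) (s0 r : R) (y : nat -> R -> R) : Prop :=
  forall s, Rabs (s - s0) < r -> forall i, (i <= N)%nat ->
    is_derive (y i) s (qrhs (Q i) (fun j => y j s)).

Lemma qnorm_pos l : 0 <= qnorm l.
Proof.
  induction l as [| m l IH]; [apply Rle_refl |].
  exact (Rplus_le_le_0_compat _ _ (Rabs_pos (fst (fst m))) IH).
Qed.

Lemma qsum_ext l f g : (forall m, List.In m l -> f (snd (fst m)) (snd m) = g (snd (fst m)) (snd m)) ->
  qsum l f = qsum l g.
Proof.
  induction l as [| m l IH]; simpl; intros h; [reflexivity |].
  rewrite (h m (or_introl eq_refl)), IH; auto.
Qed.

Lemma qsum_bound l f C :
  (forall m, List.In m l -> Rabs (f (snd (fst m)) (snd m)) <= C) ->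
  Rabs (qsum l f) <= qnorm l * C.
Proof.
  induction l as [| m l IH]; simpl; intros h.
  - rewrite Rabs_R0; lra.
  - eapply Rle_trans; [apply Rabs_triang |].
    rewrite Rabs_mult, Rmult_plus_distr_r; apply Rplus_le_compat.
    + apply Rmult_le_compat_l; [apply Rabs_pos | apply h; auto].
    + apply IH; auto.
Qed.

Lemma qsum_minus l f g : qsum l f - qsum l g = qsum l (fun j k => f j k - g j k).
Proof.
  induction l as [| m l IH]; simpl; [ring |].
  unfold qsum in *; rewrite <- IH; ring.
Qed.

(** Coefficients of the formal solution: [coef_table n i l] is the coefficient of order [l]
    of [y_i], correct for [l <= n]. *)
Fixpoint coef_table (Q : nat -> list monomial) (c : nat -> R) (n : nat) : nat -> nat -> R :=
  match n with
  | O => fun i _ => c i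
  | S m => fun i l =>
      if Nat.leb l m then coef_table Q c m i l
      else / INR (S m) * qsum (Q i) (fun j k =>
             PS_mult (coef_table Q c m j) (coef_table Q c m k) m)
  end.

Definition coef (Q : nat -> list monomial) (c : nat -> R) (i n : nat) : R := coef_table Q c n i n.

Lemma coef_table_stable Q c n i l : (l <= n)%nat -> coef_table Q c n i l = coef Q c i l.
Proof.
  induction n as [| n IH]; intros h.
  - replace l with 0%nat by lia; reflexivity.
  - destruct (Nat.eq_dec l (S n)) as [-> | hn]; [reflexivity |].
    simpl; rewrite (proj2 (Nat.leb_le l n)) by lia; apply IH; lia.
Qed.

Lemma coef_S Q c i n : INR (S n) * coef Q c i (S n) =
  qsum (Q i) (fun j k => PS_mult (coef Q c j) (coef Q c k) n).
Proof.
  unfold coef at 1; cbn [coef_table].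
  rewrite (proj2 (Nat.leb_gt (S n) n)) by lia.
  rewrite <- Rmult_assoc, Rinv_r, Rmult_1_l by (apply not_0_INR; lia).
  apply qsum_ext; intros m _; unfold PS_mult; apply sum_eq; intros l hl.
  rewrite !coef_table_stable by lia; reflexivity.
Qed.

(** If [|a_l|, |b_l| <= M K^l] then the convolution is at most [(n+1) M^2 K^n]; the factor
    [n+1] is absorbed by the division in the recursion, so that the geometric bound
    propagates as soon as [K >= B M].  This is where degree two is used. *)
Lemma coef_bound Q N B c M K :
  qsystem Q N B -> (forall i, Rabs (c i) <= M) -> B * M <= K -> 0 <= K ->
  forall n i, Rabs (coef Q c i n) <= M * K ^ n.
Proof.
  intros [_ hB] hc hK hK0.
  assert (hM : 0 <= M) by (eapply Rle_trans; [apply Rabs_pos | apply (hc 0%nat)]).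
  assert (hB0 : 0 <= B) by (eapply Rle_trans; [apply qnorm_pos | apply (hB 0%nat)]).
  intros n; induction n as [n IH] using (well_founded_induction PeanoNat.Nat.lt_wf_0); intros i.
  destruct n as [| n].
  - unfold coef; simpl; rewrite Rmult_1_r; apply hc.
  - assert (hn : 0 < INR (S n)) by (apply lt_0_INR; lia).
    apply (Rmult_le_reg_l (INR (S n))); [exact hn |].
    rewrite <- (Rabs_pos_eq (INR (S n))) at 1 by lra.
    rewrite <- Rabs_mult, coef_S.
    eapply Rle_trans.
    + apply (qsum_bound _ _ (INR (S n) * (M * M * K ^ n))); intros m _.
      unfold PS_mult; eapply Rle_trans; [apply Rsum_abs |].
      eapply Rle_trans.
      * apply (sum_Rle _ (fun _ => M * M * K ^ n)); intros l hl.
        rewrite Rabs_mult.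
        replace (M * M * K ^ n) with ((M * K ^ l) * (M * K ^ (n - l))).
        -- apply Rmult_le_compat; try apply Rabs_pos; apply IH; lia.
        -- replace n with (l + (n - l))%nat at 2 by lia; rewrite pow_add; ring.
      * rewrite sum_cte; lra.
    + replace (INR (S n) * (M * K ^ S n)) with ((K * M) * (INR (S n) * K ^ n)) by (simpl; ring).
      replace (qnorm (Q i) * (INR (S n) * (M * M * K ^ n)))
        with (qnorm (Q i) * M * M * (INR (S n) * K ^ n)) by ring.
      apply Rmult_le_compat_r; [apply Rmult_le_pos; [lra | apply pow_le, hK0] |].
      apply Rmult_le_compat_r; [exact hM |].
      eapply Rle_trans; [apply Rmult_le_compat_r; [exact hM | apply (hB i)] | exact hK].
Qed.

Lemma CV_radius_geometric (a : nat -> R) (M K : R) :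
  0 < K -> (forall n, Rabs (a n) <= M * K ^ n) -> Rbar_le (/ K) (CV_radius a).
Proof.
  intros hK ha; apply (CV_radius_bounded a); exists M; intros n.
  rewrite Rabs_mult, <- RPow_abs, (Rabs_pos_eq (/ K)) by (left; apply Rinv_0_lt_compat, hK).
  rewrite pow_inv; apply (Rmult_le_reg_r (K ^ n)); [apply pow_lt, hK |].
  rewrite Rmult_assoc, Rinv_l, Rmult_1_r; [apply ha |].
  apply pow_nonzero; lra.
Qed.

Lemma is_series_0 : is_series (fun _ : nat => 0) 0.
Proof.
  apply (filterlim_ext (fun _ => 0)); [| apply filterlim_const].
  intros n; rewrite sum_n_const; ring.
Qed.

Lemma is_pseries_qsum l (a : nat -> nat -> R) (x : R) :
  (forall i, Rbar_lt (Rabs x) (CV_radius (a i))) ->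
  is_pseries (fun n => qsum l (fun j k => PS_mult (a j) (a k) n)) x
    (qrhs l (fun j => PSeries (a j) x)).
Proof.
  intros ha; unfold qrhs; induction l as [| m l IH]; simpl.
  - apply (is_series_ext (fun _ => 0)); [| apply is_series_0].
    intros n; symmetry; exact (Rmult_0_r _).
  - refine (is_pseries_plus (fun n => fst (fst m) * PS_mult (a (snd (fst m))) (a (snd m)) n)
      _ x _ _ _ IH).
    refine (is_pseries_scal (fst (fst m)) (PS_mult (a (snd (fst m))) (a (snd m))) x _ _ _);
      [apply Rmult_comm |].
    apply is_pseries_mult; try apply ha; apply PSeries_correct, CV_radius_inside, ha.
Qed.

(** Existence, in the form of a convergent power series. *)
Lemma qsystem_exists Q N B (c : nat -> R) (s0 : R) :
  qsystem Q N B -> (exists M, forall i, Rabs (c i) <= M) ->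
  exists (a : nat -> nat -> R) (r : R), 0 < r /\
    (forall i, Rbar_lt 0 (CV_radius (a i))) /\ (forall i, a i 0%nat = c i) /\
    qsolution Q N s0 r (fun i s => PSeries (a i) (s - s0)).
Proof.
  intros hQ [M hM].
  assert (hM0 : 0 <= M) by (eapply Rle_trans; [apply Rabs_pos | apply (hM 0%nat)]).
  assert (hB0 : 0 <= B) by (eapply Rle_trans; [apply qnorm_pos | apply (proj2 hQ 0%nat)]).
  assert (hBM : 0 <= B * M) by (apply Rmult_le_pos; assumption).
  set (K := B * M + 1).
  assert (hK : 0 < K) by (unfold K; lra).
  assert (hcv : forall i, Rbar_le (/ K) (CV_radius (coef Q c i))).
  { intros i; apply (CV_radius_geometric _ M); [exact hK |].
    intros n; apply (coef_bound Q N B); auto; unfold K; lra. }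
  assert (hK' : 0 < / K) by (apply Rinv_0_lt_compat, hK).
  exists (coef Q c), (/ K); split; [| split; [| split]].
  - exact hK'.
  - intros i; eapply Rbar_lt_le_trans; [| apply hcv]; exact hK'.
  - reflexivity.
  - intros s hs i _.
    assert (hin : forall j, Rbar_lt (Rabs (s - s0)) (CV_radius (coef Q c j))).
    { intros j; eapply Rbar_lt_le_trans; [| apply hcv]; exact hs. }
    eapply is_derive_eq.
    + apply (is_derive_comp (PSeries (coef Q c i)) (fun s => s - s0)).
      * apply is_derive_PSeries, hin.
      * apply is_derive_Rminus; [apply is_derive_idR | apply is_derive_cst].
    + transitivity (PSeries (PS_derive (coef Q c i)) (s - s0)).
      { unfold scal; simpl; unfold mult; simpl; ring. }
      apply is_pseries_unique.
      apply (is_pseries_ext (fun n => qsum (Q i) (fun j k =>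
        PS_mult (coef Q c j) (coef Q c k) n))).
      * intros n; unfold PS_derive; symmetry; apply coef_S.
      * apply (is_pseries_qsum (Q i) (coef Q c)), hin.
Qed.

(** [f exp (- K t)] decreases to the right of [s0] and [f exp (K t)] increases to its left. *)
Lemma gronwall (f df : R -> R) (a b K s0 : R) :
  (forall t, a <= t <= b -> is_derive f t (df t)) ->
  (forall t, a <= t <= b -> 0 <= f t) ->
  (forall t, a <= t <= b -> Rabs (df t) <= K * f t) ->
  a <= s0 <= b -> f s0 = 0 -> forall t, a <= t <= b -> f t = 0.
Proof.
  intros hd hf hK hs0 h0 t ht.
  assert (hG : forall k x, a <= x <= b ->
    is_derive (fun y => f y * exp (k * y)) x ((df x + k * f x) * exp (k * x))).
  { intros k x hx; eapply is_derive_eq.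
    - apply is_derive_Rmult; [apply hd, hx |].
      apply (is_derive_comp exp (fun y => k * y)); [apply is_derive_exp |].
      apply is_derive_Rmult; [apply is_derive_cst | apply is_derive_idR].
    - unfold scal; simpl; unfold mult; simpl; ring. }
  assert (hle : f t <= 0); [| generalize (hf t ht); lra].
  destruct (Rle_dec s0 t) as [hst | hst].
  - destruct (MVT_gen (fun y => f y * exp (- K * y)) s0 t
      (fun x => (df x + - K * f x) * exp (- K * x))) as (x & hx & hxe).
    + intros x hx; rewrite Rmin_left, Rmax_right in hx by lra; apply hG; lra.
    + intros x hx; rewrite Rmin_left, Rmax_right in hx by lra.
      apply continuity_pt_filterlim, (ex_derive_continuous (fun y => f y * exp (- K * y))).
      eexists; apply hG; lra.
    + rewrite Rmin_left, Rmax_right in hx by lra.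
      rewrite h0, Rmult_0_l, Rminus_0_r in hxe.
      assert (hxab : a <= x <= b) by lra.
      assert (h1 := Rle_trans _ _ _ (Rle_abs _) (hK x hxab)).
      assert (h2 := exp_pos (- K * x)); assert (h3 := exp_pos (- K * t)).
      apply (Rmult_le_reg_r (exp (- K * t))); [exact h3 |].
      rewrite hxe, Rmult_0_l.
      assert (0 <= (- (df x + - K * f x)) * exp (- K * x) * (t - s0)).
      { apply Rmult_le_pos; [apply Rmult_le_pos |]; lra. }
      lra.
  - destruct (MVT_gen (fun y => f y * exp (K * y)) t s0
      (fun x => (df x + K * f x) * exp (K * x))) as (x & hx & hxe).
    + intros x hx; rewrite Rmin_left, Rmax_right in hx by lra; apply hG; lra.
    + intros x hx; rewrite Rmin_left, Rmax_right in hx by lra.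
      apply continuity_pt_filterlim, (ex_derive_continuous (fun y => f y * exp (K * y))).
      eexists; apply hG; lra.
    + rewrite Rmin_left, Rmax_right in hx by lra.
      rewrite h0, Rmult_0_l in hxe.
      assert (hxab : a <= x <= b) by lra.
      assert (h1 := Rle_trans _ _ _ (Rle_abs _) (eq_ind_r (fun z => z <= _) (hK x hxab) (Rabs_Ropp _))).
      assert (h2 := exp_pos (K * x)); assert (h3 := exp_pos (K * t)).
      apply (Rmult_le_reg_r (exp (K * t))); [exact h3 |].
      rewrite Rmult_0_l.
      assert (0 <= (df x + K * f x) * exp (K * x) * (s0 - t)).
      { apply Rmult_le_pos; [apply Rmult_le_pos |]; lra. }
      lra.
Qed.

Lemma finite_family_bounded (y : nat -> R -> R) (N : nat) (a b : R) :
  a <= b -> (forall i t, (i <= N)%nat -> a <= t <= b -> continuous (y i) t) ->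
  exists M, 0 <= M /\ forall i t, (i <= N)%nat -> a <= t <= b -> Rabs (y i t) <= M.
Proof.
  intros hab; assert (h : forall n, (n <= S N)%nat ->
    (forall i t, (i <= N)%nat -> a <= t <= b -> continuous (y i) t) ->
    exists M, 0 <= M /\ forall i t, (i < n)%nat -> a <= t <= b -> Rabs (y i t) <= M).
  { intros n; induction n as [| n IH]; intros hn hc.
    - exists 0; split; [lra | intros; lia].
    - destruct (IH ltac:(lia) hc) as (M & hM0 & hM).
      destruct (continuity_ab_maj (fun t => Rabs (y n t)) a b hab) as (m & hm & _).
      + intros t ht; apply continuity_pt_filterlim.
        apply (continuous_comp (y n) Rabs); [apply hc; [lia | auto] | apply continuous_Rabs].
      + exists (Rmax M (Rabs (y n m))); split.
        * eapply Rle_trans; [exact hM0 | apply Rmax_l].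
        * intros i t hi ht; destruct (Nat.eq_dec i n) as [-> |].
          -- eapply Rle_trans; [apply hm, ht | apply Rmax_r].
          -- eapply Rle_trans; [apply hM; lia || exact ht | apply Rmax_l]. }
  intros hc; destruct (h (S N) ltac:(lia) hc) as (M & hM0 & hM).
  exists M; split; [exact hM0 | intros i t hi; apply hM; lia].
Qed.

Lemma is_derive_sum_f_R0 (f : nat -> R -> R) (df : nat -> R) (x : R) (n : nat) :
  (forall i, (i <= n)%nat -> is_derive (f i) x (df i)) ->
  is_derive (fun s => sum_f_R0 (fun i => f i s) n) x (sum_f_R0 df n).
Proof.
  induction n as [| n IH]; intros h; simpl.
  - apply h; lia.
  - apply is_derive_Rplus; [apply IH; intros; apply h; lia | apply h; lia].
Qed.

Lemma sum_f_R0_term_le (f : nat -> R) (n i : nat) :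
  (forall j, 0 <= f j) -> (i <= n)%nat -> f i <= sum_f_R0 f n.
Proof.
  intros hf hi; induction n as [| n IH]; simpl.
  - replace i with 0%nat by lia; lra.
  - destruct (Nat.eq_dec i (S n)) as [-> |].
    + generalize (cond_pos_sum f n hf); lra.
    + generalize (IH ltac:(lia)) (hf (S n)); lra.
Qed.

(** Uniqueness: a quadratic right-hand side is Lipschitz on bounded sets, so that the squared
    distance [f] of two solutions satisfies [|f'| <= K f] on compact intervals. *)
Lemma qsolution_unique Q N B s0 r (y z : nat -> R -> R) :
  qsystem Q N B -> qsolution Q N s0 r y -> qsolution Q N s0 r z ->
  (forall i, (i <= N)%nat -> y i s0 = z i s0) ->
  forall s, Rabs (s - s0) < r -> forall i, (i <= N)%nat -> y i s = z i s.
Proof.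
  intros [hQ hB] hy hz h0 s hs.
  set (a := s0 - Rabs (s - s0)); set (b := s0 + Rabs (s - s0)).
  assert (hpos := Rabs_pos (s - s0)).
  assert (hin : forall t, a <= t <= b -> Rabs (t - s0) < r).
  { intros t ht; eapply Rle_lt_trans; [| exact hs]; apply Rabs_le; unfold a, b in ht; lra. }
  assert (hab : a <= b) by (unfold a, b; lra).
  destruct (finite_family_bounded y N a b hab) as (My & hMy0 & hMy).
  { intros i t hi ht; apply (ex_derive_continuous (y i)); eexists; apply hy; auto. }
  destruct (finite_family_bounded z N a b hab) as (Mz & hMz0 & hMz).
  { intros i t hi ht; apply (ex_derive_continuous (z i)); eexists; apply hz; auto. }
  set (d := fun i t => y i t - z i t).
  set (D := fun t => sum_f_R0 (fun i => d i t * d i t) N).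
  set (rh := fun i t => qrhs (Q i) (fun j => y j t) - qrhs (Q i) (fun j => z j t)).
  assert (hDi : forall i t, (i <= N)%nat -> d i t * d i t <= D t).
  { intros i t hi; unfold D.
    apply (sum_f_R0_term_le (fun i => d i t * d i t)); [intros; apply Rle_0_sqr | exact hi]. }
  assert (hDpos : forall t, 0 <= D t).
  { intros t; eapply Rle_trans; [apply Rle_0_sqr | apply (hDi 0%nat t); lia]. }
  assert (hprod : forall i j t, (i <= N)%nat -> (j <= N)%nat ->
    Rabs (d i t) * Rabs (d j t) <= D t).
  { intros i j t hi hj; generalize (hDi i t hi) (hDi j t hj).
    replace (d i t * d i t) with (Rabs (d i t) * Rabs (d i t)) by (symmetry; apply Rsqr_abs).
    replace (d j t * d j t) with (Rabs (d j t) * Rabs (d j t)) by (symmetry; apply Rsqr_abs).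
    generalize (Rle_0_sqr (Rabs (d i t) - Rabs (d j t))); unfold Rsqr; lra. }
  assert (hrh : forall i t, (i <= N)%nat -> a <= t <= b ->
    Rabs (d i t) * Rabs (rh i t) <= B * ((My + Mz) * D t)).
  { intros i t hi ht; unfold rh, qrhs; rewrite qsum_minus, <- Rabs_mult.
    replace (d i t * qsum (Q i) (fun j k => y j t * y k t - z j t * z k t))
      with (qsum (Q i) (fun j k => d i t * (y j t * y k t - z j t * z k t))).
    2: { generalize (Q i); intros l; induction l as [| m l IH]; simpl; [ring |].
         unfold qsum in *; rewrite IH; ring. }
    eapply Rle_trans.
    - apply (qsum_bound _ _ ((My + Mz) * D t)); intros m hm.
      destruct (hQ i m hm) as [hj hk].
      replace (d i t * (y (snd (fst m)) t * y (snd m) t - z (snd (fst m)) t * z (snd m) t))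
        with (y (snd (fst m)) t * (d i t * d (snd m) t) + z (snd m) t * (d i t * d (snd (fst m)) t))
        by (unfold d; ring).
      eapply Rle_trans; [apply Rabs_triang |].
      rewrite !Rabs_mult, Rmult_plus_distr_r.
      apply Rplus_le_compat; apply Rmult_le_compat; auto using Rabs_pos;
        apply Rmult_le_pos; apply Rabs_pos.
    - apply Rmult_le_compat_r; [apply Rmult_le_pos; [lra | apply hDpos] | apply hB]. }
  assert (hD0 : D s = 0).
  { apply (gronwall D (fun t => sum_f_R0 (fun i => 2 * (d i t * rh i t)) N) a b
      (INR (S N) * (2 * (B * (My + Mz)))) s0).
    - intros t ht; apply (is_derive_sum_f_R0 (fun i t => d i t * d i t)).
      intros i hi.
      assert (hd : is_derive (d i) t (rh i t)).
      { apply is_derive_Rminus; [exact (hy t (hin t ht) i hi) | exact (hz t (hin t ht) i hi)]. }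
      eapply is_derive_eq; [exact (is_derive_Rmult (d i) (d i) t _ _ hd hd) | ring].
    - intros t _; apply hDpos.
    - intros t ht; eapply Rle_trans; [apply Rsum_abs |].
      eapply Rle_trans.
      + apply (sum_Rle _ (fun _ => 2 * (B * (My + Mz) * D t))); intros i hi.
        rewrite !Rabs_mult, (Rabs_pos_eq 2) by lra.
        apply Rmult_le_compat_l; [lra |]; rewrite (Rmult_assoc B); apply hrh; auto.
      + rewrite sum_cte; lra.
    - unfold a, b; lra.
    - unfold D; replace 0 with (sum_f_R0 (fun _ => 0) N) by (rewrite sum_cte; ring).
      apply sum_eq; intros i hi; unfold d; rewrite (h0 i hi); ring.
    - unfold a, b; generalize (Rle_abs (s - s0)) (Rle_abs (- (s - s0))); rewrite Rabs_Ropp; lra. }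
  intros i hi; apply Rminus_diag_uniq; change (d i s = 0).
  apply Rsqr_0_uniq, Rle_antisym; [rewrite <- hD0; apply hDi, hi | apply Rle_0_sqr].
Qed.

(** A solution is analytic at each point: there it coincides with the power series that solves
    the same initial value problem. *)
Lemma qsolution_analytic Q N B s0 r (y : nat -> R -> R) :
  0 < r -> qsystem Q N B -> qsolution Q N s0 r y ->
  forall i, (i <= N)%nat -> analytic_at (y i) s0.
Proof.
  intros hr hQ hy i hi.
  set (c := fun j => if Nat.leb j N then y j s0 else 0).
  destruct (qsystem_exists Q N B c s0 hQ) as (a & r' & hr' & hcv & ha0 & hsol).
  { exists (sum_f_R0 (fun j => Rabs (y j s0)) N); intros j; unfold c.
    destruct (Nat.leb_spec j N).
    - apply (sum_f_R0_term_le (fun j => Rabs (y j s0))); [intros; apply Rabs_pos | assumption].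
    - rewrite Rabs_R0; apply cond_pos_sum; intros; apply Rabs_pos. }
  exists (a i); split; [apply hcv |].
  assert (hm : 0 < Rmin r r') by (apply Rmin_pos; assumption).
  exists (mkposreal _ hm); intros s hs.
  apply (qsolution_unique Q N B s0 (Rmin r r') y (fun j s => PSeries (a j) (s - s0)) hQ).
  - intros t ht; apply hy; eapply Rlt_le_trans; [exact ht | apply Rmin_l].
  - intros t ht; apply hsol; eapply Rlt_le_trans; [exact ht | apply Rmin_r].
  - intros j hj; rewrite Rminus_diag, PSeries_0, ha0; unfold c.
    rewrite (proj2 (Nat.leb_le j N) hj); reflexivity.
  - exact hs.
  - exact hi.
Qed.

(** * Real-analytic functions *)

Lemma analytic_at_ball f x : analytic_at f x ->
  exists (a : nat -> R) (r : R), 0 < r /\ Rbar_lt r (CV_radius a) /\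
    forall y, Rabs (y - x) < r -> f y = PSeries a (y - x).
Proof.
  intros (a & ha & e & he).
  assert (hr : exists r, 0 < r /\ Rbar_lt r (CV_radius a)).
  { destruct (CV_radius a) as [c | |]; simpl in ha |- *; try contradiction.
    - exists (c / 2); lra.
    - exists 1; split; [lra | exact I]. }
  destruct hr as (r & hr0 & hr).
  exists a, (Rmin r e); split; [apply Rmin_pos; [exact hr0 | apply cond_pos] |]; split.
  - eapply Rbar_le_lt_trans; [| exact hr]; apply Rmin_l.
  - intros y hy; apply he; eapply Rlt_le_trans; [exact hy | apply Rmin_r].
Qed.

Lemma analytic_at_of_ball f x (a : nat -> R) (r : R) :
  0 < r -> Rbar_lt 0 (CV_radius a) ->
  (forall y, Rabs (y - x) < r -> f y = PSeries a (y - x)) -> analytic_at f x.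
Proof.
  intros hr ha he; exists a; split; [exact ha |].
  exists (mkposreal r hr); intros y hy; apply he, hy.
Qed.

Lemma ex_pseries_CV_radius (a : nat -> R) (x : R) : ex_pseries a x -> Rbar_le (Rabs x) (CV_radius a).
Proof.
  intros hx; apply Rbar_not_lt_le; intros hlt; apply (CV_disk_outside a x hlt).
  apply (ex_series_lim_0 (fun n => a n * x ^ n)).
  revert hx; apply ex_series_ext; intros n; apply Rmult_comm.
Qed.

Lemma analytic_at_ext_loc f g x :
  locally x (fun y => f y = g y) -> analytic_at f x -> analytic_at g x.
Proof.
  intros he (a & ha & hl); exists a; split; [exact ha |].
  generalize (filter_and _ _ he hl); apply filter_imp; intros y [e1 e2]; rewrite <- e1; exact e2.
Qed.

Lemma analytic_at_ext f g x : (forall y, f y = g y) -> analytic_at f x -> analytic_at g x.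
Proof. intros he; apply analytic_at_ext_loc, filter_forall, he. Qed.

Lemma analytic_at_plus f g x :
  analytic_at f x -> analytic_at g x -> analytic_at (fun y => f y + g y) x.
Proof.
  intros hf hg.
  destruct (analytic_at_ball f x hf) as (a & r & hr & har & ha).
  destruct (analytic_at_ball g x hg) as (b & q & hq & hbq & hb).
  apply (analytic_at_of_ball _ x (PS_plus a b) (Rmin r q)); [apply Rmin_pos; assumption | |].
  - eapply Rbar_lt_le_trans; [| apply CV_radius_plus].
    apply Rbar_min_case; eapply Rbar_lt_trans; try eassumption; assumption.
  - intros y hy.
    assert (h1 : Rabs (y - x) < r) by (eapply Rlt_le_trans; [exact hy | apply Rmin_l]).
    assert (h2 : Rabs (y - x) < q) by (eapply Rlt_le_trans; [exact hy | apply Rmin_r]).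
    rewrite (ha y h1), (hb y h2); symmetry; apply PSeries_plus; apply CV_radius_inside;
      eapply Rbar_lt_trans; try eassumption; assumption.
Qed.

Lemma analytic_at_mult f g x :
  analytic_at f x -> analytic_at g x -> analytic_at (fun y => f y * g y) x.
Proof.
  intros hf hg.
  destruct (analytic_at_ball f x hf) as (a & r & hr & har & ha).
  destruct (analytic_at_ball g x hg) as (b & q & hq & hbq & hb).
  set (m := Rmin r q).
  assert (hm : 0 < m) by (apply Rmin_pos; assumption).
  assert (hma : Rbar_lt m (CV_radius a))
    by (eapply Rbar_le_lt_trans; [| exact har]; apply Rmin_l).
  assert (hmb : Rbar_lt m (CV_radius b))
    by (eapply Rbar_le_lt_trans; [| exact hbq]; apply Rmin_r).
  apply (analytic_at_of_ball _ x (PS_mult a b) m); [exact hm | |].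
  - apply (Rbar_lt_le_trans _ (Rabs m)); [simpl; rewrite Rabs_pos_eq; lra |].
    apply ex_pseries_CV_radius, ex_pseries_mult; rewrite Rabs_pos_eq by lra; assumption.
  - intros y hy.
    rewrite (ha y), (hb y).
    + symmetry; apply PSeries_mult; eapply Rbar_lt_trans; try eassumption; exact hy.
    + eapply Rlt_le_trans; [exact hy | apply Rmin_r].
    + eapply Rlt_le_trans; [exact hy | apply Rmin_l].
Qed.

Lemma analytic_at_const c x : analytic_at (fun _ => c) x.
Proof.
  set (a := fun n => match n with O => c | _ => 0 end).
  assert (hs : forall h, is_pseries a h c).
  { intros h; apply is_series_decr_1.
    replace (plus _ _) with 0
      by (change (0 = c + - (1 * c)); ring).
    apply (is_series_ext (fun _ => 0)); [| apply is_series_0].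
    intros n; symmetry; exact (Rmult_0_r _). }
  apply (analytic_at_of_ball _ x a 1); [lra | |].
  - apply (Rbar_lt_le_trans _ (Rabs 1)); [simpl; rewrite Rabs_R1; lra |].
    apply ex_pseries_CV_radius; eexists; apply hs.
  - intros y _; symmetry; apply is_pseries_unique, hs.
Qed.

Lemma analytic_at_scal c f x : analytic_at f x -> analytic_at (fun y => c * f y) x.
Proof. apply (analytic_at_mult (fun _ => c)), analytic_at_const. Qed.

Lemma analytic_at_opp f x : analytic_at f x -> analytic_at (fun y => - f y) x.
Proof.
  intros hf; apply (analytic_at_ext (fun y => -1 * f y)); [intros; ring |].
  apply analytic_at_scal, hf.
Qed.

Lemma analytic_at_minus f g x :
  analytic_at f x -> analytic_at g x -> analytic_at (fun y => f y - g y) x.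
Proof. intros hf hg; exact (analytic_at_plus f _ x hf (analytic_at_opp g x hg)). Qed.

Lemma analytic_at_ex_derive_n f x n : analytic_at f x -> ex_derive_n f n x.
Proof.
  intros (a & ha & hl).
  apply (ex_derive_n_ext_loc (fun y => PSeries a (y - x))).
  - revert hl; apply filter_imp; intros y e; symmetry; exact e.
  - apply (ex_derive_n_ext (fun y => PSeries a (y + - x))); [reflexivity |].
    apply (ex_derive_n_comp_trans (PSeries a)).
    apply ex_derive_n_PSeries.
    rewrite Rplus_opp_r, Rabs_R0; exact ha.
Qed.

Lemma analytic_at_derive f x : analytic_at f x -> is_derive f x (Derive f x).
Proof. intros hf; apply Derive_correct, (analytic_at_ex_derive_n f x 1 hf). Qed.

Lemma is_series_3 (A B C : R) :
  is_series (fun n => match n with 0%nat => A | 1%nat => B | 2%nat => C | _ => 0 end) (A + B + C).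
Proof.
  apply (is_series_decr_n _ 3); [lia |].
  replace (plus _ _) with 0.
  - apply (is_series_ext (fun _ => 0)); [reflexivity | apply is_series_0].
  - simpl pred; rewrite !sum_Sn, sum_O; change (0 = (A + B + C) + - ((A + B) + C)); ring.
Qed.

(** The orbits of a parabolic group are quadratic in the group parameter, so that only double
    series with finitely many powers of the second variable are needed. *)
Lemma analytic2_at_quadratic_centered (g0 g1 g2 : R -> R) (p : R * R) :
  analytic_at g0 (fst p) -> analytic_at g1 (fst p) -> analytic_at g2 (fst p) ->
  analytic2_at (fun q => g0 (fst q) + g1 (fst q) * (snd q - snd p)
     + g2 (fst q) * (snd q - snd p) ^ 2) p.
Proof.
  intros h0 h1 h2.
  destruct (analytic_at_ball g0 _ h0) as (b0 & r0 & hr0 & hb0 & he0).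
  destruct (analytic_at_ball g1 _ h1) as (b1 & r1 & hr1 & hb1 & he1).
  destruct (analytic_at_ball g2 _ h2) as (b2 & r2 & hr2 & hb2 & he2).
  set (a := fun m n => match n with 0%nat => b0 m | 1%nat => b1 m | 2%nat => b2 m | _ => 0 end).
  exists a, (Rmin r0 (Rmin r1 r2)); split; [repeat apply Rmin_pos; assumption |].
  intros h k hh _.
  assert (k0 : Rabs h < r0) by (eapply Rlt_le_trans; [exact hh | apply Rmin_l]).
  assert (k1 : Rabs h < r1)
    by (eapply Rlt_le_trans; [exact hh | eapply Rle_trans; [apply Rmin_r | apply Rmin_l]]).
  assert (k2 : Rabs h < r2)
    by (eapply Rlt_le_trans; [exact hh | eapply Rle_trans; [apply Rmin_r | apply Rmin_r]]).
  assert (hT : forall m, is_series (fun n => a m n * h ^ m * k ^ n)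
    (b0 m * h ^ m + b1 m * h ^ m * k + b2 m * h ^ m * k ^ 2)).
  { intros m; eapply is_series_ext; [| apply is_series_3].
    intros [| [| [| n]]]; unfold a; simpl; ring. }
  assert (hA : forall m, is_series (fun n => Rabs (a m n * h ^ m * k ^ n))
    (Rabs (b0 m * h ^ m) + Rabs (b1 m * h ^ m) * Rabs k + Rabs (b2 m * h ^ m) * Rabs (k ^ 2))).
  { intros m; eapply is_series_ext; [| apply is_series_3].
    intros [| [| [| n]]]; unfold a; cbv beta iota.
    - rewrite pow_O, Rmult_1_r; reflexivity.
    - rewrite pow_1, <- Rabs_mult; reflexivity.
    - rewrite <- Rabs_mult; reflexivity.
    - rewrite Rmult_0_l, Rmult_0_l, Rabs_R0; reflexivity. }
  assert (d0 : ex_series (fun m => Rabs (b0 m * h ^ m)))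
    by (apply CV_disk_inside; eapply Rbar_lt_trans; [| exact hb0]; exact k0).
  assert (d1 : ex_series (fun m => Rabs (b1 m * h ^ m)))
    by (apply CV_disk_inside; eapply Rbar_lt_trans; [| exact hb1]; exact k1).
  assert (d2 : ex_series (fun m => Rabs (b2 m * h ^ m)))
    by (apply CV_disk_inside; eapply Rbar_lt_trans; [| exact hb2]; exact k2).
  split; [intros m; eexists; apply hA |]; split.
  - apply (ex_series_ext (fun m => Rabs (b0 m * h ^ m) + Rabs (b1 m * h ^ m) * Rabs k
      + Rabs (b2 m * h ^ m) * Rabs (k ^ 2))).
    + intros m; symmetry; apply is_series_unique, hA.
    + refine (ex_series_plus (fun m => _ + _) (fun m => _) (ex_series_plus (fun m => _) (fun m => _) _ _) _).
      * exact d0.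
      * apply ex_series_scal_r, d1.
      * apply ex_series_scal_r, d2.
  - simpl fst; simpl snd.
    replace (fst p + h) with (h + fst p) by ring.
    rewrite (he0 (h + fst p)), (he1 (h + fst p)), (he2 (h + fst p))
      by (replace (h + fst p - fst p) with h by ring; assumption).
    replace (h + fst p - fst p) with h by ring.
    replace (snd p + k - snd p) with k by ring.
    symmetry; apply is_series_unique.
    apply (is_series_ext (fun m => b0 m * h ^ m + b1 m * h ^ m * k + b2 m * h ^ m * k ^ 2)).
    { intros m; symmetry; apply is_series_unique, hT. }
    assert (hP : forall b, Rbar_lt (Rabs h) (CV_radius b) ->
      is_series (fun m => b m * h ^ m) (PSeries b h)).
    { intros b hb; apply (is_series_ext (fun n => scal (pow_n h n) (b n))).
      - intros n; apply Rmult_comm.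
      - apply PSeries_correct, CV_radius_inside, hb. }
    refine (is_series_plus (fun m => _ + _) (fun m => _) _ _ (is_series_plus (fun m => _) (fun m => _) _ _ _ _) _).
    + apply hP; eapply Rbar_lt_trans; [| exact hb0]; exact k0.
    + apply is_series_scal_r, hP; eapply Rbar_lt_trans; [| exact hb1]; exact k1.
    + apply is_series_scal_r, hP; eapply Rbar_lt_trans; [| exact hb2]; exact k2.
Qed.

Lemma analytic2_at_ext f g p : (forall q, f q = g q) -> analytic2_at f p -> analytic2_at g p.
Proof.
  intros he (a & r & hr & h); exists a, r; split; [exact hr |].
  intros x y hx hy; rewrite <- he; apply h; assumption.
Qed.

Lemma analytic2_at_quadratic (g0 g1 g2 : R -> R) (p : R * R) :
  analytic_at g0 (fst p) -> analytic_at g1 (fst p) -> analytic_at g2 (fst p) ->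
  analytic2_at (fun q => g0 (fst q) + g1 (fst q) * snd q + g2 (fst q) * snd q ^ 2) p.
Proof.
  intros h0 h1 h2.
  eapply analytic2_at_ext;
    [| apply (analytic2_at_quadratic_centered
         (fun s => g0 s + snd p * g1 s + snd p ^ 2 * g2 s)
         (fun s => g1 s + 2 * snd p * g2 s) g2 p)];
    [intros q; cbv beta; ring | | | exact h2].
  - apply analytic_at_plus; [apply analytic_at_plus |]; try apply analytic_at_scal; assumption.
  - apply analytic_at_plus; [| apply analytic_at_scal]; assumption.
Qed.

Lemma is_series_head (A : R) :
  is_series (fun n => match n with 0%nat => A | _ => 0 end) A.
Proof.
  apply (is_series_ext (fun n => match n with 0%nat => A | 1%nat => 0 | 2%nat => 0 | _ => 0 end)).
  - intros [| [| [| n]]]; reflexivity.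
  - generalize (is_series_3 A 0 0); rewrite !Rplus_0_r; exact (fun h => h).
Qed.

Lemma CV_radius_pos (a : nat -> R) (h : R) :
  h <> 0 -> ex_series (fun n => Rabs (a n * h ^ n)) -> Rbar_lt 0 (CV_radius a).
Proof.
  intros hh hs; apply (Rbar_lt_le_trans _ (Rabs h)); [apply Rabs_pos_lt, hh |].
  apply ex_pseries_CV_radius, (ex_series_ext (fun n => a n * h ^ n)).
  - intros n; apply Rmult_comm.
  - apply ex_series_Rabs, hs.
Qed.

Lemma PSeries_as_Series (a : nat -> R) (h : R) : PSeries a h = Series (fun n => a n * h ^ n).
Proof. reflexivity. Qed.

(** Restriction of a double power series to the coordinate lines. *)
Lemma analytic2_at_line i f p : analytic2_at f p -> analytic_at (fun x => f (line i p x)) (coord i p).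
Proof.
  intros (a & r & hr & h).
  assert (hr2 : Rabs (r / 2) < r) by (rewrite Rabs_pos_eq; lra).
  assert (h00 : Rabs 0 < r) by (rewrite Rabs_R0; lra).
  assert (hpow : forall (b x : R) n, b * 0 ^ n = match n with 0%nat => b | _ => 0 end).
  { intros b x [| n]; simpl; ring. }
  destruct i; unfold line, coord.
  - assert (e : forall x, Rabs x < r -> forall m, Series (fun n => a m n * x ^ m * 0 ^ n)
              = a m 0%nat * x ^ m).
    { intros x hx m; apply is_series_unique.
      eapply is_series_ext; [| apply is_series_head].
      intros [| n]; simpl; ring. }
    apply (analytic_at_of_ball _ _ (fun m => a m 0%nat) r); [exact hr | |].
    + destruct (h (r / 2) 0 hr2 h00) as (_ & hs & _).
      apply (CV_radius_pos _ (r / 2)); [lra |].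
      revert hs; apply ex_series_ext; intros m; apply is_series_unique.
      eapply is_series_ext; [| apply is_series_head].
      intros [| n]; cbv beta iota.
      * rewrite pow_O, Rmult_1_r; reflexivity.
      * rewrite pow_i, Rmult_0_r, Rabs_R0 by lia; reflexivity.
    + intros y hy; destruct (h (y - fst p) 0 hy h00) as (_ & _ & hf).
      replace (fst p + (y - fst p)) with y in hf by ring; rewrite Rplus_0_r in hf.
      rewrite hf, PSeries_as_Series; apply Series_ext; intros m; apply e, hy.
  - apply (analytic_at_of_ball _ _ (fun n => a 0%nat n) r); [exact hr | |].
    + destruct (h 0 (r / 2) h00 hr2) as (hs & _ & _).
      apply (CV_radius_pos _ (r / 2)); [lra |].
      generalize (hs 0%nat); apply ex_series_ext; intros n; rewrite pow_O, Rmult_1_r; reflexivity.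
    + intros y hy; destruct (h 0 (y - snd p) h00 hy) as (_ & _ & hf).
      replace (snd p + (y - snd p)) with y in hf by ring; rewrite Rplus_0_r in hf.
      rewrite hf, PSeries_as_Series; apply is_series_unique.
      eapply is_series_ext; [| apply is_series_head].
      intros [| m]; cbv beta iota; symmetry.
      * apply Series_ext; intros n; rewrite pow_O, Rmult_1_r; reflexivity.
      * apply is_series_unique, (is_series_ext (fun _ => 0)); [| apply is_series_0].
        intros n; rewrite pow_i, Rmult_0_r, Rmult_0_l by lia; reflexivity.
Qed.

(** * The initial value problem as a quadratic system *)

(** Unknowns, in this order: [1], [theta], [p = theta'], [w = H'/k1], [S = sinh theta],
    [C = cosh theta], [rho], [1/rho], the primitive [z] of [S/rho], and [u]. *)
Definition profile_system (L : R) (i : nat) : list monomial :=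
  match i with
  | 1%nat => mono 1 0 2 :: nil
  | 2%nat => mono (- 2) 3 2 :: mono (- 2 / L) 3 4 :: mono (- 2 / L) 2 5 :: nil
  | 3%nat => mono (- 1) 3 3 :: mono (- / L) 5 3 :: mono (- 1) 2 2 :: mono (- 2 / L) 2 4
         :: mono (- 2 / L ^ 2) 4 4 :: mono (2 / L ^ 2) 0 0 :: nil
  | 4%nat => mono 1 5 2 :: nil
  | 5%nat => mono 1 4 2 :: nil
  | 6%nat => mono (/ L) 5 6 :: nil
  | 7%nat => mono (- / L) 5 7 :: nil
  | 8%nat => mono 1 4 7 :: nil
  | 9%nat => mono 1 3 9 :: nil
  | _ => nil
  end%list.

Definition profile_norm (L : R) : R := sum_f_R0 (fun i => qnorm (profile_system L i)) 9.

Lemma profile_qsystem L : qsystem (profile_system L) 9 (profile_norm L).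
Proof.
  split.
  - intros i m hm.
    do 10 (destruct i as [| i];
      [simpl in hm; repeat (destruct hm as [<- | hm]; [simpl; lia |]); destruct hm |]).
    destruct hm.
  - intros i; unfold profile_norm.
    destruct (Nat.le_gt_cases i 9) as [hi | hi].
    + apply (sum_f_R0_term_le (fun i => qnorm (profile_system L i))); [intros; apply qnorm_pos | exact hi].
    + replace (profile_system L i) with (@nil monomial).
      * apply cond_pos_sum; intros; apply qnorm_pos.
      * do 10 (destruct i as [| i]; [lia |]); reflexivity.
Qed.

Lemma qsolution_shift Q N s0 s1 r y :
  qsolution Q N s0 r y -> qsolution Q N s1 (r - Rabs (s1 - s0)) y.
Proof.
  intros hy s hs; apply hy.
  replace (s - s0) with ((s - s1) + (s1 - s0)) by ring.
  eapply Rle_lt_trans; [apply Rabs_triang | lra].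
Qed.

Lemma qsolution_analytic_on Q N B s0 r y :
  qsystem Q N B -> qsolution Q N s0 r y ->
  forall s, Rabs (s - s0) < r -> forall i, (i <= N)%nat -> analytic_at (y i) s.
Proof.
  intros hQ hy s hs i hi.
  apply (qsolution_analytic Q N B s (r - Rabs (s - s0))); auto; [lra |].
  apply qsolution_shift, hy.
Qed.

Lemma zero_derive_constant (f : R -> R) (s0 r : R) :
  (forall s, Rabs (s - s0) < r -> is_derive f s 0) ->
  forall s, Rabs (s - s0) < r -> f s = f s0.
Proof.
  intros h s hs.
  destruct (Rtotal_order s s0) as [hlt | [-> | hgt]]; [| reflexivity |].
  - apply (eq_is_derive f s s0); [| exact hlt].
    intros t ht; apply h; rewrite Rabs_left1 by lra; rewrite Rabs_left in hs by lra; lra.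
  - symmetry; apply (eq_is_derive f s0 s); [| exact hgt].
    intros t ht; apply h; rewrite Rabs_pos_eq by lra; rewrite Rabs_pos_eq in hs by lra; lra.
Qed.

Lemma locally_Rabs_lt (s r : R) : Rabs s < r -> locally s (fun y => Rabs y < r).
Proof.
  intros hs; assert (he : 0 < r - Rabs s) by lra.
  exists (mkposreal _ he); intros y hy.
  replace y with ((y - s) + s) by ring.
  eapply Rle_lt_trans; [apply Rabs_triang |].
  assert (hy' : Rabs (y - s) < r - Rabs s) by exact hy.
  lra.
Qed.

Lemma is_derive_sinh_comp (f : R -> R) (x l : R) :
  is_derive f x l -> is_derive (fun y => sinh (f y)) x (cosh (f x) * l).
Proof.
  intros hf; eapply is_derive_eq.
  - apply (is_derive_comp sinh f x (cosh (f x)) l); [| exact hf].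
    apply is_derive_Reals, derivable_pt_lim_sinh.
  - apply Rmult_comm.
Qed.

Lemma is_derive_cosh_comp (f : R -> R) (x l : R) :
  is_derive f x l -> is_derive (fun y => cosh (f y)) x (sinh (f x) * l).
Proof.
  intros hf; eapply is_derive_eq.
  - apply (is_derive_comp cosh f x (sinh (f x)) l); [| exact hf].
    apply is_derive_Reals, derivable_pt_lim_cosh.
  - apply Rmult_comm.
Qed.

Lemma is_derive_exp_comp (f : R -> R) (x l : R) :
  is_derive f x l -> is_derive (fun y => exp (f y)) x (exp (f x) * l).
Proof.
  intros hf; eapply is_derive_eq.
  - apply (is_derive_comp exp f x (exp (f x)) l); [apply is_derive_exp | exact hf].
  - apply Rmult_comm.
Qed.

Lemma cosh2_sinh2 x : cosh x * cosh x = 1 + sinh x * sinh x.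
Proof.
  unfold cosh, sinh.
  assert (h : exp x * exp (- x) = 1) by (rewrite <- exp_plus, Rplus_opp_r, exp_0; reflexivity).
  nra.
Qed.

Lemma is_derive_H L theta s d2 : is_derive theta s (Derive theta s) ->
  is_derive (Derive theta) s d2 ->
  is_derive (H L theta) s (- d2 / 2 - cosh (theta s) * Derive theta s / L).
Proof.
  intros h1 h2; unfold H.
  apply (is_derive_ext (fun s => (- / 2) * Derive theta s - / L * sinh (theta s))).
  - intros t; unfold Rdiv; Rring.
  - eapply is_derive_eq.
    + apply is_derive_Rminus; apply is_derive_Rmult;
        [apply is_derive_cst | exact h2 | apply is_derive_cst | apply is_derive_sinh_comp, h1].
    + unfold Rdiv; ring.
Qed.

(** Existence: the quadratic system started at the given data, with
    [w(0) = H'(0) / k1(0)]. *)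
Lemma ivp_exists L theta0 a0 b0 : 0 < L -> k1_init L theta0 a0 <> 0 ->
  exists (delta : R) (theta : R -> R), 0 < delta /\ ivp_solution L theta0 a0 b0 delta theta.
Proof.
  intros hL hk0.
  set (c := fun i : nat => match i with
    | 0%nat => 1 | 1%nat => theta0 | 2%nat => a0
    | 3%nat => H'_init L theta0 a0 b0 / k1_init L theta0 a0
    | 4%nat => sinh theta0 | 5%nat => cosh theta0 | _ => 0 end).
  destruct (qsystem_exists (profile_system L) 9 (profile_norm L) c 0 (profile_qsystem L))
    as (a & r & hr & _ & ha0 & hsol).
  { exists (sum_f_R0 (fun i => Rabs (c i)) 5); intros i.
    destruct (Nat.le_gt_cases i 5) as [hi | hi].
    - apply (sum_f_R0_term_le (fun i => Rabs (c i))); [intros; apply Rabs_pos | exact hi].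
    - do 6 (destruct i as [| i]; [lia |]); simpl c; rewrite Rabs_R0.
      apply cond_pos_sum; intros; apply Rabs_pos. }
  set (y := fun i s => PSeries (a i) (s - 0)) in hsol.
  assert (hy0 : forall i, y i 0 = c i)
    by (intros i; unfold y; rewrite Rminus_diag, PSeries_0; apply ha0).
  clearbody y; clear a ha0.
  assert (hd : forall i s, (i <= 9)%nat -> Rabs s < r ->
    is_derive (y i) s (qrhs (profile_system L i) (fun j => y j s))).
  { intros i s hi hs; apply hsol; [rewrite Rminus_0_r |]; assumption. }
  assert (h1 : forall s, Rabs s < r -> y 0%nat s = 1).
  { intros s hs; rewrite (zero_derive_constant (y 0%nat) 0 r).
    - rewrite hy0; reflexivity.
    - intros t ht; apply (hd 0%nat t); [lia | rewrite Rminus_0_r in ht; exact ht].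
    - rewrite Rminus_0_r; exact hs. }
  set (theta := y 1%nat).
  assert (dth : forall s, Rabs s < r -> is_derive theta s (y 2%nat s)).
  { intros s hs; eapply is_derive_eq; [apply (hd 1%nat s); [lia | exact hs] |].
    unfold qrhs; simpl; rewrite (h1 s hs); ring. }
  assert (dS : forall s, Rabs s < r -> is_derive (y 4%nat) s (y 5%nat s * y 2%nat s)).
  { intros s hs; eapply is_derive_eq; [apply (hd 4%nat s); [lia | exact hs] |].
    unfold qrhs; simpl; ring. }
  assert (dC : forall s, Rabs s < r -> is_derive (y 5%nat) s (y 4%nat s * y 2%nat s)).
  { intros s hs; eapply is_derive_eq; [apply (hd 5%nat s); [lia | exact hs] |].
    unfold qrhs; simpl; ring. }
  (* [S + C] and [C - S] solve the linear equations of [exp theta] and [exp (- theta)]. *)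
  assert (hexp : forall s, Rabs s < r ->
    y 5%nat s + y 4%nat s = exp (theta s) /\ y 5%nat s - y 4%nat s = exp (- theta s)).
  { intros s hs; assert (hs0 : Rabs (s - 0) < r) by (rewrite Rminus_0_r; exact hs).
    assert (hinv : forall x, exp x * exp (- x) = 1)
      by (intros x; rewrite <- exp_plus, Rplus_opp_r, exp_0; reflexivity).
    assert (e1 := zero_derive_constant (fun s => (y 5%nat s + y 4%nat s) * exp (- theta s)) 0 r).
    assert (e2 := zero_derive_constant (fun s => (y 5%nat s - y 4%nat s) * exp (theta s)) 0 r).
    cbv beta in e1, e2.
    assert (hth0 : theta 0 = theta0) by apply hy0.
    rewrite hth0, !hy0 in e1, e2; simpl c in e1, e2.
    assert (e1' : (cosh theta0 + sinh theta0) * exp (- theta0) = 1).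
    { rewrite <- (hinv theta0); unfold cosh, sinh; field. }
    assert (e2' : (cosh theta0 - sinh theta0) * exp theta0 = 1).
    { rewrite <- (hinv theta0); unfold cosh, sinh; field. }
    split.
    - apply (Rmult_eq_reg_r (exp (- theta s))); [| generalize (exp_pos (- theta s)); lra].
      rewrite hinv; etransitivity; [apply e1; [| exact hs0] | exact e1'].
      intros t ht; rewrite Rminus_0_r in ht; eapply is_derive_eq.
      + apply is_derive_Rmult; [apply is_derive_Rplus; [apply dC | apply dS]; exact ht |].
        apply is_derive_exp_comp, (is_derive_opp theta), dth, ht.
      + unfold opp; simpl; ring.
    - apply (Rmult_eq_reg_r (exp (theta s))); [| generalize (exp_pos (theta s)); lra].
      rewrite (Rmult_comm (exp (- theta s))), hinv.
      etransitivity; [apply e2; [| exact hs0] | exact e2'].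
      intros t ht; rewrite Rminus_0_r in ht; eapply is_derive_eq.
      + apply is_derive_Rmult; [apply is_derive_Rminus; [apply dC | apply dS]; exact ht |].
        apply is_derive_exp_comp, dth, ht.
      + unfold theta; cbv beta; ring. }
  assert (hS : forall s, Rabs s < r -> sinh (theta s) = y 4%nat s).
  { intros s hs; destruct (hexp s hs) as [e1 e2]; unfold sinh; lra. }
  assert (hC : forall s, Rabs s < r -> cosh (theta s) = y 5%nat s).
  { intros s hs; destruct (hexp s hs) as [e1 e2]; unfold cosh; lra. }
  assert (hp : forall s, Rabs s < r -> Derive theta s = y 2%nat s)
    by (intros s hs; apply is_derive_unique, dth, hs).
  set (dp := fun s => - 2 * (y 3%nat s * (y 2%nat s + y 4%nat s / L)) - 2 * (y 2%nat s * y 5%nat s) / L).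
  assert (dpth : forall s, Rabs s < r -> is_derive (Derive theta) s (dp s)).
  { intros s hs; apply (is_derive_ext_loc (y 2%nat)).
    - generalize (locally_Rabs_lt s r hs); apply filter_imp; intros t ht; symmetry; apply hp, ht.
    - eapply is_derive_eq; [apply (hd 2%nat s); [lia | exact hs] |].
      unfold qrhs, dp; simpl; field; lra. }
  assert (hk1 : forall s, Rabs s < r -> k1 L theta s = y 2%nat s + y 4%nat s / L)
    by (intros s hs; unfold k1; rewrite hp, hS by exact hs; reflexivity).
  assert (h0r : Rabs 0 < r) by (rewrite Rabs_R0; exact hr).
  assert (hk00 : y 2%nat 0 + y 4%nat 0 / L <> 0) by (rewrite !hy0; exact hk0).
  assert (hloc : locally 0 (fun s => y 2%nat s + y 4%nat s / L <> 0)).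
  { assert (hc : continuous (fun s => y 2%nat s + y 4%nat s * / L) 0).
    { apply (ex_derive_continuous (fun s => y 2%nat s + y 4%nat s * / L)).
      eexists; apply is_derive_Rplus; [apply (hd 2%nat 0); [lia | exact h0r] |].
      apply is_derive_Rmult; [apply dS, h0r | apply is_derive_cst]. }
    exact (hc _ (open_neq 0 _ hk00)). }
  destruct hloc as (d & hdk).
  exists (Rmin r d), theta; split; [apply Rmin_pos; [exact hr | apply cond_pos] |].
  assert (hrd : forall s, Rabs s < Rmin r d -> Rabs s < r)
    by (intros s hs; eapply Rlt_le_trans; [exact hs | apply Rmin_l]).
  assert (hkn : forall s, Rabs s < Rmin r d -> y 2%nat s + y 4%nat s / L <> 0).
  { intros s hs; apply hdk; unfold ball; simpl; unfold AbsRing_ball, abs, minus, plus, opp; simpl.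
    rewrite Ropp_0, Rplus_0_r; eapply Rlt_le_trans; [exact hs | apply Rmin_r]. }
  assert (hH : forall s, Rabs s < r ->
    Derive (H L theta) s = y 3%nat s * (y 2%nat s + y 4%nat s / L)).
  { intros s hs; apply is_derive_unique; eapply is_derive_eq.
    - apply is_derive_H; [rewrite hp by exact hs; apply dth, hs | apply dpth, hs].
    - rewrite hC, hp by exact hs; unfold dp; field; lra. }
  assert (hw : forall s, Rabs s < Rmin r d -> H'_over_k1 L theta s = y 3%nat s).
  { intros s hs; unfold H'_over_k1; rewrite hk1, hH by (apply hrd, hs); field.
    split; [lra |]. intros e; apply (hkn s hs).
    apply (Rmult_eq_reg_r L); [| lra]. rewrite Rmult_plus_distr_r, Rmult_0_l, <- e; field; lra. }
  split; [| split; [| split; [| split]]].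
  - intros s hs; apply (qsolution_analytic_on _ 9 _ 0 r y (profile_qsystem L) hsol);
      [rewrite Rminus_0_r; apply hrd, hs | lia].
  - intros s hs; split; [rewrite hk1 by (apply hrd, hs); apply hkn, hs |].
    rewrite (is_derive_unique (H'_over_k1 L theta) s
      (qrhs (profile_system L 3) (fun j => y j s))).
    + rewrite hw, hk1, hS, hC by (assumption || apply hrd; assumption).
      unfold qrhs; simpl; rewrite (h1 s) by (apply hrd, hs); field; lra.
    + apply (is_derive_ext_loc (y 3%nat)).
      * generalize (locally_Rabs_lt s _ hs); apply filter_imp; intros t ht; symmetry; apply hw, ht.
      * apply hd; [lia | apply hrd, hs].
  - apply hy0.
  - rewrite hp by exact h0r; apply hy0.
  - change (Derive (Derive theta) 0 = b0).
    rewrite (is_derive_unique _ _ _ (dpth 0 h0r)); unfold dp; rewrite !hy0; simpl c.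
    unfold H'_init, k1_init in *; field.
    split; [lra |]. intros e; apply hk0.
    apply (Rmult_eq_reg_r L); [| lra]. rewrite Rmult_plus_distr_r, Rmult_0_l, <- e; field; lra.
Qed.

Definition profile (L rho0 u0 : R) (theta : R -> R) (i : nat) : R -> R :=
  match i with
  | 0%nat => fun _ => 1
  | 1%nat => theta
  | 2%nat => Derive theta
  | 3%nat => H'_over_k1 L theta
  | 4%nat => fun s => sinh (theta s)
  | 5%nat => fun s => cosh (theta s)
  | 6%nat => rho L rho0 theta
  | 7%nat => fun s => / rho L rho0 theta s
  | 8%nat => fun s => RInt (fun x => sinh (theta x) * / rho L rho0 theta x) 0 s
  | 9%nat => u L u0 theta
  | _ => fun _ => 0
  end.

(** Analyticity provides the third derivative of [theta] that [(H'/k1)'] requires. *)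
Lemma ivp_derivatives L theta0 a0 b0 delta theta : 0 < L ->
  ivp_solution L theta0 a0 b0 delta theta -> forall s, Rabs s < delta ->
  is_derive theta s (Derive theta s) /\
  is_derive (Derive theta) s (Derive_n theta 2 s) /\
  is_derive (H L theta) s (- Derive_n theta 2 s / 2 - cosh (theta s) * Derive theta s / L) /\
  is_derive (H'_over_k1 L theta) s (Derive (H'_over_k1 L theta) s).
Proof.
  intros hL (han & hode & _) s hs.
  assert (d1 : forall t, Rabs t < delta -> is_derive theta t (Derive theta t))
    by (intros t ht; apply analytic_at_derive, han, ht).
  assert (d2 : forall t, Rabs t < delta -> is_derive (Derive theta) t (Derive_n theta 2 t))
    by (intros t ht; apply Derive_correct, (analytic_at_ex_derive_n theta t 2), han, ht).
  assert (d3 : is_derive (Derive_n theta 2) s (Derive_n theta 3 s))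
    by (apply Derive_correct, (analytic_at_ex_derive_n theta s 3), han, hs).
  split; [auto |]; split; [auto |]; split; [apply is_derive_H; auto |].
  apply Derive_correct; unfold H'_over_k1.
  apply (ex_derive_div (Derive (H L theta)) (k1 L theta)).
  - apply (ex_derive_ext_loc (fun t => (- / 2) * Derive_n theta 2 t
      - / L * (cosh (theta t) * Derive theta t))).
    + generalize (locally_Rabs_lt s _ hs); apply filter_imp; intros t ht.
      symmetry; apply is_derive_unique; eapply is_derive_eq; [apply is_derive_H; auto |].
      unfold Rdiv; ring.
    + eexists; apply is_derive_Rminus; apply is_derive_Rmult;
        [apply is_derive_cst | exact d3 | apply is_derive_cst |].
      apply is_derive_Rmult; [apply is_derive_cosh_comp, d1, hs | apply d2, hs].
  - unfold k1; apply (ex_derive_ext (fun t => Derive theta t + / L * sinh (theta t))).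
    + intros t; unfold Rdiv; f_equal; apply Rmult_comm.
    + eexists; apply is_derive_Rplus; [apply d2, hs |].
      apply is_derive_Rmult; [apply is_derive_cst | apply is_derive_sinh_comp, d1, hs].
  - apply (hode s hs).
Qed.

Lemma is_derive_primitive (f : R -> R) (delta s : R) :
  (forall t, Rabs t < delta -> continuous f t) -> Rabs s < delta ->
  is_derive (fun t => RInt f 0 t) s (f s).
Proof.
  intros hf hs; apply (is_derive_RInt f (fun t => RInt f 0 t) 0 s); [| apply hf, hs].
  generalize (locally_Rabs_lt s _ hs); apply filter_imp; intros t ht.
  apply (RInt_correct f), (ex_RInt_continuous f); intros x hx; apply hf.
  eapply Rle_lt_trans; [| exact ht].
  unfold Rmin, Rmax in hx; destruct (Rle_dec 0 t).
  - rewrite !Rabs_pos_eq; lra.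
  - rewrite !Rabs_left1; lra.
Qed.

Lemma rho_pos L rho0 theta s : 0 < rho0 -> 0 < rho L rho0 theta s.
Proof. intros h; apply Rmult_lt_0_compat; [exact h | apply exp_pos]. Qed.

Lemma is_derive_continuous (f : R -> R) (x l : R) : is_derive f x l -> continuous f x.
Proof. intros h; apply (ex_derive_continuous f); exists l; exact h. Qed.

(** The equation [H' = w k1] is solved for [theta''], and the third-order equation gives [w']. *)
Lemma profile_solution L theta0 a0 b0 rho0 u0 delta theta : 0 < L -> 0 < rho0 ->
  ivp_solution L theta0 a0 b0 delta theta ->
  qsolution (profile_system L) 9 0 delta (profile L rho0 u0 theta).
Proof.
  intros hL hr hsol s hs i hi; rewrite Rminus_0_r in hs.
  assert (hd := ivp_derivatives L theta0 a0 b0 delta theta hL hsol).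
  destruct hsol as (han & hode & _).
  destruct (hode s hs) as [hk he].
  destruct (hd s hs) as (d1 & d2 & d3 & d4).
  assert (hrho : forall t, Rabs t < delta ->
    is_derive (rho L rho0 theta) t (/ L * (cosh (theta t) * rho L rho0 theta t))).
  { intros t ht; unfold rho; eapply is_derive_eq.
    - apply is_derive_Rmult; [apply is_derive_cst |].
      apply is_derive_exp_comp, is_derive_Rmult; [apply is_derive_cst |].
      apply (is_derive_primitive _ delta); [| exact ht].
      intros x hx; exact (is_derive_continuous _ _ _ (is_derive_cosh_comp _ _ _ (proj1 (hd x hx)))).
    - cbv beta; unfold Rdiv; ring. }
  assert (hv : forall t, Rabs t < delta -> is_derive (fun s => / rho L rho0 theta s) t
                 (- (/ L * (cosh (theta t) * / rho L rho0 theta t)))).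
  { intros t ht; assert (hpos := rho_pos L rho0 theta t hr); eapply is_derive_eq.
    - apply (is_derive_inv (rho L rho0 theta)); [apply hrho, ht | lra].
    - field; lra. }
  assert (hp2 : Derive_n theta 2 s = - 2 * (H'_over_k1 L theta s * k1 L theta s)
            - 2 * (cosh (theta s) * Derive theta s) / L).
  { unfold H'_over_k1 at 1; rewrite (is_derive_unique _ _ _ d3); field; split; [lra | exact hk]. }
  destruct i as [| [| [| [| [| [| [| [| [| [| i]]]]]]]]]]; [.. | lia]; unfold qrhs; simpl.
  - apply is_derive_cst.
  - eapply is_derive_eq; [exact d1 | ring].
  - eapply is_derive_eq; [exact d2 | rewrite hp2; unfold k1; field; lra].
  - eapply is_derive_eq; [exact d4 |].
    transitivity (- (H'_over_k1 L theta s ^ 2 + cosh (theta s) / L * H'_over_k1 L theta s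
       + k1 L theta s ^ 2 + sinh (theta s) ^ 2 / L ^ 2 - 2 / L ^ 2)); [lra |].
    unfold k1; field; lra.
  - eapply is_derive_eq; [apply is_derive_sinh_comp, d1 | ring].
  - eapply is_derive_eq; [apply is_derive_cosh_comp, d1 | ring].
  - eapply is_derive_eq; [apply hrho, hs | ring].
  - eapply is_derive_eq; [apply hv, hs | ring].
  - eapply is_derive_eq; [apply (is_derive_primitive _ delta); [| exact hs] | cbv beta; ring].
    intros x hx; apply (continuous_mult (fun x => sinh (theta x)) (fun x => / rho L rho0 theta x)).
    + exact (is_derive_continuous _ _ _ (is_derive_sinh_comp _ _ _ (proj1 (hd x hx)))).
    + exact (is_derive_continuous _ _ _ (hv x hx)).
  - eapply is_derive_eq.
    + unfold u; apply is_derive_Rmult; [apply is_derive_cst |].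
      apply is_derive_exp_comp, (is_derive_primitive _ delta); [| exact hs].
      intros x hx; exact (is_derive_continuous _ _ _ (proj2 (proj2 (proj2 (hd x hx))))).
    + unfold u; cbv beta; ring.
Qed.

Lemma H'_over_k1_0 L theta0 a0 b0 delta theta : 0 < L -> 0 < delta ->
  ivp_solution L theta0 a0 b0 delta theta ->
  H'_over_k1 L theta 0 = H'_init L theta0 a0 b0 / k1_init L theta0 a0.
Proof.
  intros hL hd hsol.
  assert (h0 : Rabs 0 < delta) by (rewrite Rabs_R0; exact hd).
  destruct (ivp_derivatives _ _ _ _ _ _ hL hsol 0 h0) as (_ & _ & d3 & _).
  destruct hsol as (_ & _ & e0 & e1 & e2).
  unfold H'_over_k1, k1, H'_init, k1_init; rewrite (is_derive_unique _ _ _ d3), e2, e1, e0.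
  f_equal; unfold Rdiv; ring.
Qed.

Lemma profile_0 L theta0 a0 b0 rho0 u0 delta theta : 0 < L -> 0 < delta ->
  ivp_solution L theta0 a0 b0 delta theta -> forall i,
  profile L rho0 u0 theta i 0 = match i with
    | 0%nat => 1 | 1%nat => theta0 | 2%nat => a0
    | 3%nat => H'_init L theta0 a0 b0 / k1_init L theta0 a0
    | 4%nat => sinh theta0 | 5%nat => cosh theta0 | 6%nat => rho0 | 7%nat => / rho0
    | 8%nat => 0 | 9%nat => u0 | _ => 0 end.
Proof.
  intros hL hd hsol i.
  assert (hw := H'_over_k1_0 L theta0 a0 b0 delta theta hL hd hsol).
  destruct hsol as (_ & _ & e0 & e1 & e2).
  assert (hr : rho L rho0 theta 0 = rho0)
    by (unfold rho; rewrite RInt_point; change (@zero R_NormedModule) with 0;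
        rewrite Rmult_0_r, exp_0; ring).
  destruct i as [| [| [| [| [| [| [| [| [| [| i]]]]]]]]]]; simpl; try reflexivity; try assumption.
  - rewrite e0; reflexivity.
  - rewrite e0; reflexivity.
  - rewrite hr; reflexivity.
  - rewrite RInt_point; reflexivity.
  - unfold u; rewrite RInt_point.
    transitivity (u0 * 1); [exact (f_equal (Rmult u0) exp_0) | ring].
Qed.

Lemma profile_unique L theta0 a0 b0 rho0 u0 delta1 delta2 theta1 theta2 :
  0 < L -> 0 < rho0 ->
  ivp_solution L theta0 a0 b0 delta1 theta1 -> ivp_solution L theta0 a0 b0 delta2 theta2 ->
  forall s, Rabs s < Rmin delta1 delta2 -> forall i, (i <= 9)%nat ->
  profile L rho0 u0 theta1 i s = profile L rho0 u0 theta2 i s.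
Proof.
  intros hL hr h1 h2 s hs i hi.
  assert (hm : 0 < Rmin delta1 delta2) by (eapply Rle_lt_trans; [apply Rabs_pos | exact hs]).
  assert (hd1 : 0 < delta1) by (eapply Rlt_le_trans; [exact hm | apply Rmin_l]).
  assert (hd2 : 0 < delta2) by (eapply Rlt_le_trans; [exact hm | apply Rmin_r]).
  apply (qsolution_unique (profile_system L) 9 (profile_norm L) 0 (Rmin delta1 delta2)).
  - apply profile_qsystem.
  - intros t ht; apply (profile_solution L theta0 a0 b0 rho0 u0 delta1 theta1 hL hr h1).
    eapply Rlt_le_trans; [exact ht | apply Rmin_l].
  - intros t ht; apply (profile_solution L theta0 a0 b0 rho0 u0 delta2 theta2 hL hr h2).
    eapply Rlt_le_trans; [exact ht | apply Rmin_r].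
  - intros j _.
    rewrite (profile_0 L theta0 a0 b0 rho0 u0 delta1 theta1 hL hd1 h1 j).
    rewrite (profile_0 L theta0 a0 b0 rho0 u0 delta2 theta2 hL hd2 h2 j); reflexivity.
  - rewrite Rminus_0_r; exact hs.
  - exact hi.
Qed.

Lemma ivp_unique L theta0 a0 b0 rho0 u0 delta1 delta2 theta1 theta2 :
  0 < L -> 0 < rho0 ->
  ivp_solution L theta0 a0 b0 delta1 theta1 -> ivp_solution L theta0 a0 b0 delta2 theta2 ->
  forall s, Rabs s < Rmin delta1 delta2 ->
    theta1 s = theta2 s /\ rho L rho0 theta1 s = rho L rho0 theta2 s /\
    u L u0 theta1 s = u L u0 theta2 s /\ lambda2 L u0 theta1 s = lambda2 L u0 theta2 s.
Proof.
  intros hL hr h1 h2 s hs.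
  assert (h := profile_unique L theta0 a0 b0 rho0 u0 delta1 delta2 theta1 theta2 hL hr h1 h2 s hs).
  assert (e1 : theta1 s = theta2 s) by (apply (h 1%nat); lia).
  assert (e2 : Derive theta1 s = Derive theta2 s) by (apply (h 2%nat); lia).
  assert (e6 : rho L rho0 theta1 s = rho L rho0 theta2 s) by (apply (h 6%nat); lia).
  assert (e9 : u L u0 theta1 s = u L u0 theta2 s) by (apply (h 9%nat); lia).
  repeat split; try assumption.
  unfold lambda2, H; rewrite e1, e2, e9; reflexivity.
Qed.

(** * The parabolic rotational surface of a profile *)

(** In the basis [m = (1,0,1,0)], [e = (0,0,0,1)], [n = (1,0,-1,0)/2], [f = (0,1,0,0)], whose only
    nonzero products are [<m,n> = -1], [<e,e> = 1], [<f,f> = -1], this is the image of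
    [al m + be f + ga n] under [exp (t B)], where [B m = e], [B e = n], [B n = B f = 0]. *)
Definition orbit (al be ga t : R) : R22 :=
  (al + / 2 * (ga + al * t ^ 2 / 2), be, al - / 2 * (ga + al * t ^ 2 / 2), al * t).

Definition orbit_t (al t : R) : R22 := (/ 2 * (al * t), 0, - / 2 * (al * t), al).

Lemma ip_orbit al be ga al' be' ga' t :
  ip (orbit al be ga t) (orbit al' be' ga' t) = - al * ga' - al' * ga - be * be'.
Proof. unfold ip, orbit; autorewrite with r22; field. Qed.

Lemma ip_orbit_t_orbit al al' be' ga' t : ip (orbit_t al t) (orbit al' be' ga' t) = 0.
Proof. unfold ip, orbit, orbit_t; autorewrite with r22; field. Qed.

Lemma ip_orbit_t al al' t : ip (orbit_t al t) (orbit_t al' t) = al * al'.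
Proof. unfold ip, orbit_t; autorewrite with r22; field. Qed.

Lemma orbit_eq al be ga al' be' ga' t :
  al = al' -> be = be' -> ga = ga' -> orbit al be ga t = orbit al' be' ga' t.
Proof. intros; subst; reflexivity. Qed.

Lemma is_derive_sq (x : R) : is_derive (fun t : R => t ^ 2) x (2 * x).
Proof. auto_derive; [exact I | ring]. Qed.

Ltac derive_step :=
  lazymatch goal with
  | |- is_derive (fun x => @?f x + @?g x) _ _ => apply (is_derive_Rplus f g)
  | |- is_derive (fun x => @?f x - @?g x) _ _ => apply (is_derive_Rminus f g)
  | |- is_derive (fun x => @?f x * @?g x) _ _ => apply (is_derive_Rmult f g)
  | |- is_derive (fun _ => ?c) _ _ => apply (is_derive_cst c)
  | |- is_derive (fun x => x) _ _ => apply is_derive_idR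
  | |- is_derive (fun x => x ^ 2) _ _ => apply is_derive_sq
  | |- is_derive (fun x => / _) _ _ => eassumption
  | |- is_derive (fun x => ?f x) _ _ => match goal with h : is_derive f _ _ |- _ => exact h end
  | |- is_derive ?f _ _ => match goal with h : is_derive f _ _ |- _ => exact h end
  end.

Ltac derive_ring := cbn [fst snd]; (eapply is_derive_eq; [ repeat derive_step | cbv beta ]).

Lemma is_vpd_orbit_s (al be ga : R -> R) (p : R * R) (dal dbe dga : R) :
  is_derive al (fst p) dal -> is_derive be (fst p) dbe -> is_derive ga (fst p) dga ->
  is_vpd i1 (fun q => orbit (al (fst q)) (be (fst q)) (ga (fst q)) (snd q)) p
    (orbit dal dbe dga (snd p)).
Proof.
  intros h1 h2 h3; unfold orbit; split4; unfold line, coord, c0, c1, c2, c3; unfold Rdiv.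
  - derive_ring; field.
  - exact h2.
  - derive_ring; field.
  - derive_ring; field.
Qed.

Lemma is_vpd_orbit_t (al be ga : R -> R) (p : R * R) :
  is_vpd i2 (fun q => orbit (al (fst q)) (be (fst q)) (ga (fst q)) (snd q)) p
    (orbit_t (al (fst p)) (snd p)).
Proof.
  unfold orbit, orbit_t; split4; unfold line, coord, c0, c1, c2, c3; unfold Rdiv;
    derive_ring; field.
Qed.

Lemma is_vpd_orbit_t_s (al : R -> R) (p : R * R) (dal : R) : is_derive al (fst p) dal ->
  is_vpd i1 (fun q => orbit_t (al (fst q)) (snd q)) p (orbit_t dal (snd p)).
Proof.
  intros h; unfold orbit_t; split4; unfold line, coord, c0, c1, c2, c3; cbn [fst snd].
  - derive_ring; field.
  - apply is_derive_cst.
  - derive_ring; field.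
  - exact h.
Qed.

Lemma is_vpd_orbit_t_t (al : R -> R) (p : R * R) :
  is_vpd i2 (fun q => orbit_t (al (fst q)) (snd q)) p (orbit 0 0 (al (fst p)) (snd p)).
Proof.
  unfold orbit_t, orbit; split4; unfold line, coord, c0, c1, c2, c3; cbn [fst snd].
  - derive_ring; field.
  - apply is_derive_cst.
  - derive_ring; field.
  - derive_ring; field.
Qed.

Lemma analytic_map_orbit (D : R * R -> Prop) (al be ga : R -> R) :
  (forall p, D p -> analytic_at al (fst p) /\ analytic_at be (fst p) /\ analytic_at ga (fst p)) ->
  analytic_map D (fun q => orbit (al (fst q)) (be (fst q)) (ga (fst q)) (snd q)).
Proof.
  intros h p hp; destruct (h p hp) as (h1 & h2 & h3).
  assert (h0 := analytic_at_const 0 (fst p)).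
  split; [| split; [| split]].
  - apply (analytic2_at_ext (fun q => (al (fst q) + / 2 * ga (fst q)) + 0 * snd q
      + / 4 * al (fst q) * snd q ^ 2)).
    + intros q; unfold orbit; autorewrite with r22; field.
    + apply (analytic2_at_quadratic (fun s => al s + / 2 * ga s) (fun _ => 0) (fun s => / 4 * al s));
        auto using analytic_at_scal, analytic_at_plus.
  - apply (analytic2_at_ext (fun q => be (fst q) + 0 * snd q + 0 * snd q ^ 2)).
    + intros q; unfold orbit; autorewrite with r22; field.
    + apply (analytic2_at_quadratic be (fun _ => 0) (fun _ => 0)); auto.
  - apply (analytic2_at_ext (fun q => (al (fst q) - / 2 * ga (fst q)) + 0 * snd q
      + - / 4 * al (fst q) * snd q ^ 2)).
    + intros q; unfold orbit; autorewrite with r22; field.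
    + apply (analytic2_at_quadratic (fun s => al s - / 2 * ga s) (fun _ => 0) (fun s => - / 4 * al s));
        auto using analytic_at_scal, analytic_at_minus.
  - apply (analytic2_at_ext (fun q => 0 + al (fst q) * snd q + 0 * snd q ^ 2)).
    + intros q; unfold orbit; autorewrite with r22; field.
    + apply (analytic2_at_quadratic (fun _ => 0) al (fun _ => 0)); auto.
Qed.

Definition parabolic_B (x : R22) : R22 :=
  (/ 2 * c3 x, 0, - / 2 * c3 x, / 2 * (c0 x + c2 x)).

Lemma parabolic_B_orbit al be ga t : parabolic_B (orbit al be ga t) = orbit_t al t.
Proof. unfold parabolic_B, orbit, orbit_t; apply R22_ext; autorewrite with r22; field. Qed.

Lemma is_linear_c0 : is_linear c0.
Proof.
  apply (is_linear_comp (fun x : R22 => fst (fst x)) fst); [| apply is_linear_fst].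
  apply (is_linear_comp (fun x : R22 => fst x) fst); apply is_linear_fst.
Qed.
Lemma is_linear_c1 : is_linear c1.
Proof.
  apply (is_linear_comp (fun x : R22 => fst (fst x)) snd); [| apply is_linear_snd].
  apply (is_linear_comp (fun x : R22 => fst x) fst); apply is_linear_fst.
Qed.
Lemma is_linear_c2 : is_linear c2.
Proof.
  apply (is_linear_comp (fun x : R22 => fst x) snd); [apply is_linear_fst | apply is_linear_snd].
Qed.
Lemma is_linear_c3 : is_linear c3.
Proof. apply is_linear_snd. Qed.

Lemma is_linear_add {V W : NormedModule R_AbsRing} (f g : V -> W) :
  is_linear f -> is_linear g -> is_linear (fun x => plus (f x) (g x)).
Proof.
  intros hf hg.
  apply (is_linear_comp (fun x => (f x, g x)) (fun y : W * W => plus (fst y) (snd y))).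
  - apply is_linear_prod; assumption.
  - apply is_linear_plus.
Qed.

Lemma is_linear_smul {V W : NormedModule R_AbsRing} (a : R) (f : V -> W) :
  is_linear f -> is_linear (fun x => scal a (f x)).
Proof.
  intros hf; apply (is_linear_comp f (fun y : W => scal a y)); [exact hf |].
  apply (is_linear_scal_r (K := R_AbsRing) a), Rmult_comm.
Qed.

Lemma is_linear_vec (f : R22 -> R) (v : R22) : is_linear f -> is_linear (fun x => scal (f x) v).
Proof.
  intros hf; apply (is_linear_comp f (fun y : R => scal y v)); [exact hf |].
  apply (is_linear_scal_l (K := R_AbsRing) v).
Qed.

Lemma is_linear_ip_l (v : R22) : is_linear (fun x => ip x v).
Proof.
  apply (is_linear_ext (fun x => plus (plus (plus (scal (- c0 v) (c0 x)) (scal (- c1 v) (c1 x)))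
    (scal (c2 v) (c2 x))) (scal (c3 v) (c3 x)))).
  - intros x; unfold ip.
    change (((- c0 v * c0 x + - c1 v * c1 x) + c2 v * c2 x) + c3 v * c3 x =
      - c0 x * c0 v - c1 x * c1 v + c2 x * c2 v + c3 x * c3 v); ring.
  - exact (is_linear_add (W := R_NormedModule) _ _
      (is_linear_add (W := R_NormedModule) _ _ (is_linear_add (W := R_NormedModule) _ _
        (is_linear_smul (W := R_NormedModule) (- c0 v) c0 is_linear_c0)
        (is_linear_smul (W := R_NormedModule) (- c1 v) c1 is_linear_c1))
        (is_linear_smul (W := R_NormedModule) (c2 v) c2 is_linear_c2))
      (is_linear_smul (W := R_NormedModule) (c3 v) c3 is_linear_c3)).
Qed.

Lemma parabolic_B_linear : is_linear parabolic_B.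
Proof.
  apply (is_linear_ext (fun x => plus (scal (c3 x) (/ 2, 0, - / 2, 0))
    (plus (scal (c0 x) (0, 0, 0, / 2)) (scal (c2 x) (0, 0, 0, / 2))))).
  - intros x; unfold parabolic_B; apply R22_ext; autorewrite with r22; ring.
  - exact (is_linear_add _ _ (is_linear_vec c3 _ is_linear_c3)
      (is_linear_add _ _ (is_linear_vec c0 _ is_linear_c0) (is_linear_vec c2 _ is_linear_c2))).
Qed.

Lemma parabolic_B_rotational (D : R * R -> Prop) (X : R * R -> R22) :
  (forall p, D p -> vpd i2 X p = parabolic_B (X p)) -> parabolic_rotational D X.
Proof.
  intros hX; exists parabolic_B; split; [split |]; [| | split; [| split; [| split]]].
  - apply parabolic_B_linear.
  - intros x y; unfold ip, parabolic_B; autorewrite with r22; field.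
  - exists (1, 0, 1, 0), (0, 0, 0, 1); split.
    + intros a b h; split.
      * assert (h3 : a * (/ 2 * (1 + 1)) + b * (/ 2 * (0 + 0)) = 0) by exact (f_equal c3 h); lra.
      * assert (h0 : a * (/ 2 * 0) + b * (/ 2 * 1) = 0) by exact (f_equal c0 h); lra.
    + intros z; exists (/ 2 * (c0 z + c2 z)), (c3 z); unfold parabolic_B.
      apply R22_ext; autorewrite with r22; field.
  - intros x; unfold parabolic_B; apply R22_ext; autorewrite with r22; field.
  - exists (1, 0, 1, 0); intros h.
    assert (h0 : / 2 * (/ 2 * (1 + 1)) = 0) by exact (f_equal c0 h); lra.
  - exact hX.
Qed.

(** With [V = m + z f - z^2/2 n], which is null, and [T = f - z n = dV/dz], the immersion is
    [exp (t B) (r V + L^2/(2 r) n)].  With [r'/r = C/L] one finds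
    [<X_s, X_s> = C^2 - (r z')^2], so that [z' = S/r] makes [s] an arc length;
    the normal is [- (C T + (S r/L) V - S L/(2 r) n)] at [t = 0]. *)
Definition imm (L : R) (r z : R -> R) (q : R * R) : R22 :=
  orbit (r (fst q)) (r (fst q) * z (fst q))
    (L ^ 2 * / 2 * / r (fst q) - / 2 * (r (fst q) * (z (fst q) * z (fst q)))) (snd q).

Definition imm_s (L : R) (S C r z : R -> R) (q : R * R) : R22 :=
  orbit (/ L * (C (fst q) * r (fst q)))
    (/ L * (C (fst q) * (r (fst q) * z (fst q))) + S (fst q))
    (- L * / 2 * (C (fst q) * / r (fst q))
      - (/ L * / 2 * (C (fst q) * (r (fst q) * (z (fst q) * z (fst q)))) + S (fst q) * z (fst q)))
    (snd q).

Definition imm_t (r : R -> R) (q : R * R) : R22 := orbit_t (r (fst q)) (snd q).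

Definition imm_normal (L : R) (S C r z : R -> R) (q : R * R) : R22 :=
  orbit (- / L * (S (fst q) * r (fst q)))
    (- / L * (S (fst q) * (r (fst q) * z (fst q))) - C (fst q))
    (C (fst q) * z (fst q) + (/ L * / 2 * (S (fst q) * (r (fst q) * (z (fst q) * z (fst q))))
      + L * / 2 * (S (fst q) * / r (fst q))))
    (snd q).

(** A rational parametrization of [C^2 - S^2 = 1]: identities modulo this relation become
    identities of rational functions. *)
Lemma hyperbolic_parameter (S C : R) : C * C = 1 + S * S -> 0 < C ->
  exists x, 0 < x /\ S = (x - / x) / 2 /\ C = (x + / x) / 2.
Proof.
  intros h hC; exists (S + C).
  assert (hx : 0 < S + C).
  { destruct (Rlt_or_le 0 (S + C)) as [| hn]; [assumption |].
    assert (0 <= (- (S + C)) * (C - S)) by (apply Rmult_le_pos; lra); lra. }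
  assert (hi : / (S + C) = C - S).
  { apply (Rmult_eq_reg_l (S + C)); [| lra]; rewrite Rinv_r by lra; lra. }
  rewrite hi; lra.
Qed.

Lemma imm_surface (L delta : R) (J : R -> Prop) (S C p r z : R -> R) :
  0 < L ->
  (forall s, Rabs s < delta -> C s * C s = 1 + S s * S s /\ 0 < C s /\ 0 < r s /\
     is_derive S s (C s * p s) /\ is_derive C s (S s * p s) /\
     is_derive r s (C s / L * r s) /\ is_derive z s (S s * / r s)) ->
  surface L (strip delta J) (imm L r z) (imm_s L S C r z) (imm_t r) (imm_normal L S C r z) r
    (fun s => C s / L) (fun s => p s + S s / L) (fun s => S s / L).
Proof.
  intros hL h.
  assert (hv : forall s, Rabs s < delta -> is_derive (fun s => / r s) s (- (C s / L * / r s))).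
  { intros s hs; destruct (h s hs) as (_ & _ & hr & _ & _ & hdr & _).
    eapply is_derive_eq; [apply (is_derive_inv r _ _ hdr); lra | field; lra]. }
  constructor; intros q [hq _];
    destruct (h _ hq) as (hCS & hC & hr & dS & dC & dr & dz);
    assert (dv := hv _ hq); cbv beta;
    destruct (hyperbolic_parameter _ _ hCS hC) as (x & hx & eS & eC).
  1-10: unfold imm, imm_s, imm_t, imm_normal;
    rewrite ?(ip_comm (orbit _ _ _ _) (orbit_t _ _)), ?ip_orbit, ?ip_orbit_t_orbit, ?ip_orbit_t;
    rewrite ?eS, ?eC; try reflexivity; field; lra.
  - unfold imm, imm_s; eapply is_vpd_eq.
    + apply (is_vpd_orbit_s r (fun s => r s * z s)
        (fun s => L ^ 2 * / 2 * / r s - / 2 * (r s * (z s * z s)))); derive_ring; reflexivity.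
    + apply orbit_eq; field; lra.
  - apply (is_vpd_orbit_t r (fun s => r s * z s)
        (fun s => L ^ 2 * / 2 * / r s - / 2 * (r s * (z s * z s)))).
  - unfold imm, imm_s, imm_normal; eapply is_vpd_eq.
    + apply (is_vpd_orbit_s (fun s => / L * (C s * r s)) (fun s => / L * (C s * (r s * z s)) + S s)
        (fun s => - L * / 2 * (C s * / r s)
          - (/ L * / 2 * (C s * (r s * (z s * z s))) + S s * z s))); derive_ring; reflexivity.
    + unfold orbit; apply R22_ext; autorewrite with r22; rewrite eS, eC; field; lra.
  - unfold imm_s, imm_t; eapply is_vpd_eq.
    + apply (is_vpd_orbit_t (fun s => / L * (C s * r s)) (fun s => / L * (C s * (r s * z s)) + S s)
        (fun s => - L * / 2 * (C s * / r s)
          - (/ L * / 2 * (C s * (r s * (z s * z s))) + S s * z s))).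
    + unfold orbit_t; apply R22_ext; autorewrite with r22; field; lra.
  - unfold imm_t; eapply is_vpd_eq.
    + apply (is_vpd_orbit_t_s r); exact dr.
    + unfold orbit_t; apply R22_ext; autorewrite with r22; field; lra.
  - unfold imm_t, imm_s, imm_normal, imm; eapply is_vpd_eq.
    + apply (is_vpd_orbit_t_t r).
    + unfold orbit; apply R22_ext; autorewrite with r22; rewrite eS, eC; field; lra.
  - unfold imm_s, imm_normal; eapply is_vpd_eq.
    + apply (is_vpd_orbit_s (fun s => - / L * (S s * r s)) (fun s => - / L * (S s * (r s * z s)) - C s)
        (fun s => C s * z s + (/ L * / 2 * (S s * (r s * (z s * z s)))
          + L * / 2 * (S s * / r s)))); derive_ring; reflexivity.
    + unfold orbit; apply R22_ext; autorewrite with r22; rewrite eS, eC; field; lra.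
  - unfold imm_t, imm_normal; eapply is_vpd_eq.
    + apply (is_vpd_orbit_t (fun s => - / L * (S s * r s)) (fun s => - / L * (S s * (r s * z s)) - C s)
        (fun s => C s * z s + (/ L * / 2 * (S s * (r s * (z s * z s)))
          + L * / 2 * (S s * / r s)))).
    + unfold orbit_t; apply R22_ext; autorewrite with r22; field; lra.
  - split; assumption.
Qed.

Lemma imm_analytic (L delta : R) (J : R -> Prop) (S C r z : R -> R) :
  (forall s, Rabs s < delta -> analytic_at S s /\ analytic_at C s /\ analytic_at r s /\
     analytic_at (fun s => / r s) s /\ analytic_at z s) ->
  analytic_map (strip delta J) (imm L r z) /\ analytic_map (strip delta J) (imm_normal L S C r z).
Proof.
  intros h; split.
  - apply (analytic_map_orbit _ r (fun s => r s * z s)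
        (fun s => L ^ 2 * / 2 * / r s - / 2 * (r s * (z s * z s)))).
    intros q [hq _]; destruct (h _ hq) as (hS & hC & hr & hv & hz).
    auto 8 using analytic_at_scal, analytic_at_mult, analytic_at_minus.
  - apply (analytic_map_orbit _ (fun s => - / L * (S s * r s))
        (fun s => - / L * (S s * (r s * z s)) - C s)
        (fun s => C s * z s + (/ L * / 2 * (S s * (r s * (z s * z s)))
          + L * / 2 * (S s * / r s)))).
    intros q [hq _]; destruct (h _ hq) as (hS & hC & hr & hv & hz).
    auto 12 using analytic_at_scal, analytic_at_mult, analytic_at_minus, analytic_at_plus.
Qed.

(** * Smooth functions of the profile parameter *)

(** A ring of functions that contains the derivatives of its generators consists of smooth
    functions; this handles [lambda], a square root, without computing iterated derivatives. *)
Inductive generated (G : (R -> R) -> Prop) : (R -> R) -> Prop :=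
  | gen_in f : G f -> generated G f
  | gen_cst c : generated G (fun _ => c)
  | gen_plus f g : generated G f -> generated G g -> generated G (fun s => f s + g s)
  | gen_mult f g : generated G f -> generated G g -> generated G (fun s => f s * g s).

Definition closed_under_derivative (G : (R -> R) -> Prop) (delta : R) : Prop :=
  forall f, G f -> exists f', generated G f' /\
    forall s, Rabs s < delta -> is_derive f s (f' s).

Lemma generated_derive G delta : closed_under_derivative G delta ->
  forall f, generated G f -> exists f', generated G f' /\
    forall s, Rabs s < delta -> is_derive f s (f' s).
Proof.
  intros hG f hf; induction hf as [f hf | c | f g hf (f' & hf' & df) hg (g' & hg' & dg)
                                  | f g hf (f' & hf' & df) hg (g' & hg' & dg)].
  - apply hG, hf.
  - exists (fun _ => 0); split; [apply gen_cst | intros; apply is_derive_cst].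
  - exists (fun s => f' s + g' s); split; [apply gen_plus; assumption |].
    intros s hs; apply is_derive_Rplus; auto.
  - exists (fun s => f' s * g s + f s * g' s); split.
    + apply gen_plus; apply gen_mult; assumption.
    + intros s hs; apply is_derive_Rmult; auto.
Qed.

Lemma filterdiff_fst (f : R -> R) (p : R * R) (l : R) : is_derive f (fst p) l ->
  filterdiff (fun q : R * R => f (fst q)) (locally p) (fun v : R * R => fst v * l).
Proof.
  intros hf.
  apply (filterdiff_comp' (U := prod_NormedModule R_AbsRing R_NormedModule R_NormedModule)
    (V := R_NormedModule) (W := R_NormedModule) (fun q : R * R => fst q) f p
    (fun v => fst v) (fun y => y * l)).
  - apply filterdiff_linear, is_linear_fst.
  - exact hf.
Qed.

Lemma generated_smooth G delta (D : R * R -> Prop) f :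
  closed_under_derivative G delta -> (forall p, D p -> Rabs (fst p) < delta) ->
  generated G f ->
  smooth_on (V := prod_NormedModule R_AbsRing R_NormedModule R_NormedModule)
    (W := R_NormedModule) D (fun p => f (fst p)).
Proof.
  intros hG hD hf n; revert f hf; induction n as [| n IH]; intros f hf;
    destruct (generated_derive G delta hG f hf) as (f' & hf' & df).
  - intros p hp; apply (filterdiff_continuous (fun q : R * R => f (fst q))).
    eexists; apply filterdiff_fst, df, hD, hp.
  - exists (fun p v => fst v * f' (fst p)); split.
    + intros p hp; apply filterdiff_fst, df, hD, hp.
    + intros v; apply (IH (fun s => fst v * f' s)), gen_mult; [apply gen_cst | exact hf'].
Qed.

Lemma generated_qrhs G (y : nat -> R -> R) (l : list monomial) :
  (forall m, List.In m l -> generated G (y (snd (fst m))) /\ generated G (y (snd m))) ->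
  generated G (fun s => qrhs l (fun j => y j s)).
Proof.
  unfold qrhs; induction l as [| m l IH]; simpl; intros h; [apply gen_cst |].
  apply gen_plus; [| apply IH; auto].
  destruct (h m (or_introl eq_refl)) as [h1 h2].
  apply (gen_mult G (fun _ => fst (fst m))); [apply gen_cst | apply gen_mult; assumption].
Qed.

(** * The conformal factor *)

Lemma strip_open delta : open (strip delta (fun _ => True)).
Proof.
  intros p [hp _].
  destruct (locally_Rabs_lt (fst p) delta hp) as (e & he).
  exists e; intros q [hq _]; split; [apply he, hq | exact I].
Qed.

Section ConformalFactor.
Context (L theta0 a0 b0 rho0 u0 delta : R) (theta : R -> R).
Context (hL : 0 < L) (hr : 0 < rho0) (hsol : ivp_solution L theta0 a0 b0 delta theta).
Context (hlam : forall s, Rabs s < delta -> 0 < lambda2 L u0 theta s).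

Lemma profile_derive i s : Rabs s < delta -> (i <= 9)%nat ->
  is_derive (profile L rho0 u0 theta i) s
    (qrhs (profile_system L i) (fun j => profile L rho0 u0 theta j s)).
Proof.
  intros hs hi; apply (profile_solution L theta0 a0 b0 rho0 u0 delta theta hL hr hsol s); auto.
  rewrite Rminus_0_r; exact hs.
Qed.

Lemma is_derive_u s : Rabs s < delta ->
  is_derive (u L u0 theta) s (H'_over_k1 L theta s * u L u0 theta s).
Proof.
  intros hs; eapply is_derive_eq; [apply (profile_derive 9 s hs); lia |].
  unfold qrhs; simpl; ring.
Qed.

Lemma is_derive_H_profile s : Rabs s < delta ->
  is_derive (H L theta) s (H'_over_k1 L theta s * k1 L theta s).
Proof.
  intros hs.
  destruct (ivp_derivatives _ _ _ _ _ _ hL hsol s hs) as (_ & _ & d3 & _).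
  eapply is_derive_eq; [exact d3 |].
  unfold H'_over_k1; rewrite (is_derive_unique _ _ _ d3).
  field; split; [lra | apply (proj1 (proj2 hsol) s hs)].
Qed.

Lemma H_nonzero s : Rabs s < delta -> H L theta s <> 0.
Proof.
  intros hs e; generalize (hlam s hs); unfold lambda2; rewrite e; unfold Rdiv.
  rewrite Rinv_0, Rmult_0_r; lra.
Qed.

Lemma u_nonzero s : Rabs s < delta -> u L u0 theta s <> 0.
Proof.
  intros hs e; generalize (hlam s hs); unfold lambda2; rewrite e; unfold Rdiv.
  rewrite Rmult_0_l; lra.
Qed.

Lemma lambda_sq s : Rabs s < delta -> lambda L u0 theta s ^ 2 = lambda2 L u0 theta s.
Proof. intros hs; unfold lambda; apply pow2_sqrt; left; apply hlam, hs. Qed.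

Lemma lambda_pos s : Rabs s < delta -> 0 < lambda L u0 theta s.
Proof. intros hs; apply sqrt_lt_R0, hlam, hs. Qed.

Lemma is_derive_inv_H s : Rabs s < delta -> is_derive (fun s => / H L theta s) s
  (-1 * ((H'_over_k1 L theta s * k1 L theta s) * (/ H L theta s * / H L theta s))).
Proof.
  intros hs; eapply is_derive_eq.
  - apply (is_derive_inv (H L theta)); [apply is_derive_H_profile, hs | apply H_nonzero, hs].
  - field; apply H_nonzero, hs.
Qed.

Lemma is_derive_lambda2 s : Rabs s < delta -> is_derive (lambda2 L u0 theta) s
  (lambda2 L u0 theta s * (H'_over_k1 L theta s * (1 - k1 L theta s / H L theta s))).
Proof.
  intros hs; unfold lambda2; eapply is_derive_eq.
  - apply is_derive_div; [apply is_derive_u, hs | apply is_derive_H_profile, hs | apply H_nonzero, hs].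
  - field; apply H_nonzero, hs.
Qed.

Lemma is_derive_lambda s : Rabs s < delta -> is_derive (lambda L u0 theta) s
  (/ 2 * (lambda L u0 theta s * (H'_over_k1 L theta s
     * (1 + -1 * (k1 L theta s * / H L theta s))))).
Proof.
  intros hs; unfold lambda at 1; eapply is_derive_eq.
  - apply (is_derive_comp sqrt (lambda2 L u0 theta)).
    + apply is_derive_Reals, derivable_pt_lim_sqrt, hlam, hs.
    + apply is_derive_lambda2, hs.
  - assert (hp := lambda_pos s hs); assert (hq := lambda_sq s hs).
    change (sqrt (lambda2 L u0 theta s)) with (lambda L u0 theta s); rewrite <- hq.
    change (lambda L u0 theta s ^ 2 * (H'_over_k1 L theta s * (1 - k1 L theta s / H L theta s))
      * / (2 * lambda L u0 theta s) =
      / 2 * (lambda L u0 theta s * (H'_over_k1 L theta s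
        * (1 + -1 * (k1 L theta s * / H L theta s))))).
    field; split; [apply H_nonzero, hs | lra].
Qed.

Definition factor_generators (f : R -> R) : Prop :=
  (exists i, (i <= 9)%nat /\ f = profile L rho0 u0 theta i) \/
  f = lambda L u0 theta \/ f = (fun s => / H L theta s).

Lemma profile_generated i : (i <= 9)%nat -> generated factor_generators (profile L rho0 u0 theta i).
Proof. intros hi; apply gen_in; left; exists i; auto. Qed.

Lemma k1_generated : generated factor_generators (k1 L theta).
Proof.
  replace (k1 L theta) with (fun s => Derive theta s + / L * sinh (theta s)).
  - apply gen_plus; [apply (profile_generated 2); lia |].
    apply (gen_mult _ (fun _ => / L)); [apply gen_cst | apply (profile_generated 4); lia].
  - apply functional_extensionality; intros s; unfold k1, Rdiv; ring.
Qed.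

Lemma factor_closed : closed_under_derivative factor_generators delta.
Proof.
  assert (hw : generated factor_generators (H'_over_k1 L theta))
    by (apply (profile_generated 3); lia).
  assert (hl : generated factor_generators (lambda L u0 theta))
    by (apply gen_in; right; left; reflexivity).
  assert (hi : generated factor_generators (fun s => / H L theta s))
    by (apply gen_in; right; right; reflexivity).
  assert (hk := k1_generated).
  intros f [(i & hi9 & ->) | [-> | ->]].
  - exists (fun s => qrhs (profile_system L i) (fun j => profile L rho0 u0 theta j s)); split.
    + apply generated_qrhs; intros m hm.
      destruct (proj1 (profile_qsystem L) i m hm); split; apply profile_generated; assumption.
    + intros s hs; apply profile_derive; assumption.
  - eexists; split; [| exact is_derive_lambda].
    apply (gen_mult _ (fun _ => / 2)); [apply gen_cst |].
    apply (gen_mult _ (lambda L u0 theta)); [exact hl |].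
    apply (gen_mult _ (H'_over_k1 L theta)); [exact hw |].
    apply (gen_plus _ (fun _ => 1)); [apply gen_cst |].
    apply (gen_mult _ (fun _ => -1)); [apply gen_cst |].
    apply (gen_mult _ (k1 L theta) (fun s => / H L theta s)); [exact hk | exact hi].
  - eexists; split; [| exact is_derive_inv_H].
    apply (gen_mult _ (fun _ => -1)); [apply gen_cst |].
    apply gen_mult; apply gen_mult; assumption.
Qed.

Lemma profile_analytic i s : Rabs s < delta -> (i <= 9)%nat ->
  analytic_at (profile L rho0 u0 theta i) s.
Proof.
  intros hs hi; apply (qsolution_analytic_on (profile_system L) 9 (profile_norm L) 0 delta).
  - apply profile_qsystem.
  - apply (profile_solution L theta0 a0 b0); assumption.
  - rewrite Rminus_0_r; exact hs.
  - exact hi.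
Qed.

Lemma source_metric_conf J : is_conf_metric (strip delta J)
  (source_metric (rho L rho0 theta) (lambda L u0 theta))
  (fun s => / lambda L u0 theta s ^ 2) (rho L rho0 theta).
Proof.
  intros q _; unfold source_metric, rot_metric; repeat split; ring.
Qed.

Let Z := fun s => RInt (fun x => sinh (theta x) * / rho L rho0 theta x) 0 s.
Let X := imm L (rho L rho0 theta) Z.
Let xi := imm_normal L (fun s => sinh (theta s)) (fun s => cosh (theta s)) (rho L rho0 theta) Z.
Let D := strip delta (fun _ => True).
Let E := fun s => / lambda L u0 theta s ^ 2.

Lemma solution_surface : surface L D X
  (imm_s L (fun s => sinh (theta s)) (fun s => cosh (theta s)) (rho L rho0 theta) Z)
  (imm_t (rho L rho0 theta)) xi (rho L rho0 theta)
  (fun s => cosh (theta s) / L) (k1 L theta) (k2 L theta).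
Proof.
  apply (imm_surface L delta (fun _ => True) (fun s => sinh (theta s)) (fun s => cosh (theta s))
    (Derive theta)); [exact hL |].
  intros s hs; split; [apply cosh2_sinh2 |]; split.
  { unfold cosh; generalize (exp_pos (theta s)) (exp_pos (- theta s)); lra. }
  split; [apply rho_pos, hr |].
  split; [eapply is_derive_eq; [apply (profile_derive 4 s hs); lia | unfold qrhs; simpl; ring] |].
  split; [eapply is_derive_eq; [apply (profile_derive 5 s hs); lia | unfold qrhs; simpl; ring] |].
  split; [eapply is_derive_eq; [apply (profile_derive 6 s hs); lia
                               | unfold qrhs, Rdiv; simpl; ring] |].
  eapply is_derive_eq; [apply (profile_derive 8 s hs); lia | unfold qrhs; simpl; ring].
Qed.

Lemma solution_conf_factor s : Rabs s < delta ->
  0 < E s /\ ex_derive E s /\ - (k1 L theta s + k2 L theta s) / E s = 2 * u L u0 theta s.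
Proof.
  intros hs; assert (hl := lambda_pos s hs); unfold E; split; [| split].
  - apply Rinv_0_lt_compat, pow_lt, hl.
  - apply (ex_derive_inv (fun s => lambda L u0 theta s ^ 2)).
    + apply (ex_derive_ext (fun s => lambda L u0 theta s * lambda L u0 theta s));
        [intros t; Rring |].
      eexists; apply is_derive_Rmult; apply is_derive_lambda, hs.
    + apply pow_nonzero; lra.
  - rewrite (lambda_sq s hs).
    assert (hH := H_nonzero s hs); assert (hu := u_nonzero s hs).
    unfold lambda2; replace (- (k1 L theta s + k2 L theta s)) with (2 * H L theta s).
    + field; split; assumption.
    + unfold H, k1, k2, Rdiv; field; lra.
Qed.

Lemma solution_tension (D' : R * R -> Prop) eps e p :
  (forall q, D' q -> D q) -> D' p ->
  ortho_frame D' (source_metric (rho L rho0 theta) (lambda L u0 theta)) eps e ->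
  tension (source_metric (rho L rho0 theta) (lambda L u0 theta)) eps e X p =
  scal (2 * u L u0 theta (fst p)) (xi p).
Proof.
  intros hDD hp hf.
  destruct (solution_conf_factor (fst p) (proj1 (hDD p hp))) as (hE & (dE & hdE) & hEu).
  rewrite (surface_tension L D X _ _ xi (rho L rho0 theta) _ _ _ hL (strip_open delta)
    solution_surface D' _ E eps e p dE hDD hp (source_metric_conf _) hE hdE hf).
  cbv beta; rewrite hEu; reflexivity.
Qed.

Lemma solution_biharmonic :
  biharmonic D (source_metric (rho L rho0 theta) (lambda L u0 theta)) X.
Proof.
  apply (surface_biharmonic L D X _ _ xi (rho L rho0 theta) _ _ _ hL (strip_open delta)
    solution_surface _ E (u L u0 theta) (H'_over_k1 L theta) (source_metric_conf _)).
  - intros p [hp _]; apply solution_conf_factor, hp.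
  - intros p [hp _]; apply is_derive_u, hp.
  - intros p [hp _].
    destruct (ivp_derivatives _ _ _ _ _ _ hL hsol (fst p) hp) as (_ & _ & _ & d4).
    assert (d2 := profile_derive 2 (fst p) hp ltac:(lia)).
    assert (dS := profile_derive 4 (fst p) hp ltac:(lia)).
    exists (Derive (H'_over_k1 L theta) (fst p)),
      (qrhs (profile_system L 2) (fun j => profile L rho0 u0 theta j (fst p))
        + / L * (cosh (theta (fst p)) * Derive theta (fst p))).
    split; [exact d4 |]; split; [| split; [| split]].
    + apply (is_derive_ext (fun s => Derive theta s + / L * sinh (theta s)));
        [intros t; unfold k1, Rdiv; Rring |].
      eapply is_derive_eq.
      * apply is_derive_Rplus; [exact d2 |].
        apply is_derive_Rmult; [apply is_derive_cst | exact dS].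
      * unfold qrhs; simpl; ring.
    + apply (is_derive_ext (fun s => / L * sinh (theta s)));
        [intros t; unfold k2, Rdiv; Rring |].
      eapply is_derive_eq.
      * apply is_derive_Rmult; [apply is_derive_cst | exact dS].
      * unfold qrhs, k1, k2, Rdiv; simpl; ring.
    + unfold qrhs, k1, k2; simpl; field; lra.
    + assert (he := proj2 (proj1 (proj2 hsol) (fst p) hp)).
      rewrite <- he; unfold k2; field; lra.
Qed.

(** The frame [lambda d/ds], [(lambda / rho) d/dt] shows that the tension does not vanish. *)
Lemma solution_not_harmonic : 0 < delta ->
  ~ harmonic D (source_metric (rho L rho0 theta) (lambda L u0 theta)) X.
Proof.
  intros hd hh.
  set (e := fun (i : ix) (p : R * R) (k : ix) => match i, k with
    | i1, i1 => lambda L u0 theta (fst p)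
    | i2, i2 => lambda L u0 theta (fst p) * / rho L rho0 theta (fst p)
    | _, _ => 0 end).
  assert (hf : ortho_frame D (source_metric (rho L rho0 theta) (lambda L u0 theta))
                 (fun _ => 1) e).
  { split; [auto |]; split.
    - assert (hD : forall p, D p -> Rabs (fst p) < delta) by (intros p [hp _]; exact hp).
      assert (hl : generated factor_generators (lambda L u0 theta))
        by (apply gen_in; right; left; reflexivity).
      assert (h0 := gen_cst factor_generators 0).
      assert (h := fun f => generated_smooth factor_generators delta D f factor_closed hD).
      intros [|] [|]; [exact (h _ hl) | exact (h _ h0) | exact (h _ h0) |].
      apply (h (fun s => lambda L u0 theta s * / rho L rho0 theta s)), gen_mult; [exact hl |].
      apply (profile_generated 7); lia.
    - intros p [hp _]; assert (hl := lambda_pos (fst p) hp).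
      assert (hrp := rho_pos L rho0 theta (fst p) hr).
      intros [|] [|]; rewrite !sum2_R; unfold e, source_metric, rot_metric;
        match goal with |- @eq _ ?a ?b => change (@eq R a b) end; field; lra. }
  assert (h0 : D (0, 0)) by (split; [simpl; rewrite Rabs_R0; exact hd | exact I]).
  assert (ht := hh D _ e (strip_open delta) (fun q hq => hq) hf (0, 0) h0).
  rewrite (solution_tension D _ e (0, 0) (fun q hq => hq) h0 hf) in ht.
  assert (hx := sf_xx solution_surface (0, 0) h0).
  assert (hz : ip (scal (2 * u L u0 theta (fst (0, 0))) (xi (0, 0))) (xi (0, 0)) = 0)
    by (rewrite ht; apply ip_zero_l).
  rewrite ip_scal_l, hx in hz.
  apply (u_nonzero 0); [rewrite Rabs_R0; exact hd | simpl in hz; lra].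
Qed.

Lemma solution_induced p : D p -> forall i j, induced X i j p = rot_metric (rho L rho0 theta) i j p.
Proof.
  intros hp; unfold induced; assert (hsf := solution_surface).
  assert (v1 := is_vpd_unique _ _ _ _ (sf_dX1 hsf p hp)).
  assert (v2 := is_vpd_unique _ _ _ _ (sf_dX2 hsf p hp)).
  intros [|] [|]; rewrite ?v1, ?v2; unfold rot_metric.
  - apply (sf_ss hsf p hp).
  - apply (sf_st hsf p hp).
  - rewrite ip_comm; apply (sf_st hsf p hp).
  - apply (sf_tt hsf p hp).
Qed.

Lemma solution_immersion : 0 < delta ->
  rotational_biharmonic_immersion L delta (fun _ => True)
    (rho L rho0 theta) (lambda L u0 theta) X /\
  unit_normal_with_shape D (k1 L theta) (k2 L theta) (H L theta) X xi.
Proof.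
  intros hd.
  assert (hind := solution_induced); assert (hsf := solution_surface).
  assert (han : analytic_map D X /\ analytic_map D xi).
  { apply imm_analytic; intros s hs.
    split; [apply (profile_analytic 4); auto; lia |].
    split; [apply (profile_analytic 5); auto; lia |].
    split; [apply (profile_analytic 6); auto; lia |].
    split; [apply (profile_analytic 7); auto; lia | apply (profile_analytic 8); auto; lia]. }
  split; [split; [| split; [| split; [| split; [| split; [| split; [| split]]]]]] |].
  - intros p hp; apply (sf_XX hsf p hp).
  - apply han.
  - intros p hp v hv; rewrite !sum2_R, !hind by exact hp; unfold rot_metric.
    assert (hrp := rho_pos L rho0 theta (fst p) hr).
    replace (_ + _) with (v i1 * v i1 + (rho L rho0 theta (fst p) * v i2) * (rho L rho0 theta (fst p) * v i2))
      by ring.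
    destruct hv as [hv | hv].
    + generalize (Rsqr_pos_lt _ hv) (Rle_0_sqr (rho L rho0 theta (fst p) * v i2)); unfold Rsqr; lra.
    + assert (hv' : rho L rho0 theta (fst p) * v i2 <> 0)
        by (apply Rmult_integral_contrapositive; split; [lra | exact hv]).
      generalize (Rsqr_pos_lt _ hv') (Rle_0_sqr (v i1)); unfold Rsqr; lra.
  - apply parabolic_B_rotational; intros p hp.
    rewrite (is_vpd_unique _ _ _ _ (sf_dX2 hsf p hp)).
    unfold X, imm; rewrite parabolic_B_orbit; reflexivity.
  - exact hind.
  - intros p hp; assert (hl := lambda_pos (fst p) (proj1 hp)); split; [exact hl |].
    intros i j; rewrite hind by exact hp; unfold source_metric; field; lra.
  - exact solution_biharmonic.
  - exact (solution_not_harmonic hd).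
  - split; [apply han |]; intros p hp.
    assert (hr' := rho_pos L rho0 theta (fst p) hr).
    assert (v1 := is_vpd_unique _ _ _ _ (sf_dX1 hsf p hp)).
    assert (v2 := is_vpd_unique _ _ _ _ (sf_dX2 hsf p hp)).
    assert (x1 := is_vpd_unique _ _ _ _ (sf_dxi1 hsf p hp)).
    assert (x2 := is_vpd_unique _ _ _ _ (sf_dxi2 hsf p hp)).
    split; [apply (sf_xx hsf p hp) |].
    split; [apply (sf_xX hsf p hp) |].
    split; [| split; [| split]].
    + intros [|]; rewrite ?v1, ?v2;
        [apply (sf_xs hsf p hp) | apply (sf_xt hsf p hp)].
    + rewrite x1, v1, tanproj_scal, tanproj_tangent;
        [vec_ring | apply (sf_sX hsf p hp)].
    + rewrite x2, v2, tanproj_scal, tanproj_tangent;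
        [vec_ring | apply (sf_tX hsf p hp)].
    + intros D' eps e hD' hDD hp' hf.
      assert (hc : is_conf_metric D (induced X) (fun _ => 1) (rho L rho0 theta)).
      { intros q hq; rewrite !hind by exact hq; unfold rot_metric; repeat split; ring. }
      rewrite (surface_tension L D X _ _ xi (rho L rho0 theta) _ _ _ hL (strip_open delta)
        hsf D' _ (fun _ => 1) eps e p 0 hDD hp' hc Rlt_0_1 (is_derive_cst 1 (fst p)) hf).
      unfold H, k1, k2; apply R22_ext; autorewrite with r22; field; lra.
Qed.

End ConformalFactor.

(** * Null frames of parabolic rotations *)

Definition comb (n e m f : R22) (a b c d : R) : R22 :=
  plus (plus (scal a n) (scal b e)) (plus (scal c m) (scal d f)).

Record null_frame (n e m f : R22) : Prop := {
  nf_nn : ip n n = 0; nf_ne : ip n e = 0; nf_nm : ip n m = -1; nf_nf : ip n f = 0;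
  nf_ee : ip e e = 1; nf_em : ip e m = 0; nf_ef : ip e f = 0;
  nf_mm : ip m m = 0; nf_mf : ip m f = 0; nf_ff : ip f f = -1;
  nf_expand : forall v, v = comb n e m f (- ip v m) (ip v e) (- ip v n) (- ip v f)
}.

Definition det3 (a1 a2 a3 b1 b2 b3 d1 d2 d3 : R) : R :=
  a1 * (b2 * d3 - b3 * d2) - a2 * (b1 * d3 - b3 * d1) + a3 * (b1 * d2 - b2 * d1).

(** The vector with [<cross a b d, v> = det (a, b, d, v)]. *)
Definition cross (a b d : R22) : R22 :=
  (det3 (c1 a) (c2 a) (c3 a) (c1 b) (c2 b) (c3 b) (c1 d) (c2 d) (c3 d),
   - det3 (c0 a) (c2 a) (c3 a) (c0 b) (c2 b) (c3 b) (c0 d) (c2 d) (c3 d),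
   - det3 (c0 a) (c1 a) (c3 a) (c0 b) (c1 b) (c3 b) (c0 d) (c1 d) (c3 d),
   det3 (c0 a) (c1 a) (c2 a) (c0 b) (c1 b) (c2 b) (c0 d) (c1 d) (c2 d)).

Lemma cross_orthogonal a b d :
  ip a (cross a b d) = 0 /\ ip b (cross a b d) = 0 /\ ip d (cross a b d) = 0.
Proof. unfold ip, cross, det3; autorewrite with r22; repeat split; ring. Qed.

(** Cramer's rule for the Gram matrix [G] of [a, b, d], in a form that holds for all vectors:
    [<f, v> f = det G v - sum_ij adj(G)_ij <a_j, v> a_i].  When [G] is invertible it expands
    [v] in the basis [a, b, d, f]. *)
Lemma cross_double a b d v :
  scal (ip v (cross a b d)) (cross a b d) =
  minus (scal (det3 (ip a a) (ip a b) (ip a d) (ip a b) (ip b b) (ip b d) (ip a d) (ip b d) (ip d d)) v)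
    (plus (plus
      (scal (det3 (ip a v) (ip b v) (ip d v) (ip a b) (ip b b) (ip b d) (ip a d) (ip b d) (ip d d)) a)
      (scal (det3 (ip a a) (ip a b) (ip a d) (ip a v) (ip b v) (ip d v) (ip a d) (ip b d) (ip d d)) b))
      (scal (det3 (ip a a) (ip a b) (ip a d) (ip a b) (ip b b) (ip b d) (ip a v) (ip b v) (ip d v)) d)).
Proof.
  destruct a as [[[a0 a1] a2] a3], b as [[[b0 b1] b2] b3], d as [[[d0 d1] d2] d3],
    v as [[[v0 v1] v2] v3].
  unfold cross, det3, ip; apply R22_ext; autorewrite with r22; ring.
Qed.

Lemma null_frame_complete n e m :
  ip n n = 0 -> ip n e = 0 -> ip n m = -1 -> ip e e = 1 -> ip e m = 0 -> ip m m = 0 ->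
  null_frame n e m (cross n e m).
Proof.
  intros nn ne nm ee em mm.
  destruct (cross_orthogonal n e m) as (hn & he & hm).
  assert (hx : forall v, v = comb n e m (cross n e m) (- ip v m) (ip v e) (- ip v n)
                           (- ip v (cross n e m))).
  { intros v; assert (h := cross_double n e m v).
    rewrite nn, ne, nm, ee, em, mm in h.
    rewrite (ip_comm v m), (ip_comm v e), (ip_comm v n).
    unfold comb, det3 in *.
    apply R22_ext; [apply (f_equal c0) in h | apply (f_equal c1) in h
                   | apply (f_equal c2) in h | apply (f_equal c3) in h];
      autorewrite with r22 in *; lra. }
  assert (hff : ip (cross n e m) (cross n e m) = -1).
  { assert (hg : ip (cross n e m) (cross n e m) =
      det3 (ip n n) (ip n e) (ip n m) (ip n e) (ip e e) (ip e m) (ip n m) (ip e m) (ip m m)).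
    { unfold cross, det3, ip; autorewrite with r22; ring. }
    rewrite hg, nn, ne, nm, ee, em, mm; unfold det3; ring. }
  constructor; assumption.
Qed.

Lemma null_frame_opp n e m f : null_frame n e m f -> null_frame n e m (opp f).
Proof.
  intros h; destruct h; constructor; rewrite ?ip_opp_l, ?ip_opp_r; try lra.
  intros v; rewrite ip_opp_r, (nf_expand0 v) at 1; unfold comb; vec_ring.
Qed.

Lemma ip_comb_null n e m f a b c d a' b' c' d' : null_frame n e m f ->
  ip (comb n e m f a b c d) (comb n e m f a' b' c' d') = b * b' - a * c' - c * a' - d * d'.
Proof.
  intros []; unfold comb; autorewrite with ipdb.
  rewrite (ip_comm e n), (ip_comm m n), (ip_comm f n), (ip_comm m e), (ip_comm f e), (ip_comm f m).
  rewrite nf_nn0, nf_ne0, nf_nm0, nf_nf0, nf_ee0, nf_em0, nf_ef0, nf_mm0, nf_mf0, nf_ff0; ring.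
Qed.

Lemma comb_coords n e m f a b c d : null_frame n e m f ->
  - ip (comb n e m f a b c d) m = a /\ ip (comb n e m f a b c d) e = b /\
  - ip (comb n e m f a b c d) n = c /\ - ip (comb n e m f a b c d) f = d.
Proof.
  intros []; unfold comb; autorewrite with ipdb.
  rewrite (ip_comm e n), (ip_comm m n), (ip_comm f n), (ip_comm m e), (ip_comm f e), (ip_comm f m).
  rewrite nf_nn0, nf_ne0, nf_nm0, nf_nf0, nf_ee0, nf_em0, nf_ef0, nf_mm0, nf_mf0, nf_ff0.
  repeat split; ring.
Qed.

(** * Linear isometries *)

Lemma class_C_const (n : nat) {V W : NormedModule R_AbsRing} (D : V -> Prop) (w : W) :
  class_C n D (fun _ : V => w).
Proof.
  revert w; induction n as [| n IH]; intros w; simpl.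
  - intros p _; apply continuous_const.
  - exists (fun _ _ => zero); split; [intros p _; apply filterdiff_const | intros v; apply IH].
Qed.

Lemma linear_smooth {V W : NormedModule R_AbsRing} (D : V -> Prop) (l : V -> W) :
  is_linear l -> smooth_on D l.
Proof.
  intros hl [| n]; simpl.
  - intros p _; apply linear_cont, hl.
  - exists (fun _ v => l v); split; [intros p _; apply filterdiff_linear, hl |].
    intros v; apply class_C_const.
Qed.

Definition frame_map (n e m f n' e' m' f' v : R22) : R22 :=
  comb n' e' m' f' (- ip v m) (ip v e) (- ip v n) (- ip v f).

Lemma frame_map_linear n e m f n' e' m' f' : is_linear (frame_map n e m f n' e' m' f').
Proof.
  apply (is_linear_ext (fun v => plus (plus (scal (ip v (opp m)) n') (scal (ip v e) e'))
    (plus (scal (ip v (opp n)) m') (scal (ip v (opp f)) f')))).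
  - intros v; unfold frame_map, comb; rewrite !ip_opp_r; reflexivity.
  - exact (is_linear_add _ _
      (is_linear_add _ _ (is_linear_vec _ n' (is_linear_ip_l (opp m)))
                         (is_linear_vec _ e' (is_linear_ip_l e)))
      (is_linear_add _ _ (is_linear_vec _ m' (is_linear_ip_l (opp n)))
                         (is_linear_vec _ f' (is_linear_ip_l (opp f))))).
Qed.

Lemma frame_map_comb n e m f n' e' m' f' a b c d : null_frame n e m f ->
  frame_map n e m f n' e' m' f' (comb n e m f a b c d) = comb n' e' m' f' a b c d.
Proof.
  intros h; unfold frame_map.
  destruct (comb_coords n e m f a b c d h) as (-> & -> & -> & ->); reflexivity.
Qed.

Lemma frame_map_inverse n e m f n' e' m' f' v : null_frame n e m f -> null_frame n' e' m' f' ->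
  frame_map n' e' m' f' n e m f (frame_map n e m f n' e' m' f' v) = v.
Proof.
  intros h h'; unfold frame_map at 2; rewrite frame_map_comb by exact h'.
  symmetry; apply (nf_expand _ _ _ _ h).
Qed.

Lemma frame_map_ip n e m f n' e' m' f' v w : null_frame n e m f -> null_frame n' e' m' f' ->
  ip (frame_map n e m f n' e' m' f' v) (frame_map n e m f n' e' m' f' w) = ip v w.
Proof.
  intros h h'; unfold frame_map; rewrite ip_comb_null by exact h'.
  rewrite <- (ip_comb_null n e m f _ _ _ _ _ _ _ _ h).
  rewrite <- (nf_expand _ _ _ _ h v), <- (nf_expand _ _ _ _ h w); reflexivity.
Qed.

Lemma frame_map_isometry L n e m f n' e' m' f' : null_frame n e m f -> null_frame n' e' m' f' ->
  AdS_isometry L (frame_map n e m f n' e' m' f').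
Proof.
  intros h h'; exists (frame_map n' e' m' f' n e m f), (fun _ => True).
  split; [apply open_true |]; split; [auto |].
  split; [apply linear_smooth, frame_map_linear |].
  split; [apply linear_smooth, frame_map_linear |]; split.
  - intros p hp; unfold AdS; rewrite !frame_map_ip, !frame_map_inverse by assumption; auto.
  - intros p _; exists (frame_map n e m f n' e' m' f'); split.
    + apply filterdiff_linear, frame_map_linear.
    + intros v w _ _; apply frame_map_ip; assumption.
Qed.

(** * A function with the same square as one with simple zeros *)

Lemma simple_zero_isolated (g : R -> R) (s l : R) : is_derive g s l -> l <> 0 -> g s = 0 ->
  locally s (fun y => y <> s -> g y <> 0).
Proof.
  intros hg hl h0.
  apply is_derive_Reals in hg.
  destruct (hg (Rabs l / 2)) as (d & hd); [generalize (Rabs_pos_lt l hl); lra |].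
  exists d; intros y hy hne he.
  assert (hy' : Rabs (y - s) < d) by exact hy.
  specialize (hd (y - s) (fun e0 => hne (Rminus_diag_uniq y s e0)) hy').
  rewrite (Rplus_minus s y) in hd.
  rewrite he, h0, Rminus_diag in hd; unfold Rdiv in hd; rewrite Rmult_0_l in hd.
  rewrite Rminus_0_l, Rabs_Ropp in hd; generalize (Rabs_pos_lt l hl); lra.
Qed.

Lemma locally_neq_0 (f : R -> R) (s l : R) : is_derive f s l -> f s <> 0 ->
  locally s (fun y => f y <> 0).
Proof.
  intros hf h0; exact (is_derive_continuous f s l hf _ (open_neq 0 (f s) h0)).
Qed.

(** At a common zero of [f = A - S] and [g = A + S] the derivatives of [f] and [g] differ by
    [2 S' <> 0], so that one of the two has an isolated zero there and the other one vanishes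
    on a neighbourhood. *)
Lemma same_square_sign (A S dA dS : R -> R) (delta : R) :
  (forall s, Rabs s < delta -> is_derive A s (dA s) /\ is_derive S s (dS s)) ->
  (forall s, Rabs s < delta -> A s * A s = S s * S s) ->
  (forall s, Rabs s < delta -> S s = 0 -> dS s <> 0) ->
  exists eps, (eps = 1 \/ eps = -1) /\ forall s, Rabs s < delta -> A s = eps * S s.
Proof.
  intros hd hsq hz.
  set (f := fun s => A s - S s); set (g := fun s => A s + S s).
  assert (hf : forall s, Rabs s < delta -> is_derive f s (dA s - dS s))
    by (intros s hs; apply is_derive_Rminus; apply hd, hs).
  assert (hg : forall s, Rabs s < delta -> is_derive g s (dA s + dS s))
    by (intros s hs; apply is_derive_Rplus; apply hd, hs).
  assert (hfg : forall s, Rabs s < delta -> f s = 0 \/ g s = 0).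
  { intros s hs; apply Rmult_integral; unfold f, g; generalize (hsq s hs); lra. }
  (* Near any point one of the two factors vanishes identically. *)
  assert (hloc : forall s, Rabs s < delta ->
    locally s (fun y => f y = 0) \/ locally s (fun y => g y = 0)).
  { intros s hs; assert (hin := locally_Rabs_lt s delta hs).
    destruct (Req_dec (f s) 0) as [f0 | f0].
    - destruct (Req_dec (g s) 0) as [g0 | g0].
      + assert (hS0 : S s = 0) by (unfold f, g in *; lra).
        assert (hS1 := hz s hs hS0).
        destruct (Req_dec (dA s + dS s) 0) as [e | e].
        * right; generalize (filter_and _ _ hin (simple_zero_isolated f s _ (hf s hs)
            ltac:(lra) f0)); apply filter_imp; intros y [hy hy'].
          destruct (Req_dec y s) as [-> | hne]; [exact g0 |].
          destruct (hfg y hy) as [h | h]; [destruct (hy' hne h) | exact h].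
        * left; generalize (filter_and _ _ hin (simple_zero_isolated g s _ (hg s hs)
            e g0)); apply filter_imp; intros y [hy hy'].
          destruct (Req_dec y s) as [-> | hne]; [exact f0 |].
          destruct (hfg y hy) as [h | h]; [exact h | destruct (hy' hne h)].
      + left; generalize (filter_and _ _ hin (locally_neq_0 g s _ (hg s hs) g0)).
        apply filter_imp; intros y [hy hy'].
        destruct (hfg y hy) as [h | h]; [exact h | destruct (hy' h)].
    - right; generalize (filter_and _ _ hin (locally_neq_0 f s _ (hf s hs) f0)).
      apply filter_imp; intros y [hy hy'].
      destruct (hfg y hy) as [h | h]; [destruct (hy' h) | exact h]. }
  assert (hexcl : forall s, Rabs s < delta ->
    locally s (fun y => f y = 0) -> locally s (fun y => g y = 0) -> False).
  { intros s hs h1 h2.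
    assert (hS : locally s (fun y => 0 = S y)).
    { generalize (filter_and _ _ h1 h2); apply filter_imp; intros y [e1 e2].
      unfold f, g in *; lra. }
    apply (hz s hs); [symmetry; apply (locally_singleton _ _ hS) |].
    rewrite <- (is_derive_unique _ _ _ (proj2 (hd s hs))).
    apply is_derive_unique, (is_derive_ext_loc (fun _ => 0)); [exact hS | apply is_derive_cst]. }
  (* The indicator of the first alternative is locally constant, hence constant. *)
  set (chi := fun s => if excluded_middle_informative (locally s (fun y => f y = 0)) then 1 else 0).
  assert (hchi : forall s, Rabs s < delta -> is_derive chi s 0).
  { intros s hs.
    apply (is_derive_ext_loc (fun _ => chi s)); [| apply is_derive_cst].
    assert (hin := locally_Rabs_lt s delta hs).
    destruct (hloc s hs) as [h | h].
    - generalize (locally_locally _ _ h); apply filter_imp; intros y hy; unfold chi.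
      destruct excluded_middle_informative; [| contradiction].
      destruct excluded_middle_informative; [reflexivity | contradiction].
    - generalize (filter_and _ _ hin (locally_locally _ _ h)); apply filter_imp; intros y [hy hy'].
      unfold chi.
      destruct excluded_middle_informative as [h1 |]; [destruct (hexcl s hs h1 h) |].
      destruct excluded_middle_informative as [h1 |]; [destruct (hexcl y hy h1 hy') | reflexivity]. }
  assert (hcst : forall s, Rabs s < delta -> chi s = chi 0).
  { intros s hs; apply (zero_derive_constant chi 0 delta); [| rewrite Rminus_0_r; exact hs].
    intros y hy; apply hchi; rewrite Rminus_0_r in hy; exact hy. }
  destruct (Req_dec (chi 0) 1) as [e | e].
  - exists 1; split; [auto |]; intros s hs.
    generalize (hcst s hs); rewrite e; unfold chi.
    destruct excluded_middle_informative as [h | _]; [intros _ | lra].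
    generalize (locally_singleton _ _ h); unfold f; lra.
  - exists (-1); split; [auto |]; intros s hs.
    assert (hn : ~ locally s (fun y => f y = 0)).
    { intros h; apply e; rewrite <- (hcst s hs); unfold chi.
      destruct excluded_middle_informative; [reflexivity | contradiction]. }
    destruct (hloc s hs) as [h | h]; [contradiction |].
    generalize (locally_singleton _ _ h); unfold g; lra.
Qed.

(** * Rigidity of parabolic rotational surfaces *)

Lemma analytic_map_is_vpd D X p i : analytic_map D X -> D p -> is_vpd i X p (vpd i X p).
Proof.
  intros h hp; destruct (h p hp) as (h0 & h1 & h2 & h3); split4;
    [ exact (analytic_at_derive _ _ (analytic2_at_line i _ p h0))
    | exact (analytic_at_derive _ _ (analytic2_at_line i _ p h1))
    | exact (analytic_at_derive _ _ (analytic2_at_line i _ p h2))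
    | exact (analytic_at_derive _ _ (analytic2_at_line i _ p h3)) ].
Qed.

Lemma is_pd_ip i V p W (v : R22) : is_vpd i V p W -> is_pd i (fun q => ip (V q) v) p (ip W v).
Proof.
  intros h; eapply is_derive_eq.
  - apply (is_derive_ip _ (fun _ => v) _ _ zero h), is_vderive_const.
  - rewrite ip_zero_r; ring.
Qed.

Lemma zero_derive_interval (J : R -> Prop) (f : R -> R) (t0 t : R) :
  is_open_interval J -> J t0 -> J t -> (forall x, J x -> is_derive f x 0) -> f t = f t0.
Proof.
  intros (_ & _ & hJ) h0 ht hf.
  destruct (Rtotal_order t t0) as [hlt | [-> | hgt]]; [| reflexivity |].
  - apply (eq_is_derive f t t0); [| exact hlt]; intros x hx; apply hf, (hJ t x t0); auto.
  - symmetry; apply (eq_is_derive f t0 t); [| exact hgt]; intros x hx; apply hf, (hJ t0 x t); auto.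
Qed.

(** A frame adapted to [B] in which the orbit of [P] is the standard one; [e], [n] are
    proportional to [B P], [B^2 P] and [m] spans the other null line of the plane of [P] and
    [n].  The sign of [<e, e>] is where [B P] spacelike is used. *)
Lemma parabolic_frame (B : R22 -> R22) (P : R22) (L r0 : R) :
  0 < r0 -> skew_adjoint B -> (forall x, B (B (B x)) = zero) ->
  ip P P = - L ^ 2 -> ip (B P) (B P) = r0 ^ 2 ->
  exists n e m f, null_frame n e m f /\
    B n = zero /\ B e = n /\ B m = e /\ B f = zero /\
    ip P n = - r0 /\ ip P e = 0 /\ ip P f = 0.
Proof.
  intros hr [hlin hskew] hB3 hPP hBP.
  assert (hz : forall x, ip (B x) x = 0) by (intros x; generalize (hskew x x); rewrite (ip_comm x); lra).
  assert (hr' : r0 <> 0) by lra.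
  set (n := scal (/ r0) (B (B P))); set (e := scal (/ r0) (B P)).
  set (m := plus (scal (/ r0) P) (scal (- L ^ 2 / (2 * r0 ^ 2)) n)).
  assert (hB2P : ip (B (B P)) P = - r0 ^ 2) by (rewrite hskew, hBP; ring).
  assert (hB22 : ip (B (B P)) (B (B P)) = 0)
    by (rewrite hskew, hB3, ip_zero_r; ring).
  assert (hP0 : ip (B P) P = 0) by apply hz.
  assert (hP1 : ip (B (B P)) (B P) = 0) by apply hz.
  assert (hBn : B n = zero).
  { unfold n; rewrite (linear_scal _ hlin), hB3; vec_ring. }
  assert (hBe : B e = n) by (unfold e, n; apply (linear_scal _ hlin)).
  assert (hBm : B m = e).
  { unfold m; rewrite (linear_plus _ hlin), !(linear_scal _ hlin), hBn; unfold e; vec_ring. }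
  assert (hN : null_frame n e m (cross n e m)).
  { apply null_frame_complete; unfold m, n, e; autorewrite with ipdb;
      rewrite ?(ip_comm P (B P)), ?(ip_comm P (B (B P))), ?(ip_comm (B P) (B (B P)));
      rewrite ?hB22, ?hP1, ?hB2P, ?hBP, ?hP0, ?hPP; field; exact hr'. }
  exists n, e, m, (cross n e m); split; [exact hN |].
  split; [exact hBn |]; split; [exact hBe |]; split; [exact hBm |]; split.
  - rewrite (nf_expand _ _ _ _ hN (B (cross n e m))).
    rewrite !hskew, hBm, hBe, hBn, ip_zero_r, (ip_comm _ (B (cross n e m))), hz.
    rewrite (ip_comm _ e), (ip_comm _ n), (nf_ef _ _ _ _ hN), (nf_nf _ _ _ _ hN).
    unfold comb; vec_ring.
  - assert (hPm : P = scal r0 (minus m (scal (- L ^ 2 / (2 * r0 ^ 2)) n))).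
    { unfold m; apply R22_ext; autorewrite with r22; field; exact hr'. }
    split; [| split].
    + unfold n; rewrite ip_scal_r, ip_comm, hB2P; field; exact hr'.
    + unfold e; rewrite ip_scal_r, ip_comm, hP0; ring.
    + rewrite hPm, ip_scal_l, ip_minus_l, ip_scal_l, (nf_mf _ _ _ _ hN), (nf_nf _ _ _ _ hN); ring.
Qed.

(** [d n + b e + a m + c f] is the curve [X(s, t0)] in a null frame in which [B X = b n + a e].
    Then [htt], [hst], [hss] are the coefficients of the first fundamental form, and [hXX] says
    that the curve lies on the quadric. *)
Section Coordinates.
Context (L delta : R) (a b c d r q S Z dS : R -> R).
Context (hr : forall s, Rabs s < delta -> 0 < r s /\ is_derive r s (q s * r s)).
Context (ha : forall s, Rabs s < delta -> is_derive a s (Derive a s)).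
Context (hb : forall s, Rabs s < delta -> is_derive b s (Derive b s)).
Context (hc : forall s, Rabs s < delta -> is_derive c s (Derive c s)).
Context (hd : forall s, Rabs s < delta -> is_derive d s (Derive d s)).
Context (hc2 : forall s, Rabs s < delta -> ex_derive (Derive c) s).
Context (hq : forall s, Rabs s < delta -> ex_derive q s).
Context (hS : forall s, Rabs s < delta -> is_derive S s (dS s) /\ (S s = 0 -> dS s <> 0)).
Context (hZ : forall s, Rabs s < delta -> is_derive Z s (S s * / r s)).
Context (hqS : forall s, Rabs s < delta -> q s * q s * L ^ 2 = 1 + S s * S s).
Context (htt : forall s, Rabs s < delta -> a s * a s = r s * r s).
Context (hst : forall s, Rabs s < delta -> Derive b s * a s - Derive a s * b s = 0).
Context (hXX : forall s, Rabs s < delta -> b s * b s - 2 * (d s * a s) - c s * c s = - L ^ 2).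
Context (hss : forall s, Rabs s < delta ->
  Derive b s * Derive b s - 2 * (Derive d s * Derive a s) - Derive c s * Derive c s = 1).
Context (h0 : 0 < delta) (ha0 : a 0 = r 0) (hb0 : b 0 = 0) (hc0 : c 0 = 0) (hZ0 : Z 0 = 0).

Lemma ratio_constant (f df g : R -> R) :
  (forall s, Rabs s < delta -> is_derive f s (df s)) ->
  (forall s, Rabs s < delta -> is_derive g s ((df s - q s * f s) * / r s)) ->
  forall s, Rabs s < delta -> f s * / r s - g s = f 0 * / r 0 - g 0.
Proof.
  intros hf hg s hs.
  apply (zero_derive_constant (fun s => f s * / r s - g s) 0 delta); [| rewrite Rminus_0_r; exact hs].
  intros x hx; rewrite Rminus_0_r in hx; destruct (hr x hx) as [hr1 hr2].
  eapply is_derive_eq.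
  - apply is_derive_Rminus; [| apply hg, hx].
    apply is_derive_Rmult; [apply hf, hx | apply (is_derive_inv r _ _ hr2); lra].
  - cbv beta; field; lra.
Qed.

(** The sign in [a = +- r] does not jump: differentiating [a^2 = r^2] gives the linear equation
    of [r] for [a]. *)
Lemma coord_a_derive s : Rabs s < delta -> Derive a s = q s * a s.
Proof.
  intros hs; destruct (hr s hs) as [hr1 hr2].
  assert (e : Derive a s * a s + a s * Derive a s = q s * r s * r s + r s * (q s * r s)).
  { rewrite <- (is_derive_unique _ _ _ (is_derive_Rmult a a s _ _ (ha s hs) (ha s hs))).
    apply is_derive_unique, (is_derive_ext_loc (fun s => r s * r s)).
    - generalize (locally_Rabs_lt s delta hs); apply filter_imp; intros y hy; symmetry; apply htt, hy.
    - apply is_derive_Rmult; exact hr2. }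
  assert (hn : a s <> 0).
  { intros h; generalize (htt s hs); rewrite h; generalize (Rmult_lt_0_compat _ _ hr1 hr1); lra. }
  apply (Rmult_eq_reg_l (a s)); [| exact hn].
  replace (a s * (q s * a s)) with (q s * (a s * a s)) by ring; rewrite (htt s hs); lra.
Qed.

Lemma coord_a s : Rabs s < delta -> a s = r s.
Proof.
  intros hs; destruct (hr s hs) as [hr1 _].
  assert (h := ratio_constant a (Derive a) (fun _ => 0) ha).
  cbv beta in h; rewrite ha0 in h.
  destruct (hr 0 ltac:(rewrite Rabs_R0; exact h0)) as [hr0 _].
  assert (e : a s * / r s - 0 = r 0 * / r 0 - 0).
  { apply h; [| exact hs]; intros x hx.
    rewrite coord_a_derive by exact hx; eapply is_derive_eq; [apply is_derive_cst | ring]. }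
  rewrite Rinv_r in e by lra.
  apply (Rmult_eq_reg_r (/ r s)); [rewrite Rinv_r; lra |].
  apply Rinv_neq_0_compat; lra.
Qed.

Lemma coord_b_derive s : Rabs s < delta -> Derive b s = q s * b s.
Proof.
  intros hs; destruct (hr s hs) as [hr1 _].
  apply (Rmult_eq_reg_r (a s)); [| rewrite coord_a by exact hs; lra].
  generalize (hst s hs); rewrite coord_a_derive by exact hs; lra.
Qed.

Lemma coord_b s : Rabs s < delta -> b s = 0.
Proof.
  intros hs; destruct (hr s hs) as [hr1 _].
  assert (h := ratio_constant b (Derive b) (fun _ => 0) hb).
  cbv beta in h; rewrite hb0 in h.
  assert (e : b s * / r s - 0 = 0 * / r 0 - 0).
  { apply h; [| exact hs]; intros x hx.
    rewrite coord_b_derive by exact hx; eapply is_derive_eq; [apply is_derive_cst | ring]. }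
  apply (Rmult_eq_reg_r (/ r s)); [lra |].
  apply Rinv_neq_0_compat; lra.
Qed.

(** Elimination of [d] between [<X, X> = - L^2], its derivative and [<X_s, X_s> = 1]. *)
Lemma coord_c_square s : Rabs s < delta ->
  (Derive c s - q s * c s) * (Derive c s - q s * c s) = S s * S s.
Proof.
  intros hs; destruct (hr s hs) as [hr1 hr2].
  assert (e : Derive b s * b s + b s * Derive b s - (0 * (d s * a s)
      + 2 * (Derive d s * a s + d s * Derive a s)) - (Derive c s * c s + c s * Derive c s) = 0).
  { assert (hl : is_derive (fun s => b s * b s - 2 * (d s * a s) - c s * c s) s
      (Derive b s * b s + b s * Derive b s - (0 * (d s * a s)
      + 2 * (Derive d s * a s + d s * Derive a s)) - (Derive c s * c s + c s * Derive c s))).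
    { apply (is_derive_Rminus (fun s => b s * b s - 2 * (d s * a s)) (fun s => c s * c s)).
      - apply (is_derive_Rminus (fun s => b s * b s) (fun s => 2 * (d s * a s))).
        + exact (is_derive_Rmult b b s _ _ (hb s hs) (hb s hs)).
        + apply (is_derive_Rmult (fun _ => 2) (fun s => d s * a s)); [apply is_derive_cst |].
          exact (is_derive_Rmult d a s _ _ (hd s hs) (ha s hs)).
      - exact (is_derive_Rmult c c s _ _ (hc s hs) (hc s hs)). }
    rewrite <- (is_derive_unique _ _ _ hl).
    apply is_derive_unique, (is_derive_ext_loc (fun _ => - L ^ 2)); [| apply is_derive_cst].
    generalize (locally_Rabs_lt s delta hs); apply filter_imp; intros y hy; symmetry; apply hXX, hy. }
  generalize (hss s hs) (hXX s hs) (hqS s hs).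
  rewrite coord_a_derive, coord_b_derive, coord_b, coord_a in e |- * by exact hs.
  intros e1 e2 e3.
  assert (e4 : Derive d s * r s = - (d s * (q s * r s)) - c s * Derive c s) by lra.
  assert (e5 : - 2 * q s * (Derive d s * r s) - Derive c s * Derive c s = 1) by lra.
  rewrite e4 in e5.
  assert (e6 : 2 * (d s * r s) = L ^ 2 - c s * c s) by lra.
  assert (e7 : q s * q s * (2 * (d s * r s)) = q s * q s * (L ^ 2 - c s * c s))
    by (rewrite e6; reflexivity).
  lra.
Qed.

Lemma coord_c : exists eps, (eps = 1 \/ eps = -1) /\
  forall s, Rabs s < delta -> c s = eps * (r s * Z s).
Proof.
  destruct (same_square_sign (fun s => Derive c s - q s * c s) S
    (fun s => Derive (fun s => Derive c s - q s * c s) s) dS delta) as (eps & heps & he).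
  - intros s hs; split; [| apply hS, hs].
    apply Derive_correct.
    apply (ex_derive_minus (Derive c) (fun s => q s * c s)); [apply hc2, hs |].
    apply (ex_derive_mult q c); [apply hq, hs | eexists; apply hc, hs].
  - exact coord_c_square.
  - intros s hs; apply hS, hs.
  - cbv beta in he; exists eps; split; [exact heps |]; intros s hs; destruct (hr s hs) as [hr1 _].
    assert (e := ratio_constant c (Derive c) (fun s => eps * Z s) hc).
    cbv beta in e; rewrite hc0, hZ0 in e.
    assert (e' : c s * / r s - eps * Z s = 0 * / r 0 - eps * 0).
    { apply e; [| exact hs]; intros x hx; rewrite he by exact hx.
      eapply is_derive_eq; [apply is_derive_Rmult; [apply is_derive_cst | apply hZ, hx] |].
      cbv beta; ring. }
    apply (Rmult_eq_reg_r (/ r s)); [| apply Rinv_neq_0_compat; lra].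
    transitivity (eps * Z s); [lra | field; lra].
Qed.

End Coordinates.

Lemma analytic_at_ip (D : R * R -> Prop) X (p : R * R) (v : R22) : analytic_map D X -> D p ->
  analytic_at (fun s => ip (X (s, snd p)) v) (fst p).
Proof.
  intros h hp; destruct (h p hp) as (h0 & h1 & h2 & h3).
  apply (analytic2_at_line i1) in h0; apply (analytic2_at_line i1) in h1.
  apply (analytic2_at_line i1) in h2; apply (analytic2_at_line i1) in h3.
  unfold line, coord in *.
  apply (analytic_at_ext (fun s => (- c0 v * c0 (X (s, snd p)) + - c1 v * c1 (X (s, snd p)))
    + (c2 v * c2 (X (s, snd p)) + c3 v * c3 (X (s, snd p))))).
  - intros s; unfold ip; ring.
  - apply analytic_at_plus; apply analytic_at_plus; apply analytic_at_scal; assumption.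
Qed.

(** In a suitable null frame, the first fundamental form and the parabolic symmetry leave a
    single immersion.  The coordinates along [m] and [e] come from [X_t = B X] and the metric,
    the one along [n] from [<X, X> = - L^2]; the one along [f] is [r z] with
    [(r z')^2 = S^2].  The sign of [r z' = +- S] is constant because the zeros of
    [S = sinh theta] are simple ([theta' = k1 <> 0] there), and it can be absorbed in [f]. *)
Lemma canonical_form L theta0 a0 b0 rho0 u0 delta theta (J : R -> Prop) (t0 : R) X :
  0 < L -> 0 < rho0 -> 0 < delta -> ivp_solution L theta0 a0 b0 delta theta ->
  is_open_interval J -> J t0 ->
  rotational_biharmonic_immersion L delta J (rho L rho0 theta) (lambda L u0 theta) X ->
  exists n e m f, null_frame n e m f /\ forall s t, strip delta J (s, t) ->
    let r := rho L rho0 theta s in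
    let y := r * RInt (fun x => sinh (theta x) * / rho L rho0 theta x) 0 s in
    X (s, t) = comb n e m f ((L ^ 2 + (r * (t - t0)) ^ 2 - y ^ 2) / (2 * r)) (r * (t - t0)) r y.
Proof.
  intros hL hr hd hsol hJ ht0 (hAdS & han & _ & (B & hB & _ & hB3 & _ & hX2) & hind & _).
  set (D := strip delta J) in *.
  assert (hD0 : forall s, Rabs s < delta -> D (s, t0)) by (intros s hs; split; assumption).
  assert (h00 : Rabs 0 < delta) by (rewrite Rabs_R0; exact hd).
  assert (hrho0 : rho L rho0 theta 0 = rho0)
    by exact (profile_0 L theta0 a0 b0 rho0 u0 delta theta hL hd hsol 6).
  assert (hBB : forall p, D p -> ip (B (X p)) (B (X p)) = rho L rho0 theta (fst p) ^ 2).
  { intros p hp; rewrite <- (hX2 p hp); exact (hind p hp i2 i2). }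
  destruct (parabolic_frame B (X (0, t0)) L rho0 hr hB hB3 (hAdS _ (hD0 0 h00)))
    as (n & e & m & f & hN & hBn & hBe & hBm & hBf & hPn & hPe & hPf).
  { rewrite hBB by (apply hD0, h00); simpl fst; rewrite hrho0; reflexivity. }
  assert (hskew := proj2 hB).
  set (a := fun s => - ip (X (s, t0)) n); set (b := fun s => ip (X (s, t0)) e).
  set (c := fun s => - ip (X (s, t0)) f); set (d := fun s => - ip (X (s, t0)) m).
  assert (hpr : forall i s, Rabs s < delta -> (i <= 9)%nat ->
    is_derive (profile L rho0 u0 theta i) s
      (qrhs (profile_system L i) (fun j => profile L rho0 u0 theta j s)))
    by (intros i s hs hi; exact (profile_derive L theta0 a0 b0 rho0 u0 delta theta hL hr hsol i s hs hi)).
  assert (hds : forall s, Rabs s < delta -> forall v,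
    is_derive (fun s => ip (X (s, t0)) v) s (ip (vpd i1 X (s, t0)) v)).
  { intros s hs v; exact (is_pd_ip i1 X (s, t0) _ v (analytic_map_is_vpd D X _ i1 han (hD0 s hs))). }
  assert (hdsN : forall s, Rabs s < delta -> forall v,
    is_derive (fun s => - ip (X (s, t0)) v) s (- ip (vpd i1 X (s, t0)) v)).
  { intros s hs v; exact (is_derive_opp _ _ _ (hds s hs v)). }
  assert (Da : forall s, Rabs s < delta -> Derive a s = - ip (vpd i1 X (s, t0)) n)
    by (intros s hs; apply is_derive_unique, hdsN, hs).
  assert (Db : forall s, Rabs s < delta -> Derive b s = ip (vpd i1 X (s, t0)) e)
    by (intros s hs; apply is_derive_unique, hds, hs).
  assert (Dc : forall s, Rabs s < delta -> Derive c s = - ip (vpd i1 X (s, t0)) f)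
    by (intros s hs; apply is_derive_unique, hdsN, hs).
  assert (Dd : forall s, Rabs s < delta -> Derive d s = - ip (vpd i1 X (s, t0)) m)
    by (intros s hs; apply is_derive_unique, hdsN, hs).
  assert (eX : forall s, X (s, t0) = comb n e m f (d s) (b s) (a s) (c s))
    by (intros s; apply (nf_expand _ _ _ _ hN)).
  assert (eXs : forall s, Rabs s < delta ->
    vpd i1 X (s, t0) = comb n e m f (Derive d s) (Derive b s) (Derive a s) (Derive c s))
    by (intros s hs; rewrite Da, Db, Dc, Dd by exact hs; apply (nf_expand _ _ _ _ hN)).
  assert (eBX : forall s, B (X (s, t0)) = comb n e m f (b s) (a s) 0 0).
  { intros s; rewrite (nf_expand _ _ _ _ hN (B (X (s, t0)))).
    rewrite !hskew, hBm, hBe, hBn, hBf, !ip_zero_r; unfold a, b.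
    f_equal; ring. }
  set (Z := fun s => RInt (fun x => sinh (theta x) * / rho L rho0 theta x) 0 s).
  set (q := fun s => / L * cosh (theta s)).
  assert (Hr : forall s, Rabs s < delta -> 0 < rho L rho0 theta s /\
    is_derive (rho L rho0 theta) s (q s * rho L rho0 theta s)).
  { intros s hs; split; [apply rho_pos, hr |].
    eapply is_derive_eq; [apply (hpr 6%nat s hs); lia | unfold qrhs, q; simpl; ring]. }
  assert (Ha : forall s, Rabs s < delta -> is_derive a s (Derive a s))
    by (intros s hs; rewrite Da by exact hs; apply hdsN, hs).
  assert (Hb : forall s, Rabs s < delta -> is_derive b s (Derive b s))
    by (intros s hs; rewrite Db by exact hs; apply hds, hs).
  assert (Hc : forall s, Rabs s < delta -> is_derive c s (Derive c s))
    by (intros s hs; rewrite Dc by exact hs; apply hdsN, hs).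
  assert (Hd : forall s, Rabs s < delta -> is_derive d s (Derive d s))
    by (intros s hs; rewrite Dd by exact hs; apply hdsN, hs).
  assert (Hc2 : forall s, Rabs s < delta -> ex_derive (Derive c) s).
  { intros s hs; apply (analytic_at_ex_derive_n c s 2).
    apply analytic_at_opp; exact (analytic_at_ip D X (s, t0) f han (hD0 s hs)). }
  assert (Hq : forall s, Rabs s < delta -> ex_derive q s).
  { intros s hs; eexists; apply is_derive_Rmult; [apply is_derive_cst |].
    apply (hpr 5%nat s hs); lia. }
  assert (Htt : forall s, Rabs s < delta -> a s * a s = rho L rho0 theta s * rho L rho0 theta s).
  { intros s hs; generalize (hBB _ (hD0 s hs)); rewrite eBX, ip_comb_null by exact hN.
    simpl fst; intros h; lra. }
  assert (Hst : forall s, Rabs s < delta -> Derive b s * a s - Derive a s * b s = 0).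
  { intros s hs; generalize (hind _ (hD0 s hs) i1 i2); unfold induced, rot_metric.
    rewrite (hX2 _ (hD0 s hs)), eXs, eBX, ip_comb_null by assumption; lra. }
  assert (HXX : forall s, Rabs s < delta -> b s * b s - 2 * (d s * a s) - c s * c s = - L ^ 2).
  { intros s hs; generalize (hAdS _ (hD0 s hs)); unfold AdS; rewrite eX, ip_comb_null by assumption; lra. }
  assert (Hss : forall s, Rabs s < delta -> Derive b s * Derive b s
      - 2 * (Derive d s * Derive a s) - Derive c s * Derive c s = 1).
  { intros s hs; generalize (hind _ (hD0 s hs) i1 i1); unfold induced, rot_metric.
    rewrite eXs, ip_comb_null by assumption; lra. }
  assert (Ha0 : a 0 = rho L rho0 theta 0) by (unfold a; rewrite hPn, hrho0; ring).
  assert (Hb0 : b 0 = 0) by exact hPe.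
  assert (Hc0 : c 0 = 0) by (unfold c; rewrite hPf; ring).
  assert (Ea : forall s, Rabs s < delta -> a s = rho L rho0 theta s)
    by exact (coord_a delta a (rho L rho0 theta) q Hr Ha Htt hd Ha0).
  assert (Eb : forall s, Rabs s < delta -> b s = 0)
    by exact (coord_b delta a b (rho L rho0 theta) q Hr Ha Hb Htt Hst hd Ha0 Hb0).
  assert (Ec : exists eps, (eps = 1 \/ eps = -1) /\
    forall s, Rabs s < delta -> c s = eps * (rho L rho0 theta s * Z s)).
  { apply (coord_c L delta a b c d (rho L rho0 theta) q (fun s => sinh (theta s)) Z
      (fun s => cosh (theta s) * Derive theta s)); try assumption.
    - intros s hs; split.
      + eapply is_derive_eq; [apply (hpr 4%nat s hs); lia | unfold qrhs; simpl; ring].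
      + intros hz;
        (* at a zero of [theta], [k1] reduces to [theta'] *)
        assert (hk := proj1 (proj1 (proj2 hsol) s hs)); unfold k1 in hk.
        rewrite hz in hk; apply Rmult_integral_contrapositive; split.
        * unfold cosh; generalize (exp_pos (theta s)) (exp_pos (- theta s)); lra.
        * unfold Rdiv in hk; lra.
    - intros s hs; eapply is_derive_eq; [apply (hpr 8%nat s hs); lia | unfold qrhs; simpl; ring].
    - intros s hs; unfold q; rewrite <- cosh2_sinh2; field; lra.
    - exact (profile_0 L theta0 a0 b0 rho0 u0 delta theta hL hd hsol 8). }
  destruct Ec as (eps & heps & Ec).
  (* Along an orbit, [<X, n>] and [<X, f>] are constant and [<X, e>] has slope [- <X, n> = r]. *)
  assert (hdt : forall s t v, D (s, t) ->
    is_derive (fun t => ip (X (s, t)) v) t (- ip (X (s, t)) (B v))).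
  { intros s t v hp; eapply is_derive_eq.
    - exact (is_pd_ip i2 X (s, t) _ v (analytic_map_is_vpd D X _ i2 han hp)).
    - rewrite (hX2 _ hp), hskew; reflexivity. }
  assert (hn : forall s t, D (s, t) -> ip (X (s, t)) n = ip (X (s, t0)) n).
  { intros s t [hs ht]; apply (zero_derive_interval J (fun t => ip (X (s, t)) n) t0 t hJ ht0 ht).
    intros x hx; eapply is_derive_eq; [apply hdt; split; assumption |].
    rewrite hBn, ip_zero_r; ring. }
  assert (hf : forall s t, D (s, t) -> ip (X (s, t)) f = ip (X (s, t0)) f).
  { intros s t [hs ht]; apply (zero_derive_interval J (fun t => ip (X (s, t)) f) t0 t hJ ht0 ht).
    intros x hx; eapply is_derive_eq; [apply hdt; split; assumption |].
    rewrite hBf, ip_zero_r; ring. }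
  assert (he : forall s t, D (s, t) -> ip (X (s, t)) e = rho L rho0 theta s * (t - t0)).
  { intros s t hp; assert (hs : Rabs s < delta) by apply hp.
    assert (h : ip (X (s, t)) e - rho L rho0 theta s * (t - t0)
      = ip (X (s, t0)) e - rho L rho0 theta s * (t0 - t0)).
    { apply (zero_derive_interval J (fun t => ip (X (s, t)) e - rho L rho0 theta s * (t - t0))
        t0 t hJ ht0 (proj2 hp)).
      intros x hx; assert (hpx : D (s, x)) by (split; assumption).
      eapply is_derive_eq.
      - apply is_derive_Rminus; [apply (hdt s x e hpx) |].
        apply is_derive_Rmult; [apply is_derive_cst |].
        apply is_derive_Rminus; [apply is_derive_idR | apply is_derive_cst].
      - rewrite hBe, (hn s x hpx); generalize (Ea s hs); unfold a; lra. }
    assert (hb0 : ip (X (s, t0)) e = 0) by exact (Eb s hs).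
    rewrite hb0, Rminus_diag in h; lra. }
  assert (hfin : forall eps f', null_frame n e m f' ->
    (forall v, ip v f' = eps * ip v f) -> (forall s, Rabs s < delta ->
       eps * c s = rho L rho0 theta s * Z s) ->
    forall s t, D (s, t) -> X (s, t) = comb n e m f'
      ((L ^ 2 + (rho L rho0 theta s * (t - t0)) ^ 2 - (rho L rho0 theta s * Z s) ^ 2)
        / (2 * rho L rho0 theta s)) (rho L rho0 theta s * (t - t0))
      (rho L rho0 theta s) (rho L rho0 theta s * Z s)).
  { intros eps' f' hN' hf' hc' s t hp; assert (hs : Rabs s < delta) by apply hp.
    assert (hrp := rho_pos L rho0 theta s hr).
    assert (x3 : - ip (X (s, t)) n = rho L rho0 theta s) by (rewrite (hn s t hp); apply Ea, hs).
    assert (x4 : - ip (X (s, t)) f' = rho L rho0 theta s * Z s)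
      by (rewrite hf', (hf s t hp), <- (hc' s hs); unfold c; ring).
    assert (hXp := nf_expand _ _ _ _ hN' (X (s, t))).
    rewrite x3, x4, (he s t hp) in hXp.
    assert (x1 : - ip (X (s, t)) m = (L ^ 2 + (rho L rho0 theta s * (t - t0)) ^ 2
        - (rho L rho0 theta s * Z s) ^ 2) / (2 * rho L rho0 theta s)).
    { generalize (hAdS _ hp); unfold AdS; rewrite hXp at 1 2; rewrite ip_comb_null by exact hN'.
      intros h; apply (Rmult_eq_reg_r (2 * rho L rho0 theta s)); [| lra].
      unfold Rdiv; rewrite (Rmult_assoc _ (/ (2 * rho L rho0 theta s))), Rinv_l by lra; lra. }
    rewrite x1 in hXp; exact hXp. }
  destruct heps as [-> | ->].
  - exists n, e, m, f; split; [exact hN |]; cbv zeta.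
    apply (hfin 1 f hN); [intros v; ring | intros s hs; rewrite (Ec s hs); ring].
  - exists n, e, m, (opp f); split; [apply null_frame_opp, hN |]; cbv zeta.
    apply (hfin (-1) (opp f) (null_frame_opp _ _ _ _ hN)).
    + intros v; rewrite ip_opp_r; ring.
    + intros s hs; rewrite (Ec s hs); ring.
Qed.

Lemma immersion_unique L theta0 a0 b0 rho0 u0 delta theta (J : R -> Prop) X Y :
  0 < L -> 0 < rho0 -> 0 < delta -> ivp_solution L theta0 a0 b0 delta theta ->
  is_open_interval J ->
  rotational_biharmonic_immersion L delta J (rho L rho0 theta) (lambda L u0 theta) X ->
  rotational_biharmonic_immersion L delta J (rho L rho0 theta) (lambda L u0 theta) Y ->
  exists F : R22 -> R22, AdS_isometry L F /\ forall p, strip delta J p -> Y p = F (X p).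
Proof.
  intros hL hr hd hsol hJ hX hY.
  destruct (proj1 (proj2 hJ)) as [t0 ht0].
  destruct (canonical_form L theta0 a0 b0 rho0 u0 delta theta J t0 X hL hr hd hsol hJ ht0 hX)
    as (n & e & m & f & hN & eX).
  destruct (canonical_form L theta0 a0 b0 rho0 u0 delta theta J t0 Y hL hr hd hsol hJ ht0 hY)
    as (n' & e' & m' & f' & hN' & eY).
  exists (frame_map n e m f n' e' m' f'); split; [apply frame_map_isometry; assumption |].
  intros [s t] hp; rewrite (eX s t hp), (eY s t hp), frame_map_comb by exact hN; reflexivity.
Qed.

(** * Initial data *)

Lemma ivp_solution_restrict L theta0 a0 b0 delta delta' theta : delta' <= delta ->
  ivp_solution L theta0 a0 b0 delta theta -> ivp_solution L theta0 a0 b0 delta' theta.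
Proof.
  intros hd (h1 & h2 & h3); split; [| split; [| exact h3]]; intros s hs.
  - apply h1; lra.
  - apply h2; lra.
Qed.

Lemma H_0 L theta0 a0 b0 delta theta : ivp_solution L theta0 a0 b0 delta theta ->
  H L theta 0 = H_init L theta0 a0 /\ k1 L theta 0 = k1_init L theta0 a0.
Proof.
  intros (_ & _ & e0 & e1 & _); unfold H, k1, H_init, k1_init; rewrite e0, e1; auto.
Qed.

Lemma lambda2_pos_near L theta0 a0 b0 rho0 u0 delta theta :
  0 < L -> 0 < rho0 -> 0 < delta -> ivp_solution L theta0 a0 b0 delta theta ->
  0 < u0 / H_init L theta0 a0 ->
  exists delta', 0 < delta' <= delta /\
    forall s, Rabs s < delta' -> 0 < lambda2 L u0 theta s.
Proof.
  intros hL hr hd hsol hpos.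
  assert (h0 : Rabs 0 < delta) by (rewrite Rabs_R0; exact hd).
  assert (hH0 := proj1 (H_0 _ _ _ _ _ _ hsol)).
  assert (hu0 : u L u0 theta 0 = u0)
    by exact (profile_0 L theta0 a0 b0 rho0 u0 delta theta hL hd hsol 9).
  assert (hn : H L theta 0 <> 0).
  { rewrite hH0; intros e; rewrite e in hpos; unfold Rdiv in hpos.
    rewrite Rinv_0, Rmult_0_r in hpos; lra. }
  assert (hv : 0 < lambda2 L u0 theta 0) by (unfold lambda2; rewrite hu0, hH0; exact hpos).
  assert (hcont : continuous (lambda2 L u0 theta) 0).
  { apply (ex_derive_continuous (lambda2 L u0 theta)); unfold lambda2.
    apply (ex_derive_div (u L u0 theta) (H L theta)); [| | exact hn]; eexists.
    - exact (is_derive_u L theta0 a0 b0 rho0 u0 delta theta hL hr hsol 0 h0).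
    - exact (is_derive_H_profile L theta0 a0 b0 delta theta hL hsol 0 h0). }
  destruct (hcont _ (open_gt 0 _ hv)) as (e & he).
  exists (Rmin delta e); split; [split; [apply Rmin_pos; [exact hd | apply cond_pos] | apply Rmin_l] |].
  intros s hs; apply he.
  change (Rabs (s - 0) < e); rewrite Rminus_0_r.
  eapply Rlt_le_trans; [exact hs | apply Rmin_r].
Qed.

Lemma constant_derive_0 (f : R -> R) (delta c l : R) : 0 < delta ->
  (forall s, Rabs s < delta -> f s = c) -> is_derive f 0 l -> l = 0.
Proof.
  intros hd hf hl; rewrite <- (is_derive_unique _ _ _ hl).
  apply is_derive_unique, (is_derive_ext_loc (fun _ => c)); [| apply is_derive_cst].
  assert (h0 : Rabs 0 < delta) by (rewrite Rabs_R0; exact hd).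
  generalize (locally_Rabs_lt 0 delta h0); apply filter_imp; intros s hs; symmetry; apply hf, hs.
Qed.

Lemma H_nonconstant L theta0 a0 b0 delta theta :
  0 < L -> 0 < delta -> admissible L theta0 a0 b0 -> ivp_solution L theta0 a0 b0 delta theta ->
  ~ (exists c, forall s, Rabs s < delta -> H L theta s = c).
Proof.
  intros hL hd (hk & _ & hH' & _) hsol (c & hc).
  assert (h0 : Rabs 0 < delta) by (rewrite Rabs_R0; exact hd).
  assert (e := constant_derive_0 _ delta c _ hd hc
    (is_derive_H_profile L theta0 a0 b0 delta theta hL hsol 0 h0)).
  rewrite (H'_over_k1_0 L theta0 a0 b0 delta theta hL hd hsol), (proj2 (H_0 _ _ _ _ _ _ hsol)) in e.
  apply hH'; rewrite <- e; field; exact hk.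
Qed.

(** [(lambda^2)' = lambda^2 H' (1/k1 - 1/H)], and no factor vanishes at [0]. *)
Lemma lambda_nonconstant L theta0 a0 b0 rho0 u0 delta theta :
  0 < L -> 0 < rho0 -> 0 < delta -> admissible L theta0 a0 b0 ->
  ivp_solution L theta0 a0 b0 delta theta ->
  (forall s, Rabs s < delta -> 0 < lambda2 L u0 theta s) ->
  ~ (exists c, forall s, Rabs s < delta -> lambda L u0 theta s = c).
Proof.
  intros hL hr hd (hk & hH & hH' & hHk) hsol hlam (c & hc).
  assert (h0 : Rabs 0 < delta) by (rewrite Rabs_R0; exact hd).
  assert (hc2 : forall s, Rabs s < delta -> lambda2 L u0 theta s = c ^ 2).
  { intros s hs; rewrite <- (hc s hs); symmetry.
    unfold lambda; apply pow2_sqrt; left; apply hlam, hs. }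
  assert (e := constant_derive_0 _ delta _ _ hd hc2
    (is_derive_lambda2 L theta0 a0 b0 rho0 u0 delta theta hL hr hsol hlam 0 h0)).
  rewrite (H'_over_k1_0 L theta0 a0 b0 delta theta hL hd hsol) in e.
  destruct (H_0 _ _ _ _ _ _ hsol) as [e1 e2]; rewrite e1, e2 in e.
  assert (hp := hlam 0 h0).
  destruct (Rmult_integral _ _ e) as [e3 | e3]; [lra |].
  destruct (Rmult_integral _ _ e3) as [e4 | e4].
  - apply hH'; replace (H'_init L theta0 a0 b0)
      with (H'_init L theta0 a0 b0 / k1_init L theta0 a0 * k1_init L theta0 a0) by (field; exact hk).
    rewrite e4; ring.
  - apply hHk; replace (H_init L theta0 a0)
      with (k1_init L theta0 a0 + (1 - k1_init L theta0 a0 / H_init L theta0 a0) * H_init L theta0 a0)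
      by (field; exact hH).
    rewrite e4; ring.
Qed.

Lemma continuous_sinh (x : R) : continuous sinh x.
Proof. eapply is_derive_continuous, is_derive_Reals, derivable_pt_lim_sinh. Qed.

Lemma continuous_cosh (x : R) : continuous cosh x.
Proof. eapply is_derive_continuous, is_derive_Reals, derivable_pt_lim_cosh. Qed.

Lemma admissible_open (L : R) :
  open (fun d : R * R * R * R => let '(th, a, b, r) := d in 0 < r /\ admissible L th a b).
Proof.
  apply (open_ext (fun d : R22 => 0 < c3 d /\ (k1_init L (c0 d) (c1 d) <> 0 /\
    H_init L (c0 d) (c1 d) <> 0 /\ H'_init L (c0 d) (c1 d) (c2 d) <> 0 /\
    H_init L (c0 d) (c1 d) - k1_init L (c0 d) (c1 d) <> 0))).
  { intros [[[th a] b] r]; unfold admissible, c0, c1, c2, c3; simpl.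
    split; intros (h1 & h2 & h3 & h4 & h5); repeat split; try assumption; lra. }
  assert (k0 : forall d, continuous c0 d) by (intros d; exact (linear_cont (V := R_NormedModule) c0 d is_linear_c0)).
  assert (k1 : forall d, continuous c1 d) by (intros d; exact (linear_cont (V := R_NormedModule) c1 d is_linear_c1)).
  assert (k2 : forall d, continuous c2 d) by (intros d; exact (linear_cont (V := R_NormedModule) c2 d is_linear_c2)).
  assert (k3 : forall d, continuous c3 d) by (intros d; exact (linear_cont (V := R_NormedModule) c3 d is_linear_c3)).
  assert (kS : forall d, continuous (fun d => sinh (c0 d)) d)
    by (intros d; apply (continuous_comp c0 sinh); [apply k0 | apply continuous_sinh]).
  assert (kC : forall d, continuous (fun d => cosh (c0 d)) d)
    by (intros d; apply (continuous_comp c0 cosh); [apply k0 | apply continuous_cosh]).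
  assert (kp : forall (f g : R22 -> R) d, continuous f d -> continuous g d ->
    continuous (fun d => f d + g d) d)
    by (intros f g d hf hg; exact (continuous_plus (V := R_NormedModule) f g d hf hg)).
  assert (kmi : forall (f g : R22 -> R) d, continuous f d -> continuous g d ->
    continuous (fun d => f d - g d) d)
    by (intros f g d hf hg; exact (continuous_minus (V := R_NormedModule) f g d hf hg)).
  assert (km : forall (f g : R22 -> R) d, continuous f d -> continuous g d ->
    continuous (fun d => f d * g d) d)
    by (intros f g d hf hg; exact (continuous_mult (K := R_AbsRing) f g d hf hg)).
  assert (ko : forall (f : R22 -> R) d, continuous f d -> continuous (fun d => - f d) d)
    by (intros f d hf; exact (continuous_opp (V := R_NormedModule) f d hf)).
  assert (kc : forall (x : R) d, continuous (fun _ : R22 => x) d)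
    by (intros x d; apply continuous_const).
  assert (hk : forall d, continuous (fun d => k1_init L (c0 d) (c1 d)) d)
    by (intros d; unfold k1_init, Rdiv; auto).
  assert (hH : forall d, continuous (fun d => H_init L (c0 d) (c1 d)) d)
    by (intros d; unfold H_init, Rdiv; auto).
  assert (hH' : forall d, continuous (fun d => H'_init L (c0 d) (c1 d) (c2 d)) d)
    by (intros d; unfold H'_init, Rdiv; auto 8).
  assert (hne : forall f : R22 -> R, (forall d, continuous f d) -> open (fun d => f d <> 0)).
  { intros f hf; apply (open_comp f (fun x => x <> 0)); [intros d _; apply hf | apply open_neq]. }
  apply open_and; [apply (open_comp c3 (fun x => 0 < x)); [intros d _; apply k3 | apply open_gt] |].
  apply open_and; [apply (hne _ hk) |].
  apply open_and; [apply (hne _ hH) |].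
  apply open_and; [apply (hne _ hH') |].
  apply (hne (fun d => H_init L (c0 d) (c1 d) - k1_init L (c0 d) (c1 d))); intros d; auto.
Qed.

Theorem theorem5p4 (L theta0 a0 b0 rho0 u0 : R)
    (hL : 0 < L) (hrho0 : 0 < rho0)
    (hadm : admissible L theta0 a0 b0)
    (hu0 : 0 < u0 / H_init L theta0 a0) :
  (* local existence *)
  (exists (delta : R) (theta : R -> R),
     0 < delta /\ ivp_solution L theta0 a0 b0 delta theta) /\
  (* uniqueness of the solution and of the associated functions *)
  (forall (delta1 delta2 : R) (theta1 theta2 : R -> R),
     ivp_solution L theta0 a0 b0 delta1 theta1 ->
     ivp_solution L theta0 a0 b0 delta2 theta2 ->
     forall s : R, Rabs s < Rmin delta1 delta2 ->
       theta1 s = theta2 s /\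
       rho L rho0 theta1 s = rho L rho0 theta2 s /\
       u L u0 theta1 s = u L u0 theta2 s /\
       lambda2 L u0 theta1 s = lambda2 L u0 theta2 s) /\
  (* the immersion attached to the solution *)
  (forall (delta0 : R) (theta : R -> R),
     0 < delta0 -> ivp_solution L theta0 a0 b0 delta0 theta ->
     exists (delta : R) (J : R -> Prop) (X xi : R * R -> R22),
       0 < delta <= delta0 /\ is_open_interval J /\
       (forall s, Rabs s < delta -> 0 < lambda2 L u0 theta s) /\
       rotational_biharmonic_immersion L delta J
         (rho L rho0 theta) (lambda L u0 theta) X /\
       unit_normal_with_shape (strip delta J)
         (k1 L theta) (k2 L theta) (H L theta) X xi) /\
  (* uniqueness of the immersion up to ambient isometry; nonconstancy *)
  (forall (delta : R) (theta : R -> R),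
     0 < delta -> ivp_solution L theta0 a0 b0 delta theta ->
     (forall s, Rabs s < delta -> 0 < lambda2 L u0 theta s) ->
     (forall (J : R -> Prop) (X Y : R * R -> R22),
        is_open_interval J ->
        rotational_biharmonic_immersion L delta J
          (rho L rho0 theta) (lambda L u0 theta) X ->
        rotational_biharmonic_immersion L delta J
          (rho L rho0 theta) (lambda L u0 theta) Y ->
        exists F : R22 -> R22, AdS_isometry L F /\
          forall p, strip delta J p -> Y p = F (X p)) /\
     ~ (exists c : R, forall s, Rabs s < delta -> H L theta s = c) /\
     ~ (exists c : R, forall s, Rabs s < delta -> lambda L u0 theta s = c)) /\
  (* openness of the conditions in the space of initial data (theta0, a0, b0, rho0) *)
  open (fun d : R * R * R * R =>
          let '(th, a, b, r) := d in 0 < r /\ admissible L th a b).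
Proof.
  split; [apply ivp_exists; [exact hL | apply hadm] |].
  split; [intros delta1 delta2 theta1 theta2; apply ivp_unique; assumption |].
  split; [| split].
  - intros delta0 theta hd hsol.
    destruct (lambda2_pos_near L theta0 a0 b0 rho0 u0 delta0 theta hL hrho0 hd hsol hu0)
      as (delta & hdelta & hpos).
    assert (hsol' := ivp_solution_restrict L theta0 a0 b0 delta0 delta theta (proj2 hdelta) hsol).
    eexists delta, (fun _ => True), _, _; split; [exact hdelta |]; split.
    + split; [apply open_true |]; split; [exists 0; exact I | auto].
    + split; [exact hpos |].
      exact (solution_immersion L theta0 a0 b0 rho0 u0 delta theta hL hrho0 hsol' hpos
               (proj1 hdelta)).
  - intros delta theta hd hsol hpos; split; [| split].
    + intros J X Y hJ hX hY.
      exact (immersion_unique L theta0 a0 b0 rho0 u0 delta theta J X Y hL hrho0 hd hsol hJ hX hY).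
    + exact (H_nonconstant L theta0 a0 b0 delta theta hL hd hadm hsol).
    + exact (lambda_nonconstant L theta0 a0 b0 rho0 u0 delta theta hL hrho0 hd hadm hsol hpos).
  - apply admissible_open.
Qed.
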